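(* Let $\pi$ be a set of primes, let $G$ be a finite $\pi$-separable group, and let $N$ be a normal subgroup of $G$. Suppose $2 \in \pi$ or $|G|$ is odd. Assume there exist partial characters $\eta, \xi \in \mathrm{I}_\pi(N)$ such that $\eta$ is $G$-invariant, $\xi$ extends to $\zeta \in \mathrm{I}_\pi(G)$ (i.e. $\zeta_N=\xi$), and $\eta\xi \in \mathrm{I}_{\pi}(N)$. Then the map $\kappa \mapsto \kappa\zeta$ is a bijection from $\mathrm{I}_\pi(G \mid \eta)$ to $\mathrm{I}_\pi(G \mid \eta\xi)$.
   Context: Let $G$ be a finite $\pi$-separable group (one having a normal series each of whose factors is a $\pi$-group or a $\pi'$-group). Let $G^o$ be the set of $\pi$-elements of $G$ (elements whose order is divisible only by primes in $\pi$). For a complex character $\chi$ of $G$, $\chi^o$ denotes the restriction of $\chi$ to $G^o$. A $\pi$-partial character of $G$ is a function on $G^o$ of the form $\chi^o$ for some character $\chi$ of $G$. A $\pi$-partial character is irreducible if it cannot be written as a sum of two $\pi$-partial characters; $\mathrm{I}_\pi(G)$ is the set of irreducible $\pi$-partial characters of $G$. (It is known that $\mathrm{I}_\pi(G)$ is a basis of the space of complex class functions on $G^o$; a partial character $\eta\in \mathrm{I}_\pi(G)$ is a constituent of a $\pi$-partial character if it appears with nonzero coefficient when the latter is written in this basis.) For $N\trianglelefteq G$ and a $\pi$-partial character $\zeta$ of $G$, $\zeta_N$ is the restriction of $\zeta$ to $N^o$. For $\eta\in \mathrm{I}_\pi(N)$, $\mathrm{I}_\pi(G\mid\eta)$ is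 the set of those partial characters in $\mathrm{I}_\pi(G)$ whose restriction to $N$ has $\eta$ as a constituent. Products of partial characters are pointwise; $G$-invariance refers to the conjugation action of $G$ on $\mathrm{I}_\pi(N)$. *)

(* Defs.v *)
From HB Require Import structures.
From mathcomp Require Export all_boot all_order all_algebra all_fingroup.
From mathcomp Require Export all_solvable all_field all_character.

Set Implicit Arguments.
Unset Strict Implicit.
Unset Printing Implicit Defensive.

Import GroupScope GRing.Theory.
Local Open Scope ring_scope.

Section PiPartial.

Variables (gT : finGroupType) (pi : nat_pred).
Implicit Types G H N : {group gT}.

(* [invariant_factor G V U] says that V <| U and that G normalises both, so a
   series from 1 to G for [pi_factor G] consists of normal subgroups of G. *)
Definition pi_factor (G V U : {set gT}) :=
  invariant_factor G V U && (pi.-group (U / V) || pi^'.-group (U / V)).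

Definition pi_separable G : Prop :=
  exists2 s : seq {group gT},
    (pi_factor G).-series 1%G s & last 1%G s = G.

Definition pi_elts G : {set gT} := [set x in G | pi.-elt x].

Lemma pi_elts_normal G : pi_elts G <| G.
Proof.
apply/andP; split; first by apply/subsetP=> x; rewrite inE => /andP[].
apply/subsetP=> y Gy; rewrite inE; apply/subsetP=> _ /imsetP[x + ->].
by rewrite !inE p_eltJ => /andP[Gx ->]; rewrite groupJ.
Qed.

(* A function on the set of pi-elements of G is encoded as its extension by 0
   to a class function on G; this is compatible with sums, products and
   restriction to subgroups. Values in algC suffice for complex characters. *)
Definition pi_restr G (chi : 'CF(G)) : 'CF(G) := '1_(pi_elts G) * chi.

Lemma pi_restrE G (chi : 'CF(G)) x :
  pi_restr chi x = if pi.-elt x then chi x else 0.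
Proof.
rewrite cfunE cfuniE ?pi_elts_normal // inE.
by case: (boolP (x \in G)) => [_|/cfun0->]; case: ifP; rewrite ?(mulr0, mul1r, mul0r).
Qed.

(* [character] contains the zero class function, which is not the character of
   a (nonzero) representation and must be excluded here: otherwise the
   decomposition phi = phi + 0 would make every partial character reducible. *)
Definition pi_partial_char G (phi : 'CF(G)) : Prop :=
  exists chi : 'CF(G),
    [/\ chi \is a character, chi != 0 & phi = pi_restr chi].

Definition pi_irr G (phi : 'CF(G)) : Prop :=
  pi_partial_char phi /\
  ~ (exists phi1 phi2 : 'CF(G),
       [/\ pi_partial_char phi1, pi_partial_char phi2 & phi = phi1 + phi2]).

(* For pi-separable G, [pi_irr] is a basis of the class functions on the
   pi-elements of G, so the expansion below is unique up to reordering and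
   zero coefficients. *)
Definition pi_constituent G (eta phi : 'CF(G)) : Prop :=
  exists (s : seq 'CF(G)) (a : 'CF(G) -> algC),
    [/\ uniq s, {in s, forall psi, pi_irr psi},
        phi = \sum_(psi <- s) a psi *: psi, eta \in s & a eta != 0].

Definition pi_irr_over G N (eta : 'CF(N)) (kappa : 'CF(G)) : Prop :=
  pi_irr kappa /\ pi_constituent eta ('Res[N] kappa).

End PiPartial.

(* Main.v *)
(* Proof idea. Along a chain of normal subgroups of G whose factors are
   pi-groups or pi'-groups, one builds for each partial character eta in I_pi(N)
   an ordinary irreducible lift, with the same stabiliser and fixed by a Galois
   automorphism u which is trivial on pi-roots of unity and inverts pi'-roots of
   unity, together with a dual (Fong) character of a pi-subgroup; the dual
   characters show that I_pi(N) is linearly independent. Odd pi'-factors enter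
   because a u-invariant character has then a unique u-invariant extension.

   For M/K a pi'-group, restriction identifies I_pi(M) with the M-orbits on
   I_pi(K), and the correspondence is one of orbits. For M/K a pi-group, Frobenius
   reciprocity holds for partial characters. If e and e' are the multiplicities
   of mu in kappa_K and of mu zeta_K in psi_K, and m the multiplicities of psi in
   kappa zeta, then e = m e' by Clifford's theorem and e' = m^T e because
   mu^M zeta = (mu zeta_K)^M; nonnegative integer matrices with this property are
   permutation matrices. The general case follows by induction along the chain,
   for a weaker hypothesis than invariance of eta, see [same_inertia]. *)

From HB Require Import structures.
From mathcomp Require Import ring boolp.
Require Import Defs.
Set Implicit Arguments.
Unset Strict Implicit.
Unset Printing Implicit Defensive.

Import Order.TTheory GroupScope GRing.Theory Num.Theory.
Local Open Scope ring_scope.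

(** Pairing with a character of a pi-group H sees only values at pi-elements. Such pairings are
    therefore functionals on partial characters, available before any basis is known. A lift with
    the same stabiliser as its partial character makes ordinary Clifford theory and that of partial
    characters agree.

    For a pi-factor N/M, restriction to H matches the characters of N over a lift with characters of
    H; this uses the same matrix argument as the final correspondence. It gives independence of the
    restrictions. That they also span is a dimension count made one coset of M at a time, where a
    trace formula equates invariant partial characters with classes of pi-elements.

    For a pi'-factor, uniqueness of the u-fixed extension transfers invariance from a character to
    its extension. An odd quotient is solvable by the odd order theorem, but that theorem is
    avoided: extensions are built over solvable subquotients only and glued with Solomon's induction
    theorem. *)

(** Substituting one equation into the other at a nonzero entry gives
    [e i = m i j ^+ 2 * e i + m i j * S + R], where [R] and [S] collect the rest of row [i] and of
    column [j]. Every term is nonnegative and [m i j] is at least 1, so [m i j = 1] and both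
    remainders vanish. *)
Lemma nat_matrix_perm (I J : eqType) (A : seq I) (B : seq J)
    (m : I -> J -> algC) (e : I -> algC) (f : J -> algC) :
    uniq A -> uniq B -> {in A & B, forall i j, m i j \in Num.nat} ->
    {in A, forall i, 0 < e i} -> {in B, forall j, 0 < f j} ->
    {in A, forall i, e i = \sum_(j <- B) m i j * f j} ->
    {in B, forall j, f j = \sum_(i <- A) m i j * e i} ->
  {in A, forall i, exists2 j, j \in B &
    [/\ m i j = 1, {in A, forall i', i' != i -> m i' j = 0}
      & {in B, forall j', j' != j -> m i j' = 0}]}.
Proof.
move=> uA uB Nm e_gt0 f_gt0 De Df i Ai.
have m_ge0: {in A & B, forall i1 j1, 0 <= m i1 j1} by move=> i1 j1 *; rewrite natr_ge0 ?Nm.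
have [j Bj nz_mij]: exists2 j, j \in B & m i j != 0.
  apply/hasP; apply: contraTT (e_gt0 i Ai) => /hasPn mi0.
  rewrite De // big_seq big1 ?ltxx // => j /mi0.
  by rewrite negbK => /eqP->; rewrite mul0r.
exists j => //.
have m_ge1: 1 <= m i j.
  by move: nz_mij; have /natrP[n ->] := Nm i j Ai Bj; rewrite pnatr_eq0 ler1n lt0n.
pose R := \sum_(j' <- B | j' != j) m i j' * f j'.
pose S := \sum_(i' <- A | i' != i) m i' j * e i'.
have DR: e i = m i j * f j + R by rewrite De // (bigD1_seq j).
have DS: f j = m i j * e i + S by rewrite Df // (bigD1_seq i).
have R_ge0: 0 <= R.
  rewrite /R big_seq_cond sumr_ge0 // => j' /andP[Bj' _].
  by rewrite mulr_ge0 ?m_ge0 // ltW // f_gt0.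
have S_ge0: 0 <= S.
  rewrite /S big_seq_cond sumr_ge0 // => i' /andP[Ai' _].
  by rewrite mulr_ge0 ?m_ge0 // ltW // e_gt0.
have: (m i j ^+ 2 - 1) * e i + (m i j * S + R) = 0.
  by apply: (addIr (e i)); rewrite add0r [in RHS]DR DS; ring.
have ei_ge0: 0 <= e i by rewrite ltW ?e_gt0.
have m2_ge0: 0 <= m i j ^+ 2 - 1 by rewrite subr_ge0 exprn_ege1.
move/eqP; rewrite !paddr_eq0 ?addr_ge0 ?mulr_ge0 ?m_ge0 //.
rewrite !mulf_eq0 (negPf nz_mij) (gt_eqF (e_gt0 i Ai)) orbF subr_eq0 /=.
rewrite sqrf_eq1 => /and3P[/orP[/eqP mij1 | /eqP mijN] /eqP S0 /eqP R0]; last first.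
  by move: (lt_le_trans ltr01 m_ge1); rewrite mijN oppr_gt0 ltr10.
split=> // [i' Ai' ne_i'i | j' Bj' ne_j'j].
  move/eqP: S0; rewrite /S big_seq_cond psumr_eq0; last first.
    by move=> k /andP[Ak _]; rewrite mulr_ge0 ?m_ge0 // ltW // e_gt0.
  move/allP/(_ i' Ai'); rewrite Ai' ne_i'i /= mulf_eq0.
  by rewrite (gt_eqF (e_gt0 _ Ai')) orbF => /eqP.
move/eqP: R0; rewrite /R big_seq_cond psumr_eq0; last first.
  by move=> k /andP[Bk _]; rewrite mulr_ge0 ?m_ge0 // ltW // f_gt0.
move/allP/(_ j' Bj'); rewrite Bj' ne_j'j /= mulf_eq0.
by rewrite (gt_eqF (f_gt0 _ Bj')) orbF => /eqP.
Qed.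

Lemma cfdot_Res_on (gT : finGroupType) (G H K : {group gT}) (phi psi : 'CF(G)) :
    H \subset G -> K \subset H -> phi \in 'CF(G, K :|: ~: H) ->
  '['Res[H] phi, 'Res[H] psi]
     = #|K|%:R / #|H|%:R * '['Res[K] phi, 'Res[K] psi].
Proof.
move=> sHG sKH Kphi; rewrite !cfdotE [RHS]mulrA [_ / _ / _]mulrAC divff ?neq0CG // mul1r.
congr (_ * _).
rewrite (big_setID K) /= (setIidPr sKH) [X in _ + X]big1 ?addr0 => [|x]; last first.
  case/setDP=> Hx K'x; rewrite !cfResE // (cfun_on0 Kphi) ?mul0r //.
  by rewrite !inE (negPf K'x) Hx.
apply: eq_bigr => x Kx; have Hx := subsetP sKH x Kx.
by rewrite !cfResE // (subset_trans sKH).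
Qed.

(** * Restriction to a supplement *)

Section TripleRestriction.

Variables (gT : finGroupType) (N M H : {group gT}).
Variables (t : Iirr M) (a : Iirr (H :&: M)).
Local Notation theta := 'chi_t.
Local Notation alpha := 'chi_a.
Hypotheses (nsMN : M <| N) (sHN : H \subset N).
Hypothesis (defT : 'I_N[theta] = (H * M)%g).
Hypothesis (IHa : H \subset 'I[alpha]).
Hypothesis dot_a : {in (theta ^: N)%CF, forall xi,
  '['Res[H :&: M] xi, alpha] = (xi == theta)%:R}.

Let sMN := normal_sub nsMN.
Let nsH0H : H :&: M <| H.
Proof. by rewrite /normal subsetIl normsI ?normG // (subset_trans sHN) ?normal_norm. Qed.

(** By Clifford's theorem ['chi_i] restricts to [M] as a multiple of the sum of the conjugates of
    [theta], and among these only [theta] meets [alpha]. *)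
Lemma triple_restriction_mult i :
    i \in irr_constt ('Ind[N] theta) ->
  '['Res[H :&: M] 'chi_i, alpha] = '['Res[M] 'chi_i, theta].
Proof.
rewrite constt_Ind_Res => tMi.
rewrite -(cfResRes _ (subsetIr H M)) //.
rewrite [in LHS](Clifford_Res_sum_cfclass nsMN tMi) linearZ cfdotZl linear_sum.
rewrite cfdot_suml (bigD1_seq theta) ?cfclass_refl ?cfclass_uniq //=.
rewrite dot_a ?cfclass_refl // eqxx big1_seq ?addr0 ?mulr1 // => xi.
by case/andP=> /negPf ne xiM; rewrite dot_a ?ne.
Qed.

(** [nat_matrix_perm] applies with the multiplicities of [theta] and of [alpha] as weights. One
    equation is [triple_restriction_mult]; the other pairs the restriction to [H] of the character
    induced from [theta] with ['chi_j], and reduces to the order formula for the product [H * M]. *)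
Lemma triple_restriction :
    let X := enum (irr_constt ('Ind[N] theta)) in
    let Y := enum (irr_constt ('Ind[H] alpha)) in
    let m i j := '['Res[H] 'chi[N]_i, 'chi[H]_j] in
  {in X, forall i, exists2 j, j \in Y &
    [/\ m i j = 1, {in X, forall i', i' != i -> m i' j = 0}
      & {in Y, forall j', j' != j -> m i j' = 0}]}.
Proof.
move=> X Y m.
pose e (i : Iirr N) := '['Res[M] 'chi_i, theta].
pose f (j : Iirr H) := '['Res[H :&: M] 'chi_j, alpha].
have [sH0H sH0M] := (subsetIl H M, subsetIr H M).
have XE (i : Iirr N): (i \in X) = (e i != 0) by rewrite mem_enum constt_Ind_Res inE.
have YE (j : Iirr H): (j \in Y) = (f j != 0) by rewrite mem_enum constt_Ind_Res inE.
have Ne (i : Iirr N): e i \in Num.nat by rewrite Cnat_cfdot_char ?cfRes_char ?irr_char.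
have Nf (j : Iirr H): f j \in Num.nat by rewrite Cnat_cfdot_char ?cfRes_char ?irr_char.
have Nm (i : Iirr N) (j : Iirr H): m i j \in Num.nat by rewrite Cnat_cfdot_char ?cfRes_char ?irr_char.
have e_gt0: {in X, forall i, 0 < e i}.
  by move=> i; rewrite XE => nz; rewrite lt0r nz natr_ge0.
have f_gt0: {in Y, forall j, 0 < f j}.
  by move=> j; rewrite YE => nz; rewrite lt0r nz natr_ge0.
apply: (nat_matrix_perm (e := e) (f := f)); rewrite ?enum_uniq //.
  move=> i; rewrite mem_enum => Xi.
  rewrite /e -triple_restriction_mult // -(cfResRes _ sH0H) //.
  rewrite ['Res[H] _]cfun_sum_cfdot linear_sum cfdot_suml big_enum.
  rewrite [RHS]big_mkcond; apply: eq_bigr => j _ /=.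
  rewrite linearZ cfdotZl; case: ifPn => //.
  by rewrite -mem_enum YE negbK => /eqP f0; rewrite -/(f j) f0 mulr0.
move=> j Yj; have := Yj; rewrite YE => nz_fj.
have DjH0: 'Res[H :&: M] 'chi_j = f j *: alpha.
  have aj: a \in irr_constt ('Res[H :&: M] 'chi_j) by rewrite inE.
  rewrite (Clifford_Res_sum_cfclass nsH0H aj) cfclass_invariant ?big_seq1 //.
transitivity '['Res[H] ('Ind[N] theta), 'chi_j]; last first.
  rewrite ['Ind[N] _]cfun_sum_constt linear_sum cfdot_suml big_enum /=.
  apply: eq_bigr => i _; rewrite linearZ cfdotZl mulrC /e cfdot_Res_l.
  congr (_ * _); rewrite cfdotC conj_natr //.
  by rewrite Cnat_cfdot_char ?cfInd_char ?irr_char.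
have ->: 'chi_j = 'Res[H] 'chi_j by rewrite cfRes_id.
(* The induced character vanishes off [M], so the inner product over [H] becomes one over [H :&: M],
   where ['chi_j] is a multiple of [alpha]. *)
rewrite -['Res[H] ('Ind _)]cfRes_id (cfdot_Res_on (K := (H :&: M)%G)) //; last first.
  apply/cfun_onP=> x; rewrite !inE negb_or negb_and negbK => /andP[H0'x Hx].
  rewrite cfResE // (cfun_on0 (cfInd_normal _ nsMN)) //.
  by move: H0'x; rewrite Hx.
rewrite cfResRes // DjH0 cfdotZr conj_natr // mulrCA -[LHS]mulr1; congr (_ * _).
rewrite -(cfResRes _ sH0M) // cfResInd // !linearZ cfdotZl linear_sum cfdot_suml.
rewrite (eq_bigr (fun y => (y \in 'I_N[theta])%:R)) => [|y Ny]; last first.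
  rewrite dot_a; last by apply/cfclassP; exists y.
  by rewrite inE Ny inE (subsetP (normal_norm nsMN)).
have ->: \sum_(y in N) (y \in 'I_N[theta])%:R = #|(H * M)%g|%:R :> algC.
  rewrite -natr_sum -defT -sum1_card; congr _%:R; rewrite [RHS]big_mkcond.
  rewrite [LHS]big_mkcond; apply: eq_bigr => y _; rewrite inE.
  by case: (y \in N) => //; case: (y \in _).
have := mul_cardG H M => /(congr1 (fun n => n%:R : algC)); rewrite !natrM => Dc.
have [nzH nzM]: #|H|%:R != 0 :> algC /\ #|M|%:R != 0 :> algC by rewrite !neq0CG.
have := congr1 (fun z => z / #|H|%:R / #|M|%:R) Dc => /= Dc'.
transitivity (#|H|%:R * #|M|%:R / #|H|%:R / #|M|%:R : algC); last by rewrite Dc'; ring.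
by field; rewrite nzM.
Qed.

End TripleRestriction.

(** * Extension of invariant characters *)

(* Choose A inducing conjugation by x on a representation X of N; rescaling A
   so that A ^+ n = X (x ^+ n)%g for the order n of x modulo N makes
   g |-> X (g * x ^- i)%g * A ^+ i a representation of G. *)
Lemma cyclic_invariant_irr_extendible (gT : finGroupType) (G N : {group gT}) s :
    N <| G -> cyclic (G / N)%g -> G \subset 'I['chi[N]_s] ->
  exists t, 'Res[N, G] 'chi_t = 'chi_s.
Proof.
move=> nsNG /cyclicP[xb defGb] IGs; have [sNG nNG] := andP nsNG.
have [x nNx [Gx Dxb]]: exists2 x, x \in 'N(N) & x \in G /\ xb = coset N x.
  have: xb \in (G / N)%g by rewrite defGb cycle_id.
  by case/morphimP=> x Nx Gx ->; exists x.

have modNx g: g \in G -> exists i, (g * x ^- i)%g \in N.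
  move=> Gg; have: coset N g \in <[xb]> by rewrite -defGb mem_quotient.
  case/cycleP=> i; rewrite Dxb -morphX // => /eqP eq_gx; exists i.
  have nNg := subsetP nNG g Gg.
  apply: coset_idr; first by rewrite groupM ?groupV ?groupX.
  by rewrite morphM ?groupV ?groupX //= morphV ?groupX // (eqP eq_gx) mulgV.
have [[d' X] irrX DX] := irr_reprP (mem_irr s); simpl in X, irrX, DX.
have d_gt0: (0 < d')%N by have [] := (mx_irrP X).1 irrX.
case: d' X irrX DX d_gt0 => // d X irrX DX _.
have absX: mx_absolutely_irreducible X by apply: groupC.
pose Y (m : gT) := X (m ^ x^-1)%g.
have nNxV m : ((m ^ x^-1)%g \in N) = (m \in N) by rewrite memJ_norm ?groupV.
have Yrep: mx_repr N Y.
  split=> [|m1 m2 Nm1 Nm2]; first by rewrite /Y conj1g repr_mx1.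
  by rewrite /Y conjMg repr_mxM ?nNxV.
(* Invariance of the character makes [X] similar to its conjugate [Y]; the inverse of the similarity
   is the wanted matrix up to a scalar. *)
have /cfRepr_rsimP[B _ freeB defB]: cfRepr X == cfRepr (MxRepresentation Yrep).
  apply/eqP/cfun_inP=> m Nm; have Nmx: (m ^ x^-1)%g \in N by rewrite nNxV.
  transitivity (cfRepr X (m ^ x^-1)%g); last by rewrite !cfunE Nm Nmx.
  by rewrite -DX inertia_valJ // (subsetP IGs) ?groupV.
rewrite row_free_unit in freeB; pose A0 := B^-1.
have uA0: A0 \is a GRing.unit by rewrite unitrV.
have A0X m: m \in N -> A0 * X m = X (m ^ x^-1)%g * A0.
  move=> Nm; apply: (mulrI freeB); rewrite mulVKr // mulrA.
  by rewrite -[B * _]defB // mulmxE mulrK.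
pose n := #[xb].
have Nxn: (x ^+ n)%g \in N.
  by apply: coset_idr; rewrite ?groupX // morphX //= -Dxb expg_order.
have n_gt0: (n > 0)%N by apply: order_gt0.
have AexpX A: (forall m, m \in N -> A * X m = X (m ^ x^-1)%g * A) ->
  forall i m, m \in N -> A ^+ i * X m = X (m ^ (x ^- i))%g * A ^+ i.
- move=> AX; elim=> [|i IHi] m Nm; first by rewrite invg1 conjg1 mul1r mulr1.
  rewrite exprSr -mulrA AX // mulrA IHi ?nNxV // -conjgM -mulrA -exprSr.
  by rewrite -invMg -expgSr expgS.
(* Schur's lemma: [A0 ^+ n] and [X (x ^+ n)%g] induce the same conjugation on the image of [X]. *)
have /is_scalar_mxP[c Dc]: is_scalar_mx ((X (x ^+ n)%g)^-1 * A0 ^+ n).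
  apply: (mx_abs_irr_cent_scalar absX); apply/centgmxP=> m Nm.
  rewrite mulmxE -mulrA (AexpX _ A0X) // !mulrA; congr (_ * _).
  rewrite conjgE invgK !repr_mxMr ?repr_mxVr ?groupM ?groupV //.
  by rewrite !mulrA mulVr ?mul1r // repr_mx_unitr.
have uXn: X (x ^+ n)%g \is a GRing.unit by apply: repr_mx_unitr.
have DA0n: A0 ^+ n = c%:M * X (x ^+ n)%g.
  have := congr1 (fun Z => X (x ^+ n)%g * Z) Dc; rewrite /= mulVKr // => ->.
  by rewrite -!mulmxE scalar_mxC.
have nz_c: c != 0.
  apply: contraTneq (unitrX n uA0) => c0.
  by rewrite DA0n c0 -scalemx1 scale0r mul0r unitr0.
pose r := (n.-root c)%R; have Dr: r ^+ n = c by rewrite rootCK.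
have nz_r: r != 0 by apply: contraNneq nz_c => r0; rewrite -Dr r0 expr0n gtn_eqF.
pose A := r^-1 *: A0.
have AX m: m \in N -> A * X m = X (m ^ x^-1)%g * A.
  by move=> Nm; rewrite -scalerAl A0X // scalerAr.
have DAn: A ^+ n = X (x ^+ n)%g.
  by rewrite exprZn DA0n exprVn Dr -mulmxE mul_scalar_mx scalerA mulVf // scale1r.
(* Two exponents that suit the same [g] differ by a multiple [k] of [n], for which
   [A ^+ k = X (x ^+ k)%g]. *)
have wd g i j: (g * x ^- i)%g \in N -> (g * x ^- j)%g \in N ->
  X (g * x ^- i)%g * A ^+ i = X (g * x ^- j)%g * A ^+ j.
- wlog le_ij: i j / (i <= j)%N => [IH Ni Nj|].
    by have [/IH | /ltnW/IH] := leqP i j; [apply | move=> ->].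
  rewrite -(subnK le_ij); move: (j - i)%N => k Ni Nj.
  have Dgi: (g * x ^- i = g * x ^- (k + i) * x ^+ k)%g.
    by rewrite expgD invMg mulgA mulgKV.
  have Nxk: (x ^+ k)%g \in N by rewrite -(groupMl _ Nj) -Dgi.
  have /dvdnP[q Dk]: (n %| k)%N.
    by rewrite order_dvdn Dxb -morphX //= coset_id.
  have DAk: A ^+ k = X (x ^+ k)%g.
    by rewrite Dk mulnC expgM exprM DAn -repr_mxX.
  by rewrite Dgi repr_mxMr // -DAk exprD mulrA.
have /fin_all_exists[idx idxP] g: exists i, g \in G -> (g * x ^- i)%g \in N.
  by case: (boolP (g \in G)) => [/modNx[i] | _]; [exists i | exists 0%N].
pose R g := X (g * x ^- idx g)%g * A ^+ idx g.
have RE g i : g \in G -> (g * x ^- i)%g \in N -> R g = X (g * x ^- i)%g * A ^+ i.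
  by move=> Gg Ni; apply: wd; rewrite ?idxP.
have Rrep: mx_repr G R.
  split=> [|g h Gg Gh].
    by rewrite (RE 1%g 0%N) ?invg1 ?mulg1 // repr_mx1 mulr1.
  have [Ng Nh] := (idxP g Gg, idxP h Gh).
  set i := idx g in Ng; set j := idx h in Nh.
  have Dgh: (g * h * x ^- (i + j) = (g * x ^- i) * (h * x ^- j) ^ (x ^- i))%g.
    by rewrite conjgE invgK expgD invMg !mulgA mulgKV.
  have Nhi: ((h * x ^- j) ^ (x ^- i))%g \in N by rewrite memJ_norm // groupV groupX.
  have -> : R (g * h)%g = X (g * h * x ^- (i + j))%g * A ^+ (i + j).
    by apply: RE; [apply: groupM | rewrite Dgh groupM].
  rewrite Dgh repr_mxMr // exprD.
  by rewrite -/(R g) /R -/i -/j mulmxE -!mulrA; congr (_ * _); rewrite !mulrA (AexpX _ AX).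
have ResR: 'Res[N] (cfRepr (MxRepresentation Rrep)) = 'chi_s.
  apply/cfun_inP=> m Nm; have Gm := subsetP sNG m Nm.
  rewrite cfResE // DX !cfunE Nm Gm /= (RE m 0%N) ?invg1 ?mulg1 //.
  by rewrite mulr1.
have /irrP[t Dt]: cfRepr (MxRepresentation Rrep) \in irr G.
  by apply: (@cfRes_irr_irr _ G N); rewrite ?cfRepr_char // ResR mem_irr.
by exists t; rewrite -Dt.
Qed.

(** * Solomon's induction theorem *)

Section Solomon.

Variables (gT : finGroupType) (G : {group gT}).
Implicit Types (K : {group gT}) (x : gT).

Lemma cfInd1_fix_rcosets K x :
  K \subset G -> 'Ind[G, K] 1 x = #|'Fix_(rcosets K G | 'Rs)[x]|%:R.
Proof.
move=> sKG; rewrite cfIndE // (reindex_inj invg_inj) /=.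
rewrite (eq_bigl [in G]) => [|y]; last by rewrite /= groupV.
pose F (A : {set gT}) : algC := (A :* x == A)%:R.
rewrite (eq_bigr (fun y => F (K :* y)%g)) => [|y Gy]; last first.
  rewrite cfun1E /F -rcosetM (sameP eqP rcoset_eqP) mem_rcoset.
  by rewrite conjgE invgK mulgA.
rewrite (set_partition_big _ (rcosets_partition sKG)) /=.
rewrite (eq_bigr (fun A => #|K|%:R * F A)) => [|_ /rcosetsP[z Gz ->]]; last first.
  rewrite (eq_bigr (fun=> F (K :* z)%g)) => [|y /rcoset_eqP-> //].
  by rewrite sumr_const card_rcoset mulr_natl.
rewrite -mulr_sumr mulKf ?neq0CG // -sum1_card natr_sum.
rewrite [RHS](eq_bigl (fun A => (A \in rcosets K G) && (A :* x == A))).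
  by rewrite [RHS]big_mkcondr; apply: eq_bigr => A _; rewrite /F; case: eqP.
by move=> A; rewrite inE (sameP afix1P eqP) /= rcosetE.
Qed.

(** [K] is the product of the p'-part [C] of [<[x]>] with a Sylow p-subgroup of the normaliser [L]
    of [C] that contains the p-part of [x]. The value is a number of fixed cosets, congruent modulo
    [p] to [#|L : K|]. *)
Lemma quasi_elementary_cfInd1 (p : nat) x : prime p -> x \in G ->
  exists2 K : {group gT}, K \subset G /\ solvable K
    & exists2 m, 'Ind[G, K] 1 x = m%:R & ~~ (p %| m)%N.
Proof.
move=> p_pr Gx; pose xp := (x.`_p)%g; pose xp' := (x.`_p^')%g.
have Gxp: xp \in G by apply: groupX.
have Gxp': xp' \in G by apply: groupX.
pose C := <[xp']>%G; pose L := 'N_G(C)%G.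
have sCG: C \subset G by rewrite cycle_subG.
have nsCL: C <| L by rewrite /normal subsetIr subsetI sCG normG.
have Lxp: xp \in L.
  rewrite inE Gxp; apply: subsetP (cent_sub _) _ _; rewrite cent_cycle.
  by apply/cent1P; rewrite /commute /xp /xp' /constt -!expgD addnC.
have [||P sylP sxpP] := @Sylow_superset p _ L <[xp]>%G.
- by rewrite cycle_subG.
- by apply: p_elt_constt.
have [sPL pP _] := and3P sylP.
have nCP: P \subset 'N(C) by apply: subset_trans sPL (subsetIr _ _).
pose K := (C <*> P)%G; have defK: K = (C * P)%g :> {set gT} by apply: norm_joinEr.
have sKL: K \subset L by rewrite join_subG normal_sub.
have sLG: L \subset G by apply: subsetIl.
have sKG: K \subset G by apply: subset_trans sLG.
have nsCK: C <| K by apply: normalS nsCL => //; apply: joing_subl.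
have hallC: p^'.-Hall(K) C.
  rewrite /pHall joing_subl [p^'.-group C]p_elt_constt /= defK indexMg.
  rewrite (eq_pnat _ (negnK _)); exact: pnat_dvd (dvdn_indexg _ _) pP.
exists K; [split=> // | exists #|'Fix_(rcosets K G | 'Rs)[x]|].
- rewrite (series_sol nsCK) abelian_sol ?cycle_abelian //= defK quotientMidl.
  exact/quotient_sol/(pgroup_sol pP).
- exact: cfInd1_fix_rcosets.
(* If [x] fixes the coset of [z], the conjugate of its p'-part lies in the normal Hall subgroup [C]
   of [K], so [z] normalises [C]. Conversely the p'-part of [x] fixes every coset inside [L]. *)
have ->: 'Fix_(rcosets K G | 'Rs)[x] = 'Fix_(rcosets K L | 'Rs)(<[xp]>).
  rewrite afix_cycle; apply/setP=> A; rewrite !in_setI.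
  have fixE z y : ((K :* z)%g \in 'Fix_'Rs[y]) = ((y ^ z^-1)%g \in K).
    rewrite (sameP afix1P eqP) /= rcosetE -rcosetM.
    by rewrite (sameP eqP rcoset_eqP) mem_rcoset conjgE invgK mulgA.
  apply/andP/andP=> [[/rcosetsP[z Gz ->]] | [/rcosetsP[z Lz ->]]].
    rewrite !fixE => Kxz; have Kp i: ((x ^+ i) ^ z^-1)%g \in K by rewrite conjXg groupX.
    split; last by apply: Kp.
    apply/rcosetsP; exists z => //; rewrite inE Gz -groupV inE /= -cycleJ cycle_subG.
    by rewrite (mem_normal_Hall hallC nsCK) ?Kp // p_eltJ p_elt_constt.
  rewrite !fixE => Kxpz; have [Gz nCz] := setIP Lz; split.
    by apply/rcosetsP; exists z.
  rewrite -(consttC p x) conjMg groupM // (subsetP (joing_subl _ _)) //.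
  by rewrite memJ_norm ?groupV ?cycle_id.
have acts_xp: [acts <[xp]>, on rcosets K L | 'Rs].
  apply: subset_trans (actsRs_rcosets _ _); by rewrite cycle_subG.
have p_xp: p.-group <[xp]> by apply: p_elt_constt.
rewrite /dvdn -(pgroup_fix_mod p_xp acts_xp) -/(dvdn _ _).
rewrite -[#|_|]/#|L : K| -p'natE ?indexg_gt0 //.
by case/and3P: sylP => _ _; apply: pnat_dvd; apply: indexgS; apply: joing_subr.
Qed.

(** [S] is not assumed to contain constants, so [1] is obtained as [1 - \prod (1 - r x)]: the
    product vanishes everywhere, and the expansion has no constant term. [S] is abstract so that it
    may speak of products with a fixed class function. *)
Lemma Solomon_induction (S : 'CF(G) -> Prop) :
    (forall f g, S f -> S g -> S (f - g)) ->
    (forall f g, S f -> S g -> S (f * g)) ->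
    (forall K, K \subset G -> solvable K -> S ('Ind[G, K] 1)) ->
  S 1.
Proof.
move=> S_B S_M S_Ind.
have S0: S 0.
  have := S_Ind 1%G (sub1G G) (solvable1 _) => S1.
  by rewrite -(subrr ('Ind[G, 1%G] 1)); apply: S_B.
have S_N f : S f -> S (- f) by rewrite -sub0r; apply: S_B.
have S_D f g : S f -> S g -> S (f + g).
  by move=> Sf Sg; rewrite -[g]opprK; apply: S_B => //; apply: S_N.
have S_n f n : S f -> S (f *+ n).
  by move=> Sf; elim: n => // n IHn; rewrite mulrS; apply: S_D.
have ex_r x : x \in G -> exists2 r, S r & r x = 1.
  move=> Gx.
  have [K [sKG solK] [m Dm m_odd]] := quasi_elementary_cfInd1 (isT : prime 2) Gx.
  have m_gt0: (0 < m)%N by case: m m_odd {Dm}.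
  move/(S_Ind K sKG): solK; move: ('Ind[G] 1) Dm => r Dm Sr.
  (* Descent on the value [d] at [x]: for a prime [p] dividing [d], a quasi-elementary subgroup
     gives a value [m] prime to [p], and [m %% d] is nonzero and smaller than [d]. *)
  elim/ltn_ind: m r Sr Dm m_gt0 {m_odd K sKG} => d IHd r Sr Dr d_gt0.
  have [d_le1 | d_gt1] := leqP d 1.
    by exists r => //; rewrite Dr; case: d d_gt0 d_le1 {IHd Dr} => // -[].
  have [p_pr p_d] := (pdiv_prime d_gt1, pdiv_dvd d).
  have [K [sKG solK] [m Dm p'm]] := quasi_elementary_cfInd1 p_pr Gx.
  apply: (IHd (m %% d)%N (ltn_pmod _ _) ('Ind[G, K] 1 - r *+ (m %/ d)%N)) => //.
  - by apply: S_B; [apply: S_Ind | apply: S_n].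
  - rewrite !cfunE Dm -scaler_nat cfunE Dr {1}(divn_eq m d) natrD natrM.
    by rewrite addrC addKr.
  by rewrite lt0n; apply: contra p'm; apply: dvdn_trans.
have{ex_r} /fin_all_exists2[r Sr r1] x : exists2 r, S r & x \in G -> r x = 1.
  by case: (boolP (x \in G)) => [/ex_r[r] | _]; [exists r | exists 0].
suffices: S (1 - \prod_(x <- enum G) (1 - r x)).
  suffices -> : \prod_(x <- enum G) (1 - r x) = 0 by rewrite subr0.
  apply/cfun_inP=> x Gx; rewrite (big_rem x) ?mem_enum //= !cfunE cfun1E Gx r1 //.
  by rewrite subrr mul0r.
elim: (enum G) => [|x s IHs]; first by rewrite big_nil subrr.
rewrite big_cons; set P := \prod_(y <- s) _ in IHs *.
have ->: 1 - (1 - r x) * P = r x - r x * (1 - P) + (1 - P) by ring.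
by apply: S_D => //; apply: S_B => //; apply: S_M.
Qed.

End Solomon.

(** * Extensions fixed by a Galois automorphism *)

Section FixedExtension.

Variables (gT : finGroupType) (u : {rmorphism algC -> algC}).
Variables (L N : {group gT}) (theta : 'CF(N)).
Hypotheses (nsNL : N <| L) (oddLN : odd #|L : N|).
Hypothesis u_inv : forall z : algC, z ^+ #|L : N| = 1 -> u z = z^-1.
Hypotheses (irr_theta : theta \in irr N) (ILtheta : L \subset 'I[theta]).
Hypothesis u_theta : cfAut u theta = theta.

Definition fixed_extension (K : {group gT}) (chi : 'CF(K)) : Prop :=
  [/\ chi \in irr K, 'Res[N] chi = theta & cfAut u chi = chi].

Lemma lin_char_mod_index (K : {group gT}) (mu : 'CF(K)) :
    N <| K -> mu \is a linear_char -> N \subset cfker mu ->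
  mu ^+ #|K : N| = 1.
Proof.
move=> nsNK lin_mu kerN; apply/cfun_inP=> x Kx.
rewrite exp_cfunE // cfun1E Kx -lin_charX //.
have Nxn: (x ^+ #|K : N|)%g \in N.
  have nNx := subsetP (normal_norm nsNK) x Kx.
  apply: coset_idr; rewrite ?groupX // morphX //= -card_quotient ?normal_norm //.
  by rewrite expg_cardG ?mem_quotient.
by rewrite (cfker1 (subsetP kerN _ Nxn)) lin_char1.
Qed.

Section Between.

Variable K : {group gT}.
Hypotheses (sNK : N \subset K) (sKL : K \subset L).

Let nsNK : N <| K. Proof. exact: normalS nsNL. Qed.
Let u_lin (mu : 'CF(K)) : mu \is a linear_char -> N \subset cfker mu ->
  mu * cfAut u mu = 1.
Proof.
move=> lin_mu kerN; apply/cfun_inP=> x Kx; rewrite !cfunE cfun1E Kx.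
rewrite u_inv ?mulfV ?lin_char_neq0 //.
have /dvdnP[m ->]: (#|K : N| %| #|L : N|)%N.
  by rewrite -(Lagrange_index sKL sNK) dvdn_mull.
have /(congr1 (fun f : 'CF(K) => f x)) := lin_char_mod_index nsNK lin_mu kerN.
by rewrite exp_cfunE // cfun1E Kx mulnC exprM => ->; rewrite expr1n.
Qed.

Let oddKN : odd #|K : N|.
Proof. by apply: dvdn_odd oddLN; rewrite -(Lagrange_index sKL sNK) dvdn_mull. Qed.

(** Gallagher's theorem: the characters of [K] over [theta] are the products of one extension with
    the irreducible characters of [K / N], and equal degrees force the factor to be linear. *)
Let extension_mul (chi psi : 'CF(K)) :
    chi \in irr K -> 'Res[N] chi = theta ->
    psi \in irr K -> 'Res[N] psi = theta ->
  exists mu : 'CF(K), [/\ mu \is a linear_char, N \subset cfker mu & psi = mu * chi].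
Proof.
case/irrP=> c -> Dc; case/irrP=> i -> Di; have [t Dt] := irrP irr_theta.
rewrite Dt in Dc Di.
have [_ _ ext_chi _] := constt_Ind_ext nsNK Dc.
have: i \in irr_constt ('Ind[K] 'chi_t) by rewrite constt_Ind_Res Di constt_irr inE.
rewrite ext_chi => /codomP[b Db].
have Db': 'chi_i = 'chi_(mod_Iirr b) * 'chi_c.
  by rewrite Db /mul_mod_Iirr /mul_Iirr cfIirrE //; have [] := constt_Ind_ext nsNK Dc.
exists 'chi_(mod_Iirr b); split=> //; last first.
  by rewrite mod_IirrE // cfker_mod.
rewrite qualifE /= irr_char /=.
have: 'chi_i 1%g = 'chi_c 1%g.
  by rewrite -(cfRes1 N 'chi_i) Di -Dc cfRes1.
by rewrite Db' cfunE -[RHS]mul1r => /(mulIf (irr1_neq0 c)) ->.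
Qed.

(** The linear factor [mu] between the two extensions is fixed by [u] and also inverted by it, so
    [mu] squares to 1; the odd index then gives [mu = 1]. *)
Lemma fixed_extension_inj (chi psi : 'CF(K)) :
  fixed_extension chi -> fixed_extension psi -> psi = chi.
Proof.
case=> irr_chi Dchi u_chi [irr_psi Dpsi u_psi].
have [mu [lin_mu kerN Dmu]] := extension_mul irr_chi Dchi irr_psi Dpsi.
have [t Dt] := irrP irr_theta; have [c Dc] := irrP irr_chi.
rewrite Dt Dc in Dchi.
have [_ inj_c _ _] := constt_Ind_ext nsNK Dchi.
have [m Dm] := irrP (lin_char_irr lin_mu).
have Dm': mod_Iirr (quo_Iirr N m) = m by rewrite quo_IirrK // -Dm.
have Du: mod_Iirr (quo_Iirr N (aut_Iirr u m)) = aut_Iirr u m.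
  by rewrite quo_IirrK // aut_IirrE -Dm cfker_aut.
have: quo_Iirr N m = quo_Iirr N (aut_Iirr u m).
  apply: inj_c; rewrite /mul_mod_Iirr /mul_Iirr Dm' Du aut_IirrE -Dm -Dc.
  by rewrite -Dmu -{1}u_psi Dmu rmorphM /= u_chi.
move/(congr1 (@mod_Iirr _ _ _)); rewrite Dm' Du => /(congr1 (fun i => 'chi_i)).
rewrite aut_IirrE -Dm => u_mu.
have:= u_lin lin_mu kerN; rewrite -u_mu => mu2.
have := lin_char_mod_index nsNK lin_mu kerN.
rewrite -[#|K : N|]odd_double_half oddKN exprS -muln2 mulnC exprM expr2 mu2.
by rewrite expr1n mulr1 => mu1; rewrite Dmu mu1 mul1r.
Qed.

(** If [u] sends [chi] to [mu * chi], multiplying [chi] by a square root of [mu] makes it fixed,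
    because [u] inverts that root. *)
Lemma fixed_extension_exists_from (chi : 'CF(K)) :
  chi \in irr K -> 'Res[N] chi = theta -> exists psi : 'CF(K), fixed_extension psi.
Proof.
move=> irr_chi Dchi.
have irr_uchi: cfAut u chi \in irr K by rewrite cfAut_irr.
have Duchi: 'Res[N] (cfAut u chi) = theta by rewrite -cfAutRes Dchi.
have [mu [lin_mu kerN Dmu]] := extension_mul irr_chi Dchi irr_uchi Duchi.
(* The exponent is half of [#|K : N| + 1], and [mu] has order dividing the odd number [#|K : N|]. *)
pose nu := mu ^+ (#|K : N|./2.+1).
have lin_nu: nu \is a linear_char by apply: rpredX.
have kerN_nu: N \subset cfker nu.
  apply/subsetP=> x Nx; have Kx := subsetP sNK x Nx.
  by rewrite cfkerEchar ?lin_charW // inE Kx /nu !exp_cfunE ?group1 // (cfker1 (subsetP kerN _ Nx)) /=.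
have nu2: nu * nu = mu.
  rewrite -exprD; have ->: (#|K : N|./2.+1 + #|K : N|./2.+1 = #|K : N|.+1)%N.
    by rewrite -[in RHS](odd_double_half #|K : N|) oddKN -addnn addSn addnS.
  by rewrite exprS lin_char_mod_index ?mulr1.
exists (nu * chi); split.
- exact: mul_lin_irr.
- rewrite rmorphM /= Dchi.
  by rewrite cfRes_sub_ker // lin_char1 // scale1r mul1r.
rewrite rmorphM /= Dmu mulrA; congr (_ * _).
transitivity (cfAut u nu * (nu * nu)); first by rewrite nu2.
by rewrite mulrA [cfAut u nu * nu]mulrC u_lin // mul1r.
Qed.

End Between.

Lemma fixed_extension_self : fixed_extension theta.
Proof. by split=> //; rewrite cfRes_id. Qed.

Lemma fixed_extension_conj (K : {group gT}) (chi : 'CF(K)) y :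
    N \subset K -> K \subset L -> y \in L -> y \in 'N(K) ->
  fixed_extension chi -> fixed_extension (chi ^ y)%CF.
Proof.
move=> sNK sKL Ly nKy [irr_chi Dchi u_chi].
have nNy: y \in 'N(N) by apply: subsetP (normal_norm nsNL) y Ly.
split; first exact: cfConjg_irr; last by rewrite cfAutConjg u_chi.
by rewrite -cfConjgRes_norm // Dchi inertiaJ ?(subsetP ILtheta).
Qed.

(** One climbs by prime indices: by uniqueness the fixed extension to a normal subgroup of prime
    index is [K]-invariant, so it extends, and the extension can be corrected to a fixed one. *)
Lemma fixed_extension_solvable (K : {group gT}) :
    N \subset K -> K \subset L -> solvable (K / N)%g ->
  exists chi : 'CF(K), fixed_extension chi.
Proof.
have [n leKn] := ubnP #|K|; elim: n => // n IHn in K leKn * => sNK sKL solK.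
have nsNK: N <| K by apply: normalS nsNL.
have [trivK | ntK] := eqVneq (K / N)%g 1%g.
  have -> : K = N.
    by apply/val_inj/eqP; rewrite eqEsubset sNK -quotient_sub1 ?normal_norm //= trivK subxx.
  by exists theta; apply: fixed_extension_self.
have [Hb nsHb pr_p] := sol_prime_factor_exists solK ntK.
have [H defHb sNH nsHK] := inv_quotientN nsNK nsHb.
have [sHK nHK] := andP nsHK.
have iHK: #|K : H| = #|K / N : H / N|%g.
  by rewrite index_quotient_eq ?normal_norm // subIset ?sNH ?orbT.
have pr_KH: prime #|K : H| by rewrite iHK -defHb.
have ltHK: (#|H| < #|K|)%N.
  rewrite -(Lagrange sHK) -[X in (X < _)%N]muln1 ltn_pmul2l //; exact: prime_gt1.
have sHL := subset_trans sHK sKL.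
have [||chi1 ext1] := IHn H _ sNH sHL.
- exact: leq_trans ltHK _.
- exact: solvableS (quotientS N sHK) solK.
have [irr1 Dchi1 u_chi1] := ext1.
have Ichi1: K \subset 'I[chi1].
  apply/subsetP=> y Ky; have nHy := subsetP nHK y Ky; rewrite inE nHy; apply/eqP.
  apply: (fixed_extension_inj sNH sHL ext1).
  exact: fixed_extension_conj sNH sHL (subsetP sKL y Ky) nHy ext1.
have [s Ds] := irrP irr1; rewrite Ds in Ichi1.
have [t Dt] := prime_invariant_irr_extendible nsHK (erefl _) pr_KH Ichi1.
apply: (fixed_extension_exists_from sNK sKL (mem_irr t)).
by rewrite -(cfResRes _ sNH sHK) Dt -Ds.
Qed.

End FixedExtension.

(** By Gallagher, multiplying [chi] by distinct irreducible characters of [K / N] gives distinct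
    irreducible characters. Hence ['[f * chi, chi] = '[f, 1]] for every class function [f] of
    [K / N]; here [f] is the indicator function of one coset. *)
Lemma sum_norm2_coset_extension (gT : finGroupType) (K N : {group gT}) (chi : 'CF(K)) g :
    N <| K -> abelian (K / N)%g -> chi \in irr K -> 'Res[N] chi \in irr N -> g \in K ->
  \sum_(y in (N :* g)%g) `|chi y| ^+ 2 = #|N|%:R.
Proof.
move=> nsNK abKN /irrP[c ->] /irrP[t Dt] Kg; have [sNK nNK] := andP nsNK.
have nsA: [set coset N g] <| (K / N)%g by rewrite -sub_abelian_normal // sub1set mem_quotient.
pose d : 'CF(K / N) := '1_[set coset N g].
have [irr_c inj_c _ _] := constt_Ind_ext nsNK Dt.
have mulE (b : Iirr (K / N)) : 'chi_(mod_Iirr b) * 'chi_c = 'chi_(mul_mod_Iirr c b).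
  by rewrite /mul_mod_Iirr /mul_Iirr cfIirrE.
have dot_b (b : Iirr (K / N)) : '['chi_(mod_Iirr b) * 'chi_c, 'chi_c] = '['chi[K / N]_b, 'chi_0].
  rewrite -{2}['chi_c]mul1r -irr0 -(mod_Iirr0 K N) !mulE !cfdot_irr.
  by rewrite (inj_eq inj_c).
have: '[(d %% N)%CF * 'chi_c, 'chi_c] = '[d, 'chi_0].
  rewrite {1 2}[d]cfun_sum_cfdot !linear_sum mulr_suml !cfdot_suml; apply: eq_bigr => b _.
  by rewrite !linearZ /= -scalerAl !cfdotZl -dot_b mod_IirrE.
have nNg := subsetP nNK g Kg.
rewrite irr0 !cfdotE /d [X in _ = _ * X](bigD1 (coset N g)) ?mem_quotient //=.
rewrite [X in _ = _ * (_ + X)]big1 ?addr0 => [|z /andP[_ ne_z]]; last first.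
  by rewrite cfuniE // inE (negPf ne_z) mul0r.
rewrite cfuniE // set11 cfun1E mem_quotient // conjC1 !mulr1.
rewrite (big_setID (N :* g)%g) /= (setIidPr _); last by rewrite mul_subG ?sub1set.
rewrite [X in _ + X]big1 ?addr0 => [|z /setDP[Kz Ng'z]]; last first.
  rewrite cfunE cfModE // cfuniE // inE; case: eqP => [/rcoset_kercosetP | _]; last by rewrite !mul0r.
  by rewrite (negPf Ng'z) => /(_ (subsetP nNK z Kz) nNg).
rewrite (eq_bigr (fun y => `|'chi_c y| ^+ 2)) => [|z Ngz]; last first.
  have Kz : z \in K by apply: subsetP Ngz; rewrite mul_subG ?sub1set.
  rewrite cfunE cfModE // cfuniE // inE normCK.
  by rewrite (rcoset_kercosetP _ nNg Ngz) ?(subsetP nNK) // eqxx mul1r.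
rewrite card_quotient // => /(canRL (mulKf _)) ->; last by rewrite invr_eq0 neq0CG.
by rewrite invrK -(Lagrange sNK) natrM mulfK // pnatr_eq0 -lt0n.
Qed.

Section FixedExtensionExists.

Variables (gT : finGroupType) (u : {rmorphism algC -> algC}).
Variables (L N : {group gT}) (theta : 'CF(N)).
Hypotheses (nsNL : N <| L) (oddLN : odd #|L : N|).
Hypothesis u_inv : forall z : algC, z ^+ #|L : N| = 1 -> u z = z^-1.
Hypotheses (irr_theta : theta \in irr N) (ILtheta : L \subset 'I[theta]).
Hypothesis u_theta : cfAut u theta = theta.

Local Notation fext := (fixed_extension u theta).
Let nNL : L \subset 'N(N). Proof. exact: normal_norm. Qed.
Let sNL : N \subset L. Proof. exact: normal_sub. Qed.
Let fext_inj := fixed_extension_inj nsNL oddLN u_inv irr_theta.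

Let Kg (g : gT) := (N <*> <[g]>)%G.
Let sNK g : N \subset Kg g. Proof. exact: joing_subl. Qed.
Let Kgg g : g \in Kg g.
Proof. by rewrite (subsetP (joing_subr _ _)) ?cycle_id. Qed.
Let sKL (K : {group gT}) g : N \subset K -> g \in K -> Kg g \subset K.
Proof. by move=> sNK' Kg'; rewrite join_subG sNK' cycle_subG. Qed.
Let abK g : g \in L -> abelian (Kg g / N)%g.
Proof.
move=> Lg; have nNg := subsetP nNL g Lg.
by rewrite /= quotientYidl ?cycle_subG // quotient_cycle // cycle_abelian.
Qed.

(* The extension to L is glued from the extensions to the groups N <*> <[g]>;
   Solomon's theorem makes it a generalized character, and it has norm 1. *)
Theorem fixed_extension_exists : exists chi : 'CF(L), fext chi.
Proof.
have /fin_all_exists[c cP] g : exists c : 'CF(Kg g), g \in L -> fext c.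
  have [Lg | _] := boolP (g \in L); last by exists 0.
  have [||chi] := fixed_extension_solvable nsNL oddLN u_inv irr_theta ILtheta u_theta (sNK g).
  - exact: sKL.
  - exact/abelian_sol/abK.
  by exists chi.
(* A fixed extension restricts to a fixed extension, so by uniqueness all of them, whatever their
   domain, agree at [g]. *)
have cE (K : {group gT}) (chi : 'CF(K)) g :
    N \subset K -> K \subset L -> fext chi -> g \in K -> chi g = c g g.
- move=> sNK' sKL' [irr_chi Dchi u_chi] K'g; have Lg := subsetP sKL' g K'g.
  have sKgK := sKL sNK' K'g.
  suffices ->: c g = 'Res[Kg g] chi by rewrite cfResE.
  apply: (fext_inj (sNK g) (sKL sNL Lg)) (cP g Lg).
  have ResN: 'Res[N] ('Res[Kg g] chi) = theta by rewrite cfResRes.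
  split=> //; last by rewrite cfAutRes u_chi.
  apply: (@cfRes_irr_irr _ _ N); last by rewrite ResN.
  by rewrite cfRes_char ?irrWchar.
pose Th g := if g \in L then c g g else 0.
have ThJ : {in L &, forall x y, Th (x ^ y)%g = Th x}.
  move=> g y Lg Ly; rewrite /Th groupJ // Lg.
  have nNy : y \in 'N(N) by apply: subsetP nNL y Ly.
  pose psi := cfIsom (conj_isom (Kg g) y) (c g).
  have [irr_c Dc u_c] := cP g Lg.
  have sNKy : N \subset (Kg g :^ y)%G by rewrite -(normP nNy) /= conjSg sNK.
  have sKyL : (Kg g :^ y)%G \subset L by rewrite /= -(conjGid Ly) conjSg sKL.
  have ext_psi : fext (psi : 'CF((Kg g :^ y)%G)).
    split; last by rewrite /psi cfAutIsom u_c.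
      by rewrite /psi cfIsom_irr.
    apply/cfun_inP=> n Nn; rewrite cfResE //.
    have Nny: (n ^ y^-1)%g \in N by rewrite memJ_norm ?groupV.
    have Kny := subsetP (sNK g) _ Nny.
    rewrite -{1}[n](conjgKV y) -(conjgmE (Kg g)) cfIsomE //.
    by rewrite -(cfResE _ (sNK g)) // Dc inertia_valJ // groupV (subsetP ILtheta).
  have Kygy: (g ^ y)%g \in (Kg g :^ y)%G by rewrite /= memJ_conjg Kgg.
  rewrite -(cE _ _ _ sNKy sKyL ext_psi) // -(conjgmE (Kg g)) /psi cfIsomE //.
have Th_fun : is_class_fun <<L>> [ffun x => Th x].
  rewrite genGid; apply: intro_class_fun => // x /negPf L'x.
  by rewrite /Th L'x.
pose Theta : 'CF(L) := Cfun 0 Th_fun.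
have ThetaE g : g \in L -> Theta g = c g g by move=> Lg; rewrite cfunE /Th Lg.
have ResTheta (K : {group gT}) (chi : 'CF(K)) :
    N \subset K -> K \subset L -> fext chi -> 'Res[K] Theta = chi.
- move=> sNK' sKL' ext_chi; apply/cfun_inP=> x Kx.
  by rewrite cfResE // ThetaE ?(subsetP sKL') // -(cE _ _ _ sNK' sKL' ext_chi).
have vTheta : Theta \in 'Z[irr L].
  (* The first condition makes [S] closed under products. For the character induced from the trivial
     one of [K / N], the product with [Theta] is induced from the fixed extension to [K]. *)
  pose S (f : 'CF(L / N)) := (f %% N)%CF \in 'Z[irr L] /\ (f %% N)%CF * Theta \in 'Z[irr L].
  suffices [_]: S 1 by rewrite rmorph1 mul1r.
  apply: Solomon_induction => [f g [Zf Zft] [Zg Zgt] | f g [Zf Zft] [Zg Zgt] | Kb sKbL solKb].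
  - by split; rewrite linearB /= ?mulrBl rpredB.
  - by split; rewrite rmorphM /=; [|rewrite -mulrA]; apply: mul_vchar.
  have [K defKb sNK' sKL'] := inv_quotientS nsNL sKbL.
  have -> : Kb = (K / N)%G by apply: val_inj.
  have Dind : ('Ind[L / N, K / N] 1 %% N)%CF = 'Ind[L, K] 1.
    by rewrite /cfMod -cfIndMorph ?ker_coset ?rmorph1.
  rewrite /S Dind; split; first by rewrite cfInd_vchar ?cfun1_vchar.
  have solK : solvable (K / N)%g by rewrite -defKb.
  have [chi ext_chi] := fixed_extension_solvable nsNL oddLN u_inv irr_theta ILtheta u_theta sNK' sKL' solK.
  rewrite -cfIndM // mul1r (ResTheta K chi) // cfInd_vchar //.
  by case: ext_chi => /irrWchar/char_vchar.
(* On the coset of [g], [Theta] agrees with an extension of [theta] to [N <*> <[g]>], so each coset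
   contributes [#|N|]. *)
have Theta1 : '[Theta] = 1.
  rewrite cfdotE (set_partition_big _ (rcosets_partition sNL)) /=.
  rewrite (eq_bigr (fun=> #|N|%:R)) => [|_ /rcosetsP[g Lg ->]].
    by rewrite sumr_const -[#|rcosets N L|]/#|L : N| -mulrnA Lagrange // mulVf ?neq0CG.
  have [irr_c Dc u_c] := cP g Lg; have sKgL := sKL sNL Lg.
  rewrite -(sum_norm2_coset_extension _ _ irr_c _ (Kgg g)) ?abK ?Dc //; last first.
    exact: normalS nsNL.
  apply: eq_bigr => y Ny; have Ky : y \in Kg g.
    by apply: subsetP Ny; rewrite mul_subG ?sub1set.
  by rewrite normCK -(ResTheta _ _ (sNK g) sKgL (cP g Lg)) cfResE.
have ResThetaN : 'Res[N] Theta = theta.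
  by apply: ResTheta => //; apply: fixed_extension_self.
have [b [i DTheta]] := vchar_norm1P vTheta Theta1.
have irr_Theta : Theta \in irr L.
  suffices b0 : b = false by rewrite DTheta b0 scale1r mem_irr.
  have [t Dt] := irrP irr_theta.
  have : 0 < Theta 1%g by rewrite -(cfRes1 N) ResThetaN Dt irr1_gt0.
  rewrite DTheta cfunE; case: (b) => //.
  by rewrite mulN1r oppr_gt0 => /lt_trans/(_ (irr1_gt0 i)); rewrite ltxx.
exact: (fixed_extension_exists_from nsNL oddLN u_inv irr_theta u_theta sNL (subxx _) irr_Theta ResThetaN).
Qed.

End FixedExtensionExists.

(** * Partial characters *)

Section PartialCharacters.

Variables (gT : finGroupType) (pi : nat_pred).
Implicit Types G H N : {group gT}.
Local Notation rho := (pi_restr pi).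

Fact pi_restr_is_linear G : linear (@pi_restr gT pi G).
Proof. by move=> a f g; rewrite /pi_restr mulrDr scalerAr. Qed.
HB.instance Definition _ G :=
  GRing.isLinear.Build algC 'CF(G) 'CF(G) *:%R (@pi_restr gT pi G) (@pi_restr_is_linear G).

Lemma pi_restr_id G (f : 'CF(G)) : rho (rho f) = rho f.
Proof. by apply/cfunP=> x; rewrite !pi_restrE; case: (pi.-elt x)%g. Qed.

Lemma pi_restrM G (f g : 'CF(G)) : rho (f * g) = rho f * rho g.
Proof.
by apply/cfunP=> x; rewrite pi_restrE [RHS]cfunE !pi_restrE cfunE; case: (pi.-elt x)%g; rewrite ?mulr0.
Qed.

Lemma pi_restr_Res G H (f : 'CF(G)) : H \subset G -> 'Res[H] (rho f) = rho ('Res[H] f).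
Proof.
by move=> sHG; apply/cfun_inP=> x Hx; rewrite !(cfResE, pi_restrE) //; case: (pi.-elt x)%g; rewrite ?cfResE.
Qed.

Lemma pi_restr_Ind G H (f : 'CF(H)) : H \subset G -> rho ('Ind[G] f) = 'Ind[G] (rho f).
Proof.
move=> sHG; rewrite /pi_restr mulrC -cfIndM // mulrC; congr ('Ind[G] (_ * _)).
apply/cfun_inP=> x Hx; rewrite cfResE // !cfuniE ?pi_elts_normal // !inE Hx.
by rewrite (subsetP sHG).
Qed.

Lemma pi_restrJ G (f : 'CF(G)) y : (rho f ^ y)%CF = rho (f ^ y)%CF.
Proof.
have [nGy | notNy] := boolP (y \in 'N(G)); last by rewrite !cfConjgEout.
by apply/cfun_inP=> x Gx; rewrite cfConjgE // !pi_restrE p_eltJ cfConjgE.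
Qed.

Lemma pi_restr_pgroup G (f : 'CF(G)) : pi.-group G -> rho f = f.
Proof.
by move=> piG; apply/cfun_inP=> x Gx; rewrite pi_restrE (mem_p_elt piG Gx).
Qed.

Lemma pi_partial_restr G (f : 'CF(G)) : pi_partial_char pi f -> rho f = f.
Proof. by case=> chi [_ _ ->]; apply: pi_restr_id. Qed.

Lemma pi_restr_partial G (chi : 'CF(G)) :
  chi \is a character -> chi != 0 -> pi_partial_char pi (rho chi).
Proof. by exists chi. Qed.

Lemma pi_restr_irr_partial G i : pi_partial_char pi (rho 'chi[G]_i).
Proof. by apply: pi_restr_partial; rewrite ?irr_char ?irr_neq0. Qed.

Lemma pi_restr1 G (f : 'CF(G)) : rho f 1%g = f 1%g.
Proof. by rewrite pi_restrE p_elt1. Qed.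

Lemma pi_partial_gt0 G (f : 'CF(G)) : pi_partial_char pi f -> 0 < f 1%g.
Proof. by case=> chi [Nchi nz_chi ->]; rewrite pi_restr1 char1_gt0. Qed.

Lemma pi_partial_neq0 G (f : 'CF(G)) : pi_partial_char pi f -> f != 0.
Proof. by move/pi_partial_gt0; apply: contraTneq => ->; rewrite cfunE ltxx. Qed.

Lemma pi_partial_Res G H (f : 'CF(G)) :
  H \subset G -> pi_partial_char pi f -> pi_partial_char pi ('Res[H] f).
Proof.
move=> sHG [chi [Nchi nz_chi ->]]; exists ('Res[H] chi).
by rewrite cfRes_char // pi_restr_Res // cfRes_eq0.
Qed.

Lemma pi_partial_Ind G H (f : 'CF(H)) :
  H \subset G -> pi_partial_char pi f -> pi_partial_char pi ('Ind[G] f).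
Proof.
move=> sHG [chi [Nchi nz_chi ->]]; exists ('Ind[G] chi).
by rewrite cfInd_char // pi_restr_Ind // cfInd_eq0.
Qed.

Lemma pi_partialJ G (f : 'CF(G)) y :
  pi_partial_char pi f -> pi_partial_char pi (f ^ y)%CF.
Proof.
case=> chi [Nchi nz_chi ->]; exists (chi ^ y)%CF; rewrite pi_restrJ cfConjg_char //.
split=> //; apply: contraNneq nz_chi => chiy0.
by rewrite -(cfConjgK y chi) chiy0 linear0.
Qed.

Lemma pi_partialM G (f g : 'CF(G)) :
  pi_partial_char pi f -> pi_partial_char pi g -> pi_partial_char pi (f * g).
Proof.
case=> chi [Nchi nz_chi ->] [psi [Npsi nz_psi ->]]; exists (chi * psi).
split; rewrite ?rpredM ?pi_restrM //.
by rewrite -char1_eq0 ?rpredM // cfunE mulf_neq0 // char1_eq0.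
Qed.

Lemma pi_irr_partial G (f : 'CF(G)) : pi_irr pi f -> pi_partial_char pi f.
Proof. by case. Qed.

Lemma pi_irr_restr G (f : 'CF(G)) : pi_irr pi f -> rho f = f.
Proof. by move/pi_irr_partial/pi_partial_restr. Qed.

Lemma pi_irr_add G (f g : 'CF(G)) (chi : 'CF(G)) :
    pi_irr pi f -> pi_partial_char pi g -> chi \is a character ->
  f = g + rho chi -> f = g.
Proof.
case=> _ irr_f Pg Nchi Df; have [chi0 | nz_chi] := eqVneq chi 0.
  by rewrite Df chi0 linear0 addr0.
by case: irr_f; exists g, (rho chi); split=> //; apply: pi_restr_partial.
Qed.

(** An irreducible constituent of a character restricting to [f] splits off as a partial character,
    which by irreducibility is all of [f]. *)
Lemma pi_irr_irr G (f : 'CF(G)) : pi_irr pi f -> exists i, f = rho 'chi_i.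
Proof.
move=> irr_f; have [[chi [Nchi nz_chi Df]] _] := irr_f.
have [i chi_i] := neq0_has_constt nz_chi; exists i.
have /constt_charP[//|psi Npsi Dchi] := chi_i.
apply: pi_irr_add irr_f _ Npsi _; first exact: pi_restr_irr_partial.
by rewrite Df Dchi linearD.
Qed.

Lemma pi_irrJ G (f : 'CF(G)) y : pi_irr pi f -> pi_irr pi (f ^ y)%CF.
Proof.
case=> Pf irr_f; split; first exact: pi_partialJ.
case=> f1 [f2 [Pf1 Pf2 Df]]; case: irr_f; exists (f1 ^ y^-1%g)%CF, (f2 ^ y^-1%g)%CF.
by split; [apply: pi_partialJ..| rewrite -[LHS](cfConjgK y) Df linearD].
Qed.

Lemma pi_partial_sum G (f : 'CF(G)) : pi_partial_char pi f ->
  exists2 s : seq 'CF(G), {in s, forall psi, pi_irr pi psi} & f = \sum_(psi <- s) psi.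
Proof.
have nat1 (g : 'CF(G)) : pi_partial_char pi g -> g 1%g \in Num.nat.
  by case=> chi [Nchi _ ->]; rewrite pi_restr1 Cnat_char1.
move=> Pf; have /natrP[n] := nat1 f Pf.
elim/ltn_ind: n f Pf => n IHn f Pf fn.
have [irr_f | red_f] := pselect (pi_irr pi f).
  by exists [:: f]; [move=> psi; rewrite inE => /eqP-> | rewrite big_seq1].
have [f1 [f2 [Pf1 Pf2 Df]]]: exists f1 f2, [/\ pi_partial_char pi f1, pi_partial_char pi f2 & f = f1 + f2].
  by apply: contrapT => red; case: red_f.
have [/natrP[n1 fn1] /natrP[n2 fn2]] := (nat1 _ Pf1, nat1 _ Pf2).
have := pi_partial_gt0 Pf1; have := pi_partial_gt0 Pf2; rewrite fn1 fn2 !ltr0n => n2_gt0 n1_gt0.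
have Dn: n = (n1 + n2)%N.
  by apply/eqP; rewrite -(eqr_nat algC) -fn Df cfunE fn1 fn2 natrD.
have [|s1 irr_s1 Ds1] := IHn n1 _ f1 Pf1 fn1; first by rewrite Dn -addn1 leq_add2l.
have [|s2 irr_s2 Ds2] := IHn n2 _ f2 Pf2 fn2; first by rewrite Dn -add1n leq_add2r.
exists (s1 ++ s2); last by rewrite big_cat -Ds1 -Ds2.
by move=> psi; rewrite mem_cat => /orP[/irr_s1 | /irr_s2].
Qed.

(** Irreducibility is a proposition, hence the classical [[< >]]. Distinct irreducible characters
    can have the same restriction to pi-elements, hence [undup]. *)
Definition Ipi G : seq 'CF(G) :=
  undup [seq rho 'chi_i | i <- enum 'I_(Nirr G) & `[< pi_irr pi (rho 'chi[G]_i) >]].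

Lemma Ipi_uniq G : uniq (Ipi G). Proof. exact: undup_uniq. Qed.

Lemma IpiP G (f : 'CF(G)) : reflect (pi_irr pi f) (f \in Ipi G).
Proof.
rewrite mem_undup; apply: (iffP mapP) => [[i] | irr_f].
  by rewrite mem_filter => /andP[/asboolP irr_i _] ->.
have [i Di] := pi_irr_irr irr_f; exists i => //.
by rewrite mem_filter mem_enum andbT -Di; apply/asboolP.
Qed.

(* The coordinate of [rho f] on [psi], 0 if [psi] is not irreducible; it is
   meaningful even before [Ipi G] is known to be free, as [rho f] always lies in
   the span. *)
Definition pi_mult G (psi f : 'CF(G)) : algC :=
  \sum_(i < size (Ipi G) | (Ipi G)`_i == psi) coord (in_tuple (Ipi G)) i (rho f).

Fact pi_mult_is_scalar G psi : scalar (@pi_mult G psi).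
Proof.
move=> a f g; rewrite /pi_mult mulr_sumr -big_split; apply: eq_bigr => i _.
by rewrite !linearP.
Qed.
HB.instance Definition _ G psi :=
  GRing.isLinear.Build algC 'CF(G) algC *%R (@pi_mult G psi) (@pi_mult_is_scalar G psi).

Lemma pi_mult_restr G (psi f : 'CF(G)) : pi_mult psi (rho f) = pi_mult psi f.
Proof. by rewrite /pi_mult pi_restr_id. Qed.

Lemma pi_mult_nth G (i : 'I_(size (Ipi G))) (f : 'CF(G)) :
  pi_mult (Ipi G)`_i f = coord (in_tuple (Ipi G)) i (rho f).
Proof.
rewrite /pi_mult (big_pred1 i) // => j.
by rewrite /= nth_uniq ?Ipi_uniq.
Qed.

Lemma pi_restr_span G (f : 'CF(G)) : rho f \in <<Ipi G>>%VS.
Proof.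
rewrite [f]cfun_sum_cfdot linear_sum memv_suml // => i _.
rewrite linearZ memvZ //=; have [s irr_s ->] := pi_partial_sum (pi_restr_irr_partial i).
by rewrite big_seq memv_suml // => psi /irr_s/IpiP; apply: memv_span.
Qed.

Lemma pi_mult_sum G (f : 'CF(G)) : rho f = \sum_(psi <- Ipi G) pi_mult psi f *: psi.
Proof.
rewrite [LHS](coord_span (X := in_tuple (Ipi G))) ?pi_restr_span //.
rewrite (big_nth 0) big_mkord; apply: eq_bigr => i _.
by rewrite pi_mult_nth.
Qed.

Lemma pi_dual_free G :
    {in Ipi G, forall psi, exists D : {linear 'CF(G) -> algC | *%R},
       {in Ipi G, forall f, D f = (f == psi)%:R}} ->
  free (Ipi G).
Proof.
move=> dual; change (free (in_tuple (Ipi G))); apply/freeP => k k0 i.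
have [D DE] := dual _ (mem_nth 0 (ltn_ord i)).
have := congr1 D k0; rewrite linear0 linear_sum (bigD1 i) //= big1 => [|j ne_ji].
  by rewrite linearZ /= DE ?mem_nth // eqxx mulr1 addr0.
by rewrite linearZ /= DE ?mem_nth // nth_uniq ?Ipi_uniq // val_eqE (negPf ne_ji) mulr0.
Qed.

Section Free.

Variable G : {group gT}.
Hypothesis freeI : free (Ipi G).

Lemma pi_mult_irr (f psi : 'CF(G)) : pi_irr pi f -> pi_irr pi psi ->
  pi_mult psi f = (f == psi)%:R.
Proof.
move=> irr_f /IpiP; case/(nthP 0) => j ltj <-.
have /IpiP/(nthP 0)[i lti Di] := irr_f.
rewrite (pi_mult_nth (Ordinal ltj)) pi_irr_restr // -Di.
rewrite (coord_free (Ordinal lti) (Ordinal ltj)) //.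
by rewrite nth_uniq ?Ipi_uniq.
Qed.

(** This turns the pairing with a dual character into a multiplicity: a functional that factors
    through [pi_restr] is determined by its values on [Ipi pi G], which spans. *)
Lemma pi_mult_functional (D : {linear 'CF(G) -> algC | *%R}) psi :
    pi_irr pi psi -> (forall f, D (rho f) = D f) ->
    (forall f, pi_irr pi f -> D f = (f == psi)%:R) ->
  forall f, D f = pi_mult psi f.
Proof.
move=> irr_psi Drho DE f; rewrite -Drho pi_mult_sum linear_sum.
rewrite (bigD1_seq psi) ?Ipi_uniq ?(introT (IpiP psi)) //=.
rewrite linearZ /= DE // eqxx mulr1 big_seq_cond big1 ?addr0 // => g.
by case/andP=> /IpiP irr_g /negPf ne; rewrite linearZ /= DE // ne mulr0.
Qed.

Lemma pi_mult_partial_nat (f psi : 'CF(G)) :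
  pi_partial_char pi f -> pi_irr pi psi -> pi_mult psi f \in Num.nat.
Proof.
move=> Pf irr_psi; have [s irr_s ->] := pi_partial_sum Pf.
rewrite linear_sum big_seq rpred_sum //= => g /irr_s irr_g.
by rewrite pi_mult_irr // rpred_nat.
Qed.

Lemma pi_multJ (f psi : 'CF(G)) y :
  pi_irr pi psi -> pi_mult (psi ^ y)%CF (f ^ y)%CF = pi_mult psi f.
Proof.
move=> irr_psi; rewrite -pi_mult_restr -pi_restrJ pi_mult_sum.
rewrite linear_sum /= linear_sum (bigD1_seq psi) ?Ipi_uniq ?(introT (IpiP psi)) //=.
have irrJ := pi_irrJ y irr_psi.
rewrite linearZ /= linearZ /= (pi_mult_irr irrJ irrJ) eqxx mulr1 big_seq_cond big1 ?addr0 // => g.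
case/andP=> /IpiP irr_g /negPf ne; rewrite linearZ /= linearZ /= (pi_mult_irr (pi_irrJ y irr_g) irrJ).
by rewrite (inj_eq (can_inj (cfConjgK y))) ne mulr0.
Qed.

Lemma pi_constituentP (psi f : 'CF(G)) : rho f = f ->
  pi_constituent pi psi f <-> pi_irr pi psi /\ pi_mult psi f != 0.
Proof.
move=> rho_f; split=> [[s [a [uniq_s irr_s Df s_psi nz_a]]] | [irr_psi nz]].
  have irr_psi := irr_s _ s_psi; split=> //.
  rewrite Df linear_sum (bigD1_seq psi) //= linearZ /= pi_mult_irr // eqxx mulr1.
  rewrite big_seq_cond big1 ?addr0 // => g /andP[/irr_s irr_g /negPf ne].
  by rewrite linearZ /= pi_mult_irr // ne mulr0.
exists (Ipi G), (fun g : 'CF(G) => pi_mult g f); split; rewrite ?Ipi_uniq //.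
- by move=> g /IpiP.
- by rewrite -pi_mult_sum.
- exact/IpiP.
Qed.

Lemma pi_partial_mult_neq0 (f : 'CF(G)) : pi_partial_char pi f ->
  exists2 psi, pi_irr pi psi & pi_mult psi f != 0.
Proof.
move=> Pf; apply: contrapT => no_psi.
have /eqP[] := pi_partial_neq0 Pf; rewrite -(pi_partial_restr Pf) pi_mult_sum.
rewrite big_seq big1 // => psi /IpiP irr_psi.
have [-> | nz] := eqVneq (pi_mult psi f) 0; first by rewrite scale0r.
by case: no_psi; exists psi.
Qed.

End Free.

End PartialCharacters.

(** * The Galois automorphism, stable lifts and dual characters *)

(** The automorphism raises n-th roots of unity to the power [k], chosen by the Chinese remainder
    theorem to be 1 modulo the pi-part of [n] and -1 modulo the pi'-part; the predecessor of that
    part stands for -1. *)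
Lemma pi_Galois_aut (n : nat) (pi : nat_pred) : (0 < n)%N ->
  exists u : {rmorphism algC -> algC},
    (forall z, z ^+ (n`_pi) = 1 -> u z = z) /\ (forall z, z ^+ (n`_pi^') = 1 -> u z = z^-1).
Proof.
move=> n_gt0; have co_n: coprime n`_pi n`_pi^' by apply: coprime_partC.
pose k := chinese n`_pi n`_pi^' 1 (n`_pi^').-1.
have k_pi: k = 1 %[mod n`_pi] by apply: chinese_modl.
have k_pi': k = (n`_pi^').-1 %[mod n`_pi^'] by apply: chinese_modr.
have co_k_n: coprime k n.
  rewrite -(partnC pi n_gt0) coprimeMr -coprime_modl k_pi coprime_modl coprime1n /=.
  by rewrite -coprime_modl k_pi' coprime_modl coprimePn ?part_gt0.
have [u uE] := Qn_aut_exists co_k_n.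
have uE' d z : (d %| n)%N -> z ^+ d = 1 -> u z = z ^+ (k %% d).
  move=> /dvdnP[q Dn] zd; rewrite uE ?(expr_mod _ zd) //.
  by rewrite Dn mulnC exprM zd expr1n.
exists u; split=> z zn; rewrite (uE' _ _ (dvdn_part _ _) zn).
  by rewrite k_pi expr_mod.
rewrite k_pi' expr_mod //; apply: (mulIf (x := z)).
  apply: contraTneq (oner_neq0 algC) => z0.
  by rewrite -zn z0 expr0n gtn_eqF ?part_gt0 ?eqxx.
rewrite -exprSr prednK ?part_gt0 // zn mulVf //.
apply: contraTneq (oner_neq0 algC) => z0.
by rewrite -zn z0 expr0n gtn_eqF ?part_gt0 ?eqxx.
Qed.

Lemma cfdot_Res_neq0 (gT : finGroupType) (G H K : {group gT}) i j k :
    H \subset G -> K \subset H ->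
    '['Res[H] 'chi[G]_i, 'chi_j] != 0 -> '['Res[K] 'chi[H]_j, 'chi_k] != 0 ->
  '['Res[K] 'chi[G]_i, 'chi_k] != 0.
Proof.
move=> sHG sKH ij jk; have Nres: 'Res[H] 'chi_i \is a character by rewrite cfRes_char ?irr_char.
have := @constt_Res_trans _ _ K j _ Nres; rewrite inE => /(_ ij k); rewrite !inE cfResRes //.
exact.
Qed.

Section Step.

Variables (gT : finGroupType) (pi : nat_pred) (G0 : {group gT}).
Variable u : {rmorphism algC -> algC}.
Hypothesis u_pi : forall z : algC, z ^+ (#|G0|`_pi) = 1 -> u z = z.
Local Notation rho := (pi_restr pi).
Local Notation I := (Ipi pi).
Implicit Types L M N H : {group gT}.

(** The value at a pi-element [x] is a sum of roots of unity of order dividing [#[x]], hence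
    dividing the pi-part of [#|G0|]. *)
Lemma cfAut_partial N (f : 'CF(N)) :
  N \subset G0 -> pi_partial_char pi f -> cfAut u f = f.
Proof.
move=> sNG0 [chi [Nchi _ ->]]; apply/cfun_inP=> x Nx; rewrite cfunE pi_restrE.
have [pi_x | _] := boolP (pi.-elt x)%g; last by rewrite rmorph0.
have sxN: <[x]> \subset N by rewrite cycle_subG.
rewrite -(cfResE _ sxN) ?cycle_id //.
have [r ->] := char_sum_irr (cfRes_char <[x]>%G Nchi).
rewrite sum_cfunE rmorph_sum; apply: eq_bigr => i _; apply: u_pi.
have lin_i : 'chi_i \is a linear_char by rewrite irr_cyclic_lin ?cycle_cyclic.
have /dvdnP[q ->]: (#[x] %| #|G0|`_pi)%N.
  rewrite -(part_pnat_id pi_x) partn_dvd ?cardG_gt0 //.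
  by rewrite order_dvdG ?(subsetP sNG0).
by rewrite mulnC exprM -lin_charX ?cycle_id // expg_order lin_char1 ?expr1n.
Qed.

(** Taking for [L] the stabiliser of [eta] in a larger group gives a lift with the same stabiliser
    there. *)
Definition pi_lifting N : Prop := forall L (eta : 'CF(N)),
    N <| L -> L \subset G0 -> pi_irr pi eta -> L \subset 'I[eta] ->
  exists theta : 'CF(N),
    [/\ theta \in irr N, L \subset 'I[theta], cfAut u theta = theta & rho theta = eta].

(* [alpha] is dual to [eta] for the pairing by restriction to a pi-subgroup: in
   the literature, a Fong character of [eta], here chosen to be H-invariant. *)
Definition pi_dual H M (alpha : 'CF(H :&: M)) (eta : 'CF(M)) : Prop :=
  [/\ pi.-group H, alpha \in irr (H :&: M), H \subset 'I[alpha]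
    & forall psi : 'CF(M), pi_irr pi psi -> '['Res[H :&: M] psi, alpha] = (psi == eta)%:R].

(** The case [L = M] already gives linear independence. Larger [L] provide the supplement [H] to [M]
    in a stabiliser, needed to pass through a pi-factor. *)
Definition pi_fong M : Prop := forall L (eta : 'CF(M)),
    M <| L -> L \subset G0 -> pi.-group (L / M)%g -> pi_irr pi eta -> L \subset 'I[eta] ->
  exists H, exists alpha : 'CF(H :&: M), (H * M)%g = L /\ pi_dual alpha eta.

Lemma pi_dual_Res_restr H M (f : 'CF(M)) :
  pi.-group H -> 'Res[H :&: M] (rho f) = 'Res[H :&: M] f.
Proof.
move=> piH; rewrite pi_restr_Res ?subsetIr // pi_restr_pgroup //.
exact: pgroupS (subsetIl _ _) piH.
Qed.

Lemma pi_fong_free M : M \subset G0 -> pi_fong M -> free (I M).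
Proof.
move=> sMG0 fongM; apply: pi_dual_free => eta /IpiP irr_eta.
have [|H [alpha [_ [piH _ _ dual]]]] := fongM M eta (normal_refl M) sMG0 _ irr_eta (sub_inertia eta).
  by rewrite trivg_quotient pgroup1.
pose D : {linear 'CF(M) -> algC | *%R} := cfdotr alpha \o 'Res[H :&: M].
by exists D => f /IpiP irr_f; apply: dual.
Qed.

Lemma pi_dual_mult H M (alpha : 'CF(H :&: M)) (eta : 'CF(M)) :
    free (I M) -> pi_irr pi eta -> pi_dual alpha eta ->
  forall f, '['Res[H :&: M] f, alpha] = pi_mult pi eta f.
Proof.
move=> freeM irr_eta [piH _ _ dual] f.
pose D : {linear 'CF(M) -> algC | *%R} := cfdotr alpha \o 'Res[H :&: M].
apply: (pi_mult_functional (D := D)) => // g.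
by rewrite /D /= pi_dual_Res_restr.
Qed.

Lemma inertia_pi_restr N M (theta : 'CF(M)) : 'I_N[theta] \subset 'I_N[rho theta].
Proof.
apply/subsetP=> y /setIP[Ny]; rewrite !inE Ny => /andP[-> /eqP thy] /=.
by rewrite pi_restrJ thy.
Qed.

Section Dual.

Variables (M N H : {group gT}) (t : Iirr M) (alpha : 'CF(H :&: M)).
Local Notation theta := 'chi_t.
Local Notation nu := (rho theta).
Hypotheses (nsMN : M <| N) (freeM : free (I M)) (irr_nu : pi_irr pi nu).
Hypothesis Itheta : 'I_N[nu] \subset 'I[theta].
Hypotheses (defT : (H * M)%g = 'I_N[nu]) (dual_nu : pi_dual alpha nu).

Let eqI : 'I_N[theta] = 'I_N[nu].
Proof.
by apply/eqP; rewrite eqEsubset inertia_pi_restr subsetI subsetIl Itheta.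
Qed.
Let sHN : H \subset N.
Proof. by apply: subset_trans (mulG_subl M H) _; rewrite defT subsetIl. Qed.

(** Since [theta] and [nu] have the same stabiliser in [N], the only conjugate of [theta]
    restricting to [nu] is [theta]. This is the hypothesis on conjugates in [triple_restriction]. *)
Lemma pi_dual_class : {in (theta ^: N)%CF, forall xi,
  '['Res[H :&: M] xi, alpha] = (xi == theta)%:R}.
Proof.
move=> _ /cfclassP[y Ny ->]; rewrite (pi_dual_mult freeM irr_nu dual_nu).
have nMy := subsetP (normal_norm nsMN) y Ny.
rewrite -pi_mult_restr pi_mult_irr //; last by rewrite -pi_restrJ; apply: pi_irrJ.
congr _%:R; congr (nat_of_bool _); apply/eqP/eqP=> [nuy | ->] //.
by apply: inertiaJ; apply: (subsetP Itheta); rewrite 2!inE Ny nMy pi_restrJ nuy /=.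
Qed.

(** [beta] is the partner of ['chi_i] in [triple_restriction]. Its uniqueness, the last clause,
    later shows that it is invariant under a larger pi-group. *)
Lemma pi_step_dual i : i \in irr_constt ('Ind[N] theta) ->
  exists beta : 'CF(H), [/\ beta \in irr H,
    '['Res[H] 'chi_i, beta] = 1,
    {in irr_constt ('Ind[N] theta), forall j, j != i -> '['Res[H] 'chi_j, beta] = 0},
    '['Res[H :&: M] beta, alpha] != 0
  & forall beta' : 'CF(H), beta' \in irr H -> '['Res[H :&: M] beta', alpha] != 0 ->
       '['Res[H] 'chi_i, beta'] != 0 -> beta' = beta].
Proof.
move=> ti; have [_ /irrP[a Da] IHa _] := dual_nu.
have := triple_restriction nsMN sHN (a := a) (t := t); rewrite eqI defT -Da => /(_ erefl IHa pi_dual_class).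
move=> /(_ i); rewrite mem_enum => /(_ ti)[j]; rewrite mem_enum Da constt_Ind_Res -Da inE => aj.
case=> mij uniq_i uniq_j; exists 'chi_j; split; rewrite ?mem_irr //.
- by move=> k tk ne_ki; rewrite uniq_i ?mem_enum.
- by rewrite Da.
move=> beta' /irrP[k ->] ak; apply: contraNeq => ne_kj; apply/eqP; apply: uniq_j.
  by rewrite mem_enum Da constt_Ind_Res inE -Da.
by apply: contraNneq ne_kj => ->.
Qed.

Lemma pi_step_dual_mult i : i \in irr_constt ('Ind[N] theta) ->
  pi_mult pi nu ('Res[M] 'chi_i) = '['Res[M] 'chi_i, theta].
Proof.
move=> ti; have [_ /irrP[a Da] IHa _] := dual_nu.
have := triple_restriction_mult nsMN (a := a) (t := t); rewrite -Da => /(_ pi_dual_class i ti).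
by rewrite -(pi_dual_mult freeM irr_nu dual_nu) cfResRes ?subsetIr ?normal_sub.
Qed.

End Dual.

End Step.

(** * Fixed partial characters and conjugacy classes *)

Lemma cfun_sum_class (gT : finGroupType) (G : {group gT}) (f : 'CF(G)) :
  f = \sum_(m in G) (f m / #|m ^: G|%:R) *: '1_(m ^: G).
Proof.
have nsmG m : m \in G -> m ^: G <| G.
  by move=> Gm; rewrite /normal class_subG // class_norm.
apply/cfun_inP=> z Gz; rewrite sum_cfunE (big_setID (z ^: G)) /=.
rewrite (setIidPr _) ?class_subG // [X in _ + X]big1 ?addr0 => [|m]; last first.
  by case/setDP=> Gm zG'm; rewrite cfunE cfuniE ?nsmG // class_sym (negPf zG'm) mulr0.
rewrite (eq_bigr (fun=> f z / #|z ^: G|%:R)) => [|m zGm].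
  rewrite sumr_const -[RHS]mulr_natr divfK //; apply/eqP.
  by move/eqP; rewrite pnatr_eq0 cards_eq0 => /eqP z0; have := class_refl G z; rewrite z0 inE.
have Gm: m \in G by apply: subsetP zGm; rewrite class_subG.
rewrite cfunE cfuniE ?nsmG // class_sym zGm mulr1 (class_eqP zGm).
by case/imsetP: zGm => y Gy ->; rewrite cfunJ.
Qed.

Section CountClasses.

Variables (gT : finGroupType) (pi : nat_pred) (M : {group gT}) (x : gT).
Hypotheses (nMx : x \in 'N(M)) (pi_x : pi.-elt (coset M x)).
Let J := (M <*> <[x]>)%G.
Let A := ((M :* x) :&: pi_elts pi J)%g.

Let sMJ : M \subset J. Proof. exact: joing_subl. Qed.
Let Jx : x \in J.
Proof. by rewrite (subsetP (joing_subr _ _)) ?cycle_id. Qed.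
Let nsMJ : M <| J.
Proof. by rewrite /normal sMJ join_subG normG cycle_subG. Qed.
Let sMxJ : (M :* x)%g \subset J.
Proof. by rewrite mul_subG ?sub1set. Qed.

Let AE y : (y \in A) = (y \in (M :* x)%g) && pi.-elt y.
Proof.
by rewrite !inE; apply: andb_id2l => Mxy; rewrite (subsetP sMxJ).
Qed.

Let nMMx y : y \in (M :* x)%g -> y \in 'N(M).
Proof. by move/(subsetP sMxJ)/(subsetP (normal_norm nsMJ)). Qed.

Let nJMx : J \subset 'N((M :* x)%g).
Proof.
apply/subsetP=> y Jy; rewrite inE; apply/subsetP=> _ /imsetP[z Mxz ->].
have nMy := subsetP (normal_norm nsMJ) y Jy; have nMz := nMMx Mxz.
apply/rcoset_kercosetP; rewrite ?groupJ // morphJ //=.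
rewrite (rcoset_kercosetP nMz nMx Mxz).
have abJM : abelian (J / M)%g.
  by rewrite /= quotientYidl ?cycle_subG // quotient_cycle // cycle_abelian.
by rewrite conjgE (centsP abJM _ (mem_quotient M Jx)) ?mem_quotient ?mulKg.
Qed.

Let nJA : J \subset 'N(A).
Proof. by rewrite normsI // normal_norm ?pi_elts_normal. Qed.

(** Both sides are the trace of conjugation by [x] on the class functions supported on pi-elements
    of [M], computed in the basis [Ipi pi M] and in the basis of class indicator functions. *)
Lemma sum_fixed_Ipi : free (Ipi pi M) ->
  \sum_(nu <- Ipi pi M) (nu ^ x == nu)%CF%:R
    = \sum_(m in pi_elts pi M) ((m ^ x^-1)%g \in m ^: M)%:R / #|m ^: M|%:R :> algC.
Proof.
move=> freeM.
transitivity (\sum_(nu <- Ipi pi M) \sum_(m in pi_elts pi M)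
    nu (m ^ x^-1)%g / #|m ^: M|%:R * pi_mult pi nu '1_(m ^: M)).
  apply: eq_big_seq => nu /IpiP irr_nu.
  rewrite -(pi_mult_irr freeM (pi_irrJ x irr_nu) irr_nu).
  rewrite {1}[(nu ^ x)%CF]cfun_sum_class linear_sum (big_setID (pi_elts pi M)) /=.
  rewrite (setIidPr _) ?normal_sub ?pi_elts_normal // [X in _ + X]big1 ?addr0 => [|m].
    by apply: eq_bigr => m _; rewrite linearZ /= cfConjgE.
  case/setDP=> Mm; rewrite inE Mm /= => pi'm.
  by rewrite linearZ /= -(pi_irr_restr irr_nu) pi_restrJ pi_restrE (negPf pi'm) !mul0r.
rewrite exchange_big; apply: eq_bigr => m /[!inE] /andP[Mm pi_m].
have nsmM : m ^: M <| M by rewrite /normal class_subG // class_norm.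
transitivity (pi_restr pi ('1_(m ^: M) : 'CF(M)) (m ^ x^-1)%g / #|m ^: M|%:R); last first.
  by rewrite pi_restrE p_eltJ pi_m cfuniE.
rewrite pi_mult_sum sum_cfunE mulr_suml; apply: eq_bigr => nu _.
by rewrite cfunE mulrAC [nu _ * _]mulrC.
Qed.

(** The two elements are conjugate in [M] exactly when some element of [M :* x] centralises [m];
    such elements then form one coset of ['C_M[m]]. *)
Lemma card_rcoset_cent1 m : m \in M ->
  (#|M|%:R * (((m ^ x^-1)%g \in m ^: M)%:R / #|m ^: M|%:R) : algC) = #|(M :* x)%g :&: 'C[m]|%:R.
Proof.
move=> Mm; have [/imsetP[k Mk Dmk] | not_mM] := boolP (_ \in _).
  have Cy0 : (k * x)%g \in 'C[m].
    rewrite cent1C; apply/cent1P/commgP/conjg_fixP.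
    by rewrite conjgM -Dmk conjgKV.
  have -> : (M :* x)%g :&: 'C[m] = ('C_M[m] :* (k * x))%g.
    apply/setP=> z; rewrite in_setI !mem_rcoset in_setI; congr (_ && _).
      by rewrite invMg mulgA [RHS]groupMr ?groupV.
    by rewrite [RHS]groupMr ?groupV.
  rewrite card_rcoset -index_cent1 mul1r -{1}(Lagrange (subsetIl M 'C[m])).
  by rewrite natrM mulfK // pnatr_eq0 -lt0n.
rewrite mul0r mulr0; apply/esym/eqP; rewrite pnatr_eq0 cards_eq0.
apply: contraR not_mM => /set0Pn[_ /setIP[/rcosetP[k Mk ->]]].
rewrite cent1C => /cent1P/commgP/conjg_fixP; rewrite conjgM => mkx.
by apply/imsetP; exists k; rewrite // -{1}mkx conjgK.
Qed.

(** Burnside's orbit count for [M] acting on [A]. The [M]-orbits are whole [J]-classes: given [y] in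
    [A], each element of [J] is a power of [y] times an element of [M], and the power commutes with
    [y]. *)
Lemma card_classes_rcoset :
  (#|classes J ::&: A| * #|M| = \sum_(a in M) #|A :&: 'C[a]|)%N.
Proof.
have actsMA : [acts M, on A | 'J] by rewrite astabsJ (subset_trans sMJ).
transitivity (\sum_(a in M) #|'Fix_(A | 'J)[a]|)%N; last first.
  by apply: eq_bigr => a _; rewrite afixJ cent_set1.
rewrite Frobenius_Cauchy //; congr (_ * _)%N; apply: eq_card => C.
have classE y : y \in A -> orbit 'J M y = y ^: J.
  move=> Ay; have [My _] := setIP Ay; rewrite orbitJ; apply/eqP; rewrite eqEsubset imsetS //=.
  apply/subsetP=> _ /imsetP[z Jz ->].
  have nMy := nMMx My.
  have: coset M z \in <[coset M x]>.
    by rewrite -quotient_cycle // -(quotientYidl (H := M)) ?cycle_subG ?mem_quotient.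
  rewrite -(rcoset_kercosetP nMy nMx My) => /cycleP[j Dz].
  have nMz := subsetP (normal_norm nsMJ) z Jz.
  have Mk : (y ^- j * z)%g \in M.
    apply: coset_idr; first by rewrite groupM ?groupV ?groupX.
    by rewrite morphM ?groupV ?groupX //= morphV ?groupX // morphX // Dz mulVg.
  apply/imsetP; exists (y ^- j * z)%g => //.
  rewrite conjgM; congr (_ ^ z)%g; apply/esym/conjg_fixP/commgP.
  exact/commuteV/commuteX.
apply/idP/imsetP=> [/setIdP[/imsetP[y Jy ->] sA] | [y Ay ->]].
  have Ay : y \in A by apply: subsetP sA _ (class_refl _ _).
  by exists y; rewrite ?classE.
rewrite inE classE // mem_classes ?class_sub_norm //.
by case/setIP: Ay => /(subsetP sMxJ).
Qed.

(* A commuting pair (m, y) is sent to (m y_pi', y_pi). *)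
Lemma sum_commuting_pairs :
  (\sum_(m in pi_elts pi M) #|(M :* x)%g :&: 'C[m]| = \sum_(a in M) #|A :&: 'C[a]|)%N.
Proof.
pose S1 := [set p : gT * gT | [&& p.1 \in pi_elts pi M, p.2 \in (M :* x)%g & p.2 \in 'C[p.1]]].
pose S2 := [set p : gT * gT | [&& p.1 \in M, p.2 \in A & p.2 \in 'C[p.1]]].
transitivity #|S1|.
  under eq_bigr do rewrite -sum1_card.
  by rewrite pair_big_dep -sum1_card; apply: eq_bigl => p; rewrite !inE.
transitivity #|S2|; last first.
  under [RHS]eq_bigr do rewrite -sum1_card.
  by rewrite pair_big_dep -sum1_card; apply: eq_bigl => p; rewrite !inE.
pose F (p : gT * gT) := ((p.1 * p.2.`_pi^')%g, p.2.`_pi)%g.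
pose F' (p : gT * gT) := (p.1.`_pi, (p.2 * p.1.`_pi^')%g)%g.
have c1 z : pi.-elt z -> (z.`_pi^' = 1)%g.
  by move=> pi_z; apply/constt1P; rewrite /p_elt (eq_pnat _ (negnK _)).
have c2 z : (z.`_pi^'.`_pi = 1)%g by apply/constt1P/p_elt_constt.
have c3 z : (z.`_pi^'.`_pi^' = z.`_pi^')%g by apply/constt_p_elt/p_elt_constt.
have FS : {in S1, forall p, F p \in S2 /\ F' (F p) = p}.
  case=> m y; rewrite inE /= => /and3P[/setIdP[Mm pi_m] Mxy]; rewrite cent1C => /cent1P cmy.
  have nMy := nMMx Mxy.
  have My' : (y.`_pi^')%g \in M.
    apply: coset_idr; first by rewrite groupX.
    rewrite morph_constt //=; apply/constt1P; rewrite (rcoset_kercosetP nMy nMx Mxy).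
    by rewrite /p_elt (eq_pnat _ (negnK _)).
  have cmyi i : commute m (y ^+ i)%g by apply: commuteX.
  split.
    rewrite inE /=; apply/and3P; split; first by rewrite groupM.
      rewrite AE p_elt_constt andbT.
      apply/rcoset_kercosetP; rewrite ?groupX // -(rcoset_kercosetP nMy nMx Mxy).
      by rewrite -{2}(consttC pi y) morphM ?groupX //= (coset_id My') mulg1.
    apply/cent1P/commuteM; last by apply: commuteX2.
    exact/commute_sym/cmyi.
  have cmy' : commute m y.`_pi^' by apply: cmyi.
  by rewrite /F' /F /= !consttM // (constt_p_elt pi_m) c2 c3 c1 // mulg1 mul1g consttC.
have FS' : {in S2, forall p, F' p \in S1 /\ F (F' p) = p}.
  case=> a y; rewrite inE /= AE => /and3P[Ma /andP[Mxy pi_y]]; rewrite cent1C => /cent1P cay.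
  have nMy := nMMx Mxy.
  have Ma' : (a.`_pi^')%g \in M by rewrite groupX.
  have cya' : commute y a.`_pi^' by apply/commuteX/commute_sym.
  split.
    rewrite inE /= inE p_elt_constt groupX //=; apply/andP; split.
      have nMa' : (a.`_pi^')%g \in 'N(M) by apply: subsetP (normG M) _ _.
      apply/rcoset_kercosetP; rewrite ?groupM //.
      by rewrite morphM //= (coset_id Ma') mulg1 (rcoset_kercosetP nMy nMx Mxy).
    apply/cent1P/commute_sym/commuteM; last by apply: commuteX2.
    exact/commute_sym/commuteX/commute_sym.
  by rewrite /F' /F /= !consttM // (constt_p_elt pi_y) c2 c3 c1 // mulg1 mul1g consttC.
rewrite -(@card_in_imset _ _ F); last by apply: (can_in_inj (g := F')) => p /FS[].
apply: eq_card => p; apply/imsetP/idP=> [[q /FS[Sq _] -> //] | /FS'[S1q Dp]].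
by exists (F' p).
Qed.

(** An analogue of Brauer's permutation lemma for a single coset: the dimension is the number of
    [J]-classes of pi-elements in [M :* x]. *)
Lemma card_fixed_Ipi : free (Ipi pi M) ->
  size [seq nu <- Ipi pi M | (nu ^ x)%CF == nu] = \dim 'CF(J, A).
Proof.
move=> freeM; rewrite dim_cfun_on; apply/eqP.
rewrite -(eqn_pmul2r (cardG_gt0 M)) card_classes_rcoset -sum_commuting_pairs.
rewrite -(eqr_nat algC) natrM natr_sum size_filter -sum1_count natr_sum.
rewrite [X in X * _]big_mkcond /= mulrC.
rewrite (eq_bigr (fun nu : 'CF(M) => ((nu ^ x)%CF == nu)%:R)) => [|nu _]; last by case: eqP.
rewrite sum_fixed_Ipi // mulr_sumr; apply/eqP/eq_bigr => m /setIdP[Mm _].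
exact: card_rcoset_cent1.
Qed.

End CountClasses.

Lemma dual_free (K : fieldType) (vT : vectType K) (T : eqType) (s : seq T) (F : T -> vT) :
    uniq s ->
    {in s, forall t, exists D : {linear vT -> K | *%R},
       D (F t) != 0 /\ {in s, forall t', t' != t -> D (F t') = 0}} ->
  free [seq F t | t <- s].
Proof.
move=> uniq_s dual; change (free (in_tuple [seq F t | t <- s])).
apply/freeP => k k0 i.
have lts (j : 'I_(size [seq F t | t <- s])) : (j < size s)%N by rewrite -(size_map F).
have t0 : T by case: {+}s (leq_ltn_trans (leq0n _) (lts i)).
have nthE (j : 'I_(size [seq F t | t <- s])) :
    [seq F t | t <- s]`_j = F (nth t0 s j) /\ nth t0 s j \in s.
  by rewrite (nth_map t0) ?mem_nth.
have [D [nzD D0]] := dual _ (nthE i).2.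
have := congr1 D k0; rewrite linear0 linear_sum (bigD1 i) //= big1 => [|j ne_ji].
  by rewrite linearZ /= (nthE i).1 addr0 => /eqP; rewrite mulf_eq0 (negPf nzD) orbF => /eqP.
by rewrite linearZ /= (nthE j).1 D0 ?mulr0 ?(nthE j).2 // nth_uniq.
Qed.

(** * Spanning the class functions on pi-elements *)

Section Span.

Variables (gT : finGroupType) (pi : nat_pred) (G0 M N : {group gT}).
Local Notation rho := (pi_restr pi).
Local Notation I := (Ipi pi).
Hypotheses (nsMN : M <| N) (sNG0 : N \subset G0) (piNM : pi.-group (N / M)%g).
Hypothesis fongM : pi_fong pi G0 M.
Variable sys : 'CF(M) -> 'CF(M).
Hypothesis sysP : forall nu, pi_irr pi nu ->
  [/\ sys nu \in irr M, 'I_N[nu] \subset 'I[sys nu] & rho (sys nu) = nu].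

Let freeM : free (I M).
Proof. by apply: pi_fong_free fongM; apply: subset_trans sNG0; apply: normal_sub. Qed.

Section Coset.

Variable x : gT.
Hypotheses (Nx : x \in N).
Let J := (M <*> <[x]>)%G.
Let A := ((M :* x) :&: pi_elts pi J)%g.
Let nMx : x \in 'N(M). Proof. exact: subsetP (normal_norm nsMN) x Nx. Qed.
Let sMJ : M \subset J. Proof. exact: joing_subl. Qed.
Let sJN : J \subset N. Proof. by rewrite join_subG normal_sub ?cycle_subG. Qed.
Let nsMJ : M <| J. Proof. exact: normalS nsMN. Qed.
Let cycJM : cyclic (J / M)%g.
Proof. by rewrite /= quotientYidl ?cycle_subG // quotient_cycle // cycle_cyclic. Qed.
Let piJM : pi.-group (J / M)%g. Proof. exact: pgroupS (quotientS M sJN) piNM. Qed.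
Let Jx : x \in J.
Proof. by rewrite (subsetP (joing_subr _ _)) ?cycle_id. Qed.
Let sMxJ : (M :* x)%g \subset J.
Proof. by rewrite mul_subG ?sub1set. Qed.

Let d : 'CF(J / M) := '1_[set coset M x].
Let D : 'CF(J) := (d %% M)%CF.

Let DE y : y \in J -> D y = (y \in (M :* x)%g)%:R.
Proof.
move=> Jy; have nMy := subsetP (normal_norm nsMJ) y Jy.
have nsd : [set coset M x] <| (J / M)%g.
  by rewrite -sub_abelian_normal ?cyclic_abelian // sub1set mem_quotient.
rewrite cfModE // cfuniE // inE; congr _%:R; congr (nat_of_bool _).
by apply/eqP/rcoset_kercosetP => // ->.
Qed.

Let d0 : '[d, 'chi_0] != 0.
Proof.
rewrite irr0 -cfuniG cfdot_cfuni ?normal_refl //; last first.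
  by rewrite -sub_abelian_normal ?cyclic_abelian // sub1set mem_quotient.
rewrite mulf_neq0 ?invr_eq0 ?neq0CG // pnatr_eq0 cards_eq0; apply/set0Pn.
by exists (coset M x); rewrite inE set11 mem_quotient.
Qed.

Let DMsum (f : 'CF(J)) : f * D = \sum_b '[d, 'chi_b] *: ('chi_(mod_Iirr b) * f).
Proof.
rewrite mulrC /D {1}[d]cfun_sum_cfdot linear_sum mulr_suml; apply: eq_bigr => b _.
by rewrite linearZ /= -scalerAl mod_IirrE.
Qed.

Let Ipx := [seq nu <- I M | (nu ^ x)%CF == nu].

Let IpxP nu : nu \in Ipx -> [/\ pi_irr pi nu, J \subset 'I_N[nu] & J \subset 'I[sys nu]].
Proof.
rewrite mem_filter => /andP[/eqP nux /IpiP irr_nu]; have [_ Isys _] := sysP irr_nu.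
have sJI : J \subset 'I_N[nu].
  rewrite join_subG subsetI normal_sub // sub_inertia cycle_subG.
  by rewrite 2!inE Nx nMx nux /=.
by split=> //; apply: subset_trans Isys.
Qed.

Let extension_exists (nu : 'CF(M)) : exists chi : 'CF(J),
  nu \in Ipx -> chi \in irr J /\ 'Res[M] chi = sys nu.
Proof.
have [Inu | _] := boolP (nu \in Ipx); last by exists 0.
have [irr_nu _ Isys] := IpxP Inu; have [/irrP[t Dt] _ _] := sysP irr_nu.
rewrite Dt in Isys *.
have [i Di] := cyclic_invariant_irr_extendible nsMJ cycJM Isys.
by exists 'chi_i; rewrite mem_irr.
Qed.

(* A dimension count: the [ch nu * D] are independent by the dual characters, and
   the x-invariant elements of [I M] are as many as the J-classes in A. *)
Let coset_functions : exists ch : 'CF(M) -> 'CF(J),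
  [/\ {in Ipx, forall nu, ch nu \in irr J /\ 'Res[M] (ch nu) = sys nu}
    & <<[seq rho (ch nu * D)%R | nu <- Ipx]>>%VS = 'CF(J, A)%VS].
Proof.
have [ch chP] := choice extension_exists; exists ch; split=> //.
have resM nu (b : Iirr (J / M)) : nu \in Ipx ->
    'Res[M] ('chi_(mod_Iirr b) * ch nu) = 'chi_b 1%g *: sys nu.
  move=> Inu; have [_ Dch] := chP nu Inu.
  rewrite rmorphM /= Dch mod_IirrE // cfRes_sub_ker ?cfker_mod // cfMod1.
  by rewrite -scalerAl mul1r.
have free_ch : free [seq rho (ch nu * D) | nu <- Ipx].
  apply: dual_free => [|nu Inu]; first by rewrite filter_uniq ?Ipi_uniq.
  have [irr_nu sJI Isys] := IpxP Inu; have [/irrP[t Dt] _ Dnu] := sysP irr_nu.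
  have [/irrP[i Di] Dch] := chP nu Inu.
  have sJInu : J \subset 'I[nu] by apply: subset_trans sJI (subsetIr _ _).
  have [H [alpha [defJ dual]]] := fongM nsMJ (subset_trans sJN sNG0) piJM irr_nu sJInu.
  have [piH irr_alpha _ _] := dual; have /irrP[a Da] := irr_alpha.
  have sHJ : H \subset J by rewrite -defJ mulG_subl.
  have multE := pi_dual_mult freeM irr_nu dual.
  rewrite -Dnu Dt in irr_nu sJInu dual.
  have ti : i \in irr_constt ('Ind[J] 'chi_t).
    by rewrite constt_Ind_Res -Di Dch Dt constt_irr inE.
  have IJ : 'I_J[rho 'chi_t] = J by apply/setIidPl.
  have [||beta [irr_beta i1 i0 nz_beta _]] :=
    pi_step_dual nsMJ freeM irr_nu _ _ dual ti.
  - by rewrite IJ -Dt.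
  - by rewrite IJ.
  have /irrP[k Dk] := irr_beta.
  pose Df : {linear 'CF(J) -> algC | *%R} := cfdotr beta \o 'Res[H].
  have DfV f : Df f = '['Res[H] f, beta] by [].
  have DfE f : Df (rho f) = Df f.
    by rewrite /Df /= pi_restr_Res // pi_restr_pgroup.
  have gal (b : Iirr (J / M)) : 'chi_(mod_Iirr b) * ch nu = 'chi_(mul_mod_Iirr i b).
    have DiM : 'Res[M] 'chi_i = 'chi_t by rewrite -Di Dch.
    have [irr_i _ _ _] := constt_Ind_ext nsMJ DiM.
    by rewrite /mul_mod_Iirr /mul_Iirr cfIirrE ?Di.
  have DiM : 'Res[M] 'chi_i = 'chi_t by rewrite -Di Dch.
  have [_ inj_i constt_i _] := constt_Ind_ext nsMJ DiM.
  have mul0i : mul_mod_Iirr i (0 : Iirr (J / M)) = i.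
    by apply: irr_inj; rewrite -gal mod_Iirr0 irr0 mul1r.
  exists Df; split=> [|nu' Inu' ne_nu].
    (* Among the products of ['chi_i] with characters of [J / M], only ['chi_i] itself meets [beta];
       its coefficient is ['[d, 'chi_0]]. *)
    rewrite DfE DfV DMsum linear_sum cfdot_suml (bigD1 0) //= big1 => [|b nz_b].
      by rewrite addr0 gal mul0i linearZ cfdotZl i1 mulr1.
    rewrite gal linearZ cfdotZl i0 ?mulr0 //; first by rewrite constt_i codom_f.
    by rewrite -{2}mul0i (inj_eq inj_i).
  rewrite DfE DfV DMsum linear_sum cfdot_suml big1 //= => b _; rewrite linearZ cfdotZl.
  have [irr_nu' _ _] := IpxP Inu'; have [irr_ch' _] := chP nu' Inu'.
  have /irrP[j Dj] : 'chi_(mod_Iirr b) * ch nu' \in irr J.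
    apply: mul_lin_irr => //; rewrite mod_IirrE // cfMod_lin_char //.
    by rewrite irr_cyclic_lin.
  (* A nonzero pairing would put [alpha] below a character whose restriction to [M] is a multiple of
     [sys nu'], so [nu] would occur in [nu']. *)
  have [-> | nz] := eqVneq '['Res[H] ('chi_(mod_Iirr b) * ch nu'), beta] 0; first by rewrite mulr0.
  rewrite Dj Dk in nz; rewrite Dk Da in nz_beta.
  have := cfdot_Res_neq0 sHJ (subsetIl H M) nz nz_beta.
  rewrite -Da -Dj -(cfResRes _ (subsetIr H M)) // resM // linearZ cfdotZl multE.
  have [_ _ Dnu'] := sysP irr_nu'.
  rewrite -pi_mult_restr Dnu' pi_mult_irr //; last by rewrite -Dnu Dt.
  by rewrite (negPf ne_nu) mulr0 eqxx.
apply/eqP; rewrite eqEdim; apply/andP; split.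
  apply/span_subvP=> _ /mapP[nu _ ->]; apply/cfun_onP=> y.
  rewrite !inE negb_and => A'y; rewrite pi_restrE; case: ifP => // pi_y.
  have [Jy | J'y] := boolP (y \in J); last by rewrite cfun0.
  by move: A'y; rewrite cfunE DE // pi_y andbT Jy orbF => /negPf->; rewrite mulr0.
by rewrite (eqnP free_ch) size_map -card_fixed_Ipi // (mem_p_elt piNM) ?mem_quotient.
Qed.

(** The part [f] of [phi] on [M :* x] lies in the span of the functions [rho (ch nu * D)]. Each
    [ch nu * D] is a combination of irreducible characters of [J] over [sys nu], and these induce to
    [N] with all constituents over [sys nu]. So [f] is orthogonal to the whole span, hence to
    itself. *)
Lemma orthogonal_vanish phi : rho phi = phi ->
    (forall i nu, pi_irr pi nu -> '['Res[M] 'chi[N]_i, sys nu] != 0 -> '[phi, 'chi_i] = 0) ->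
  phi x = 0.
Proof.
move=> rho_phi orth_phi; have [pi_x | pi'x] := boolP (pi.-elt x)%g; last first.
  by rewrite -rho_phi pi_restrE (negPf pi'x).
have [ch [chP span_ch]] := coset_functions.
pose f := rho ('Res[J] phi * D).
have Af : f \in 'CF(J, A)%VS.
  apply/cfun_onP=> y; rewrite !inE negb_and => A'y; rewrite pi_restrE; case: ifP => // pi_y.
  have [Jy | J'y] := boolP (y \in J); last by rewrite cfun0.
  by move: A'y; rewrite cfunE DE // pi_y andbT Jy orbF => /negPf->; rewrite mulr0.
suffices: f = 0.
  move/(congr1 (fun g : 'CF(J) => g x)); rewrite pi_restrE pi_x !cfunE cfResE // DE //.
  by rewrite rcoset_refl mulr1.
have dot_f nu : nu \in Ipx -> '[f, rho (ch nu * D)] = 0.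
  move=> Inu; have [irr_nu _ _] := IpxP Inu; have [irr_ch Dch] := chP nu Inu.
  (* [D] takes only the values 0 and 1 and [phi] vanishes off pi-elements, so the truncations do not
     change the inner product. *)
  transitivity '['Res[J] phi, ch nu * D].
    rewrite !cfdotE; congr (_ * _); apply: eq_bigr => y Jy.
    rewrite !pi_restrE; case: ifP => [_ | pi'y]; last first.
      by rewrite mul0r cfResE // -rho_phi pi_restrE pi'y mul0r.
    by rewrite !cfunE DE //; case: (_ \in _); rewrite ?mulr1 ?mulr0 ?conjC0 ?mulr0.
  rewrite DMsum cfdot_sumr big1 // => b _; rewrite cfdotZr.
  have /irrP[j Dj] : 'chi_(mod_Iirr b) * ch nu \in irr J.
    apply: mul_lin_irr => //; rewrite mod_IirrE // cfMod_lin_char //.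
    by rewrite irr_cyclic_lin.
  rewrite Dj cfdot_Res_l ['Ind[N] _]cfun_sum_constt cfdot_sumr big1 ?mulr0 // => i.
  rewrite constt_Ind_Res cfdotZr => ij; rewrite (orth_phi i nu) ?mulr0 //.
  have [/irrP[t Dt] _ _] := sysP irr_nu; rewrite Dt.
  apply: cfdot_Res_neq0 sJN sMJ ij _; rewrite -Dj -Dt rmorphM /= Dch.
  rewrite mod_IirrE // cfRes_sub_ker ?cfker_mod // cfMod1 -scalerAl mul1r cfdotZl.
  by rewrite Dt cfnorm_irr mulr1 irr1_neq0.
move: Af; rewrite -span_ch => /(coord_span (X := in_tuple _)) Df.
apply/eqP; rewrite -cfnorm_eq0 {2}Df cfdot_sumr big1 // => i _.
rewrite cfdotZr; have /mapP[nu Inu ->] := mem_nth 0 (ltn_ord i).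
by rewrite dot_f // mulr0.
Qed.

End Coset.

Lemma orthogonal_eq0 phi : rho phi = phi ->
    (forall i nu, pi_irr pi nu -> '['Res[M] 'chi[N]_i, sys nu] != 0 -> '[phi, 'chi_i] = 0) ->
  phi = 0.
Proof.
move=> rho_phi orth; apply/cfun_inP=> x Nx; rewrite [RHS]cfunE.
exact: orthogonal_vanish.
Qed.

End Span.

Lemma span_map_sum (K : fieldType) (vT : vectType K) (T : eqType) (s : seq T) (F : T -> vT) v :
  uniq s -> v \in <<[seq F t | t <- s]>>%VS -> exists a, v = \sum_(t <- s) a t *: F t.
Proof.
elim: s v => [|t s IHs] v /=; first by rewrite span_nil memv0 => _ /eqP->; exists (fun=> 0); rewrite big_nil.
case/andP=> s't uniq_s; rewrite span_cons => /memv_addP[_ /vlineP[c ->] [w sw ->]].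
have [a ->] := IHs w uniq_s sw.
exists (fun t' => if t' == t then c else a t'); rewrite big_cons eqxx; congr (_ + _).
by apply: eq_big_seq => t' st'; case: eqP st' s't => // -> ->.
Qed.

(** * Partial characters over a pi-quotient *)

Section PiQuotient.

Variables (gT : finGroupType) (pi : nat_pred) (G0 M N : {group gT}).
Variable u : {rmorphism algC -> algC}.
Local Notation rho := (pi_restr pi).
Local Notation I := (Ipi pi).
Hypotheses (nsMN : M <| N) (sNG0 : N \subset G0) (piNM : pi.-group (N / M)%g).
Hypotheses (fongM : pi_fong pi G0 M) (liftM : pi_lifting pi G0 u M).

Let sMN : M \subset N. Proof. exact: normal_sub. Qed.
Let nMN : N \subset 'N(M). Proof. exact: normal_norm. Qed.
Let freeM : free (I M).
Proof. exact: pi_fong_free (subset_trans sMN sNG0) fongM. Qed.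

(** The reverse inclusion of stabilisers is automatic, by [inertia_pi_restr]. *)
Definition stable_lift (nu : 'CF(M)) (theta : 'CF(M)) : Prop :=
  [/\ theta \in irr M, 'I_N[nu] \subset 'I[theta] & rho theta = nu].

Lemma stable_lift_exists nu : pi_irr pi nu -> exists theta, stable_lift nu theta.
Proof.
move=> irr_nu.
have [theta [irr_th Ith _ Dnu]] := liftM (normal_Inertia nu sMN)
  (subset_trans (Inertia_sub _ _) sNG0) irr_nu (subsetIr _ _).
by exists theta.
Qed.

Lemma stable_liftJ nu theta y :
  y \in N -> stable_lift nu theta -> stable_lift (nu ^ y)%CF (theta ^ y)%CF.
Proof.
move=> Ny [irr_th Ith Dnu]; have nMy := subsetP nMN y Ny.
split; [exact: cfConjg_irr | | by rewrite -pi_restrJ Dnu].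
rewrite -!conjg_inertia // -{1}(conjGid Ny) -conjIg conjSg //.
Qed.

Lemma stable_lift_mult nu theta xi mu : pi_irr pi nu -> pi_irr pi mu -> stable_lift nu theta ->
  xi \in (theta ^: N)%CF -> mu \notin (nu ^: N)%CF -> pi_mult pi mu xi = 0.
Proof.
move=> irr_nu irr_mu [_ _ Dnu] /cfclassP[y Ny ->] not_mu.
rewrite -pi_mult_restr -pi_restrJ Dnu pi_mult_irr //; last exact: pi_irrJ.
by case: eqP not_mu => // <-; case/cfclassP; exists y.
Qed.

Lemma stable_lift_orbit nu t i mu : pi_irr pi nu -> pi_irr pi mu -> stable_lift nu 'chi_t ->
    i \in irr_constt ('Ind[N] 'chi_t) -> pi_mult pi mu ('Res[M] 'chi_i) != 0 ->
  mu \in (nu ^: N)%CF.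
Proof.
move=> irr_nu irr_mu lift_t; rewrite constt_Ind_Res => ti; apply: contraR => not_mu.
rewrite (Clifford_Res_sum_cfclass nsMN ti) linearZ linear_sum /= big_seq big1 ?mulr0 //.
by move=> xi th_xi; apply: (stable_lift_mult irr_nu irr_mu lift_t th_xi not_mu).
Qed.

(** [beta] separates ['chi_i] from the other characters over ['chi_t]. Any further character that
    meets [beta] also meets [alpha] below it, and so has [nu] in its restriction. *)
Lemma stable_lift_dual nu t i : pi_irr pi nu -> stable_lift nu 'chi_t ->
    i \in irr_constt ('Ind[N] 'chi_t) ->
  exists (H : {group gT}) (beta : 'CF(H)), [/\ H \subset N, pi.-group H, beta \in irr H,
    '['Res[H] 'chi_i, beta] = 1
    & forall j, '['Res[H] 'chi_j, beta] != 0 -> j != i ->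
        j \notin irr_constt ('Ind[N] 'chi_t) /\ pi_mult pi nu ('Res[M] 'chi_j) != 0].
Proof.
move=> irr_nu [_ It Dnu] ti; pose T := ('I_N[nu])%G.
have sTN : T \subset N by apply: Inertia_sub.
have [H [alpha [defT dual]]] := fongM (normal_Inertia nu sMN) (subset_trans sTN sNG0)
  (pgroupS (quotientS M sTN) piNM) irr_nu (subsetIr _ _).
have sHN : H \subset N by apply: subset_trans sTN; rewrite -[gval T]defT mulG_subl.
have [piH irr_alpha _ _] := dual; have multE := pi_dual_mult freeM irr_nu dual.
have /irrP[a Da] := irr_alpha.
rewrite -Dnu in irr_nu It dual.
have [|beta [irr_beta i1 i0 nz_beta _]] := pi_step_dual nsMN freeM irr_nu It _ dual ti.
  by rewrite defT Dnu.
exists H, beta; split=> // j nz_j ne_ji.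
split; first by apply: contraNN nz_j => tj; rewrite i0.
have /irrP[k Dk] := irr_beta; rewrite Dk in nz_j; rewrite Dk Da in nz_beta.
have := cfdot_Res_neq0 sHN (subsetIl H M) nz_j nz_beta.
by rewrite -Da -(cfResRes _ (subsetIr H M)) // multE.
Qed.

Lemma stable_lift_inj nu t i j : pi_irr pi nu -> stable_lift nu 'chi_t ->
    i \in irr_constt ('Ind[N] 'chi_t) -> j \in irr_constt ('Ind[N] 'chi_t) ->
  rho 'chi_i = rho 'chi_j -> i = j.
Proof.
move=> irr_nu lift_t ti tj eq_ij.
have [H [beta [sHN piH _ i1 j0]]] := stable_lift_dual irr_nu lift_t ti.
apply: contraTeq tj => ne_ij; rewrite eq_sym in ne_ij.
have [|not_tj _] // := j0 j _ ne_ij.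
suffices -> : 'Res[H] 'chi_j = 'Res[H] 'chi_i by rewrite i1 oner_eq0.
rewrite -[LHS](pi_restr_pgroup _ piH) -[RHS](pi_restr_pgroup _ piH).
by rewrite -!pi_restr_Res // eq_ij.
Qed.

Section System.

Variables (nu0 : 'CF(M)) (t0 : Iirr M).
Hypotheses (irr_nu0 : pi_irr pi nu0) (lift_t0 : stable_lift nu0 'chi_t0).

(** Independent choices for conjugate partial characters need not be conjugate, so one lift is
    chosen per [N]-orbit and transported. Prescribing the lift over the orbit of [nu0] lets facts
    about systems apply to any given stable lift. *)
Lemma lift_system : exists sys : 'CF(M) -> 'CF(M),
  [/\ forall nu, pi_irr pi nu -> stable_lift nu (sys nu),
      forall nu mu, pi_irr pi nu -> pi_irr pi mu -> mu \in (nu ^: N)%CF ->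
        sys mu \in (sys nu ^: N)%CF
    & sys nu0 \in ('chi_t0 ^: N)%CF].
Proof.
have /choice[lf lfP] (nu : 'CF(M)) : exists theta, pi_irr pi nu ->
    stable_lift nu theta /\ (nu \in (nu0 ^: N)%CF -> theta \in ('chi_t0 ^: N)%CF).
- have [/cfclassP[y Ny ->] | not_nu] := boolP (nu \in (nu0 ^: N)%CF).
    exists ('chi_t0 ^ y)%CF => _; split; first exact: stable_liftJ.
    by move=> _; apply/cfclassP; exists y.
  have [irr_nu | red_nu] := pselect (pi_irr pi nu); last by exists 0.
  by have [theta] := stable_lift_exists irr_nu; exists theta.
pose rep (nu : 'CF(M)) : 'CF(M) := (I M)`_(find (mem (nu ^: N)%CF) (I M)).
have repP nu : pi_irr pi nu -> pi_irr pi (rep nu) /\ rep nu \in (nu ^: N)%CF.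
  move=> irr_nu; have has_nu : has (mem (nu ^: N)%CF) (I M).
    by apply/hasP; exists nu; [apply/IpiP | apply: cfclass_refl].
  by split; [apply/IpiP; rewrite mem_nth // -has_find | apply: (nth_find 0 has_nu)].
have /choice[sys sysP] (nu : 'CF(M)) : exists theta, pi_irr pi nu ->
    stable_lift nu theta /\ theta \in (lf (rep nu) ^: N)%CF.
- have [irr_nu | red_nu] := pselect (pi_irr pi nu); last by exists 0.
  have [irr_rep] := repP nu irr_nu; rewrite cfclass_sym => /cfclassP[y Ny Dnu].
  exists (lf (rep nu) ^ y)%CF => _; split; last by apply/cfclassP; exists y.
  by rewrite {1}Dnu; apply: stable_liftJ => //; have [] := lfP _ irr_rep.
exists sys; split=> [nu /sysP[] // | nu mu irr_nu irr_mu nu_mu |].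
  have eq_rep : rep mu = rep nu.
    by rewrite /rep (eq_find (a2 := mem (nu ^: N)%CF)) // => xi; rewrite /= (cfclass_transr nu_mu).
  have [_ sys_mu] := sysP mu irr_mu; have [_ sys_nu] := sysP nu irr_nu.
  by rewrite -(cfclass_transr sys_nu) -eq_rep.
have [_ sys_nu0] := sysP nu0 irr_nu0; have [irr_rep rep_nu0] := repP nu0 irr_nu0.
have [_ /(_ rep_nu0)] := lfP _ irr_rep.
by move=> lf0; rewrite (cfclass_transr lf0).
Qed.

End System.

Section OverSystem.

Variable sys : 'CF(M) -> 'CF(M).
Hypothesis sys_lift : forall nu, pi_irr pi nu -> stable_lift nu (sys nu).
Hypothesis sys_class : forall nu mu, pi_irr pi nu -> pi_irr pi mu ->
  mu \in (nu ^: N)%CF -> sys mu \in (sys nu ^: N)%CF.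

Definition over_system : pred (Iirr N) :=
  [pred i | has (fun nu => '['Res[M] 'chi_i, sys nu] != 0) (I M)].

Lemma over_systemP i : reflect
  (exists nu t, [/\ pi_irr pi nu, sys nu = 'chi_t & i \in irr_constt ('Ind[N] 'chi_t)])
  (over_system i).
Proof.
apply: (iffP hasP) => [[nu /IpiP irr_nu] nz | [nu [t [irr_nu Dt]]]].
  have [/irrP[t Dt] _ _] := sys_lift irr_nu; exists nu, t.
  by rewrite constt_Ind_Res inE -Dt.
by rewrite constt_Ind_Res inE -Dt; exists nu => //; apply/IpiP.
Qed.

Lemma over_system_dual i : over_system i -> exists (H : {group gT}) (beta : 'CF(H)),
  [/\ H \subset N, pi.-group H, beta \in irr H, '['Res[H] 'chi_i, beta] = 1
    & forall j, over_system j -> j != i -> '['Res[H] 'chi_j, beta] = 0].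
Proof.
case/over_systemP=> nu [t [irr_nu Dt ti]]; have := sys_lift irr_nu; rewrite Dt => lift_t.
have [H [beta [sHN piH irr_beta i1 j0]]] := stable_lift_dual irr_nu lift_t ti.
exists H, beta; split=> // j /over_systemP[mu [s [irr_mu Ds sj]]] ne_ji.
apply: contraTeq sj => /j0/(_ ne_ji)[not_tj nu_j]; apply: contra not_tj => sj.
have := sys_lift irr_mu; rewrite Ds => lift_s.
have /(sys_class irr_mu irr_nu) := stable_lift_orbit irr_mu irr_nu lift_s sj nu_j.
by rewrite Dt Ds => /(cfclass_Ind nsMN) <-.
Qed.

Let X := enum over_system.

Lemma over_system_free : free [seq rho 'chi_i | i <- X].
Proof.
apply: dual_free => [|i]; rewrite ?enum_uniq // mem_enum => Xi.
have [H [beta [sHN piH irr_beta i1 j0]]] := over_system_dual Xi.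
pose D : {linear 'CF(N) -> algC | *%R} := cfdotr beta \o 'Res[H].
have DE f : D (rho f) = '['Res[H] f, beta].
  by rewrite /D /= pi_restr_Res // pi_restr_pgroup.
exists D; rewrite DE i1 oner_neq0; split=> // j; rewrite mem_enum => Xj ne_ji.
by rewrite DE j0.
Qed.

(** By [orthogonal_eq0] the pairings with the characters in [over_system] separate functions
    supported on pi-elements. The dimension is thus at most their number, and independence does the
    rest. *)
Lemma over_system_span : <<[seq rho 'chi_i | i <- X]>>%VS = 'CF(N, pi_elts pi N)%VS.
Proof.
have rho_on (f : 'CF(N)) : rho f \in 'CF(N, pi_elts pi N)%VS.
  apply/cfun_onP=> x; rewrite inE negb_and pi_restrE => N'x.
  case: ifP => // pi_x; move: N'x; rewrite pi_x orbF => N'x; exact: cfun0.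
have rho_id (f : 'CF(N)) : f \in 'CF(N, pi_elts pi N)%VS -> rho f = f.
  move=> Af; apply/cfun_inP=> x Nx; rewrite pi_restrE; case: ifPn => // pi'x.
  by rewrite (cfun_on0 Af) // inE Nx.
apply/eqP; rewrite eqEdim; apply/andP; split.
  by apply/span_subvP=> _ /mapP[i _ ->].
rewrite (eqnP over_system_free) size_map -cardE.
pose F (f : 'CF(N)) : 'rV[algC]_#|over_system| := \row_j '[f, 'chi_(enum_val j)].
have linF : linear F.
  by move=> c f g; apply/rowP=> j; rewrite !mxE cfdotDl cfdotZl.
pose Fl := HB.pack_for {linear 'CF(N) -> 'rV[algC]_#|over_system|} F
  (GRing.isLinear.Build _ _ _ _ F linF).
pose h := linfun Fl.
rewrite -(limg_dim_eq (f := h)); first by rewrite (leq_trans (dimvS (subvf _))) // dimvf /dim /= mul1n.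
apply/eqP; rewrite -subv0; apply/subvP=> f /memv_capP[Af].
rewrite memv_ker lfunE /= => /eqP/rowP F0; rewrite memv0; apply/eqP.
apply: (orthogonal_eq0 nsMN sNG0 piNM fongM sys_lift) (rho_id _ Af) _ => i nu irr_nu nz.
have Xi : i \in over_system by apply/hasP; exists nu => //; apply/IpiP.
by have := F0 (enum_rank_in Xi i); rewrite !mxE enum_rankK_in.
Qed.

(** Pairing with the dual characters shows that [kappa] has natural coefficients in the basis just
    found; irreducibility leaves a single term. *)
Lemma pi_irr_over_system kappa : pi_irr pi kappa ->
  exists2 i, over_system i & kappa = rho 'chi_i.
Proof.
move=> irr_k; have [k Dk] := pi_irr_irr irr_k.
have: kappa \in <<[seq rho 'chi_i | i <- X]>>%VS.
  rewrite over_system_span; apply/cfun_onP=> x; rewrite inE negb_and Dk pi_restrE => N'x.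
  case: ifP => // pi_x; move: N'x; rewrite pi_x orbF => N'x; exact: cfun0.
case/(span_map_sum (enum_uniq _)) => a Da.
have a_nat i : over_system i -> a i \in Num.nat.
  move=> Xi; have [H [beta [sHN piH irr_beta i1 j0]]] := over_system_dual Xi.
  have : '['Res[H] 'chi_k, beta] \in Num.nat.
    by rewrite Cnat_cfdot_char ?cfRes_char ?irr_char ?irrWchar.
  have -> : '['Res[H] 'chi_k, beta] = '['Res[H] kappa, beta].
    by rewrite Dk pi_restr_Res // pi_restr_pgroup.
  rewrite Da linear_sum cfdot_suml big_enum /=.
  rewrite (bigD1 i) //= big1 => [|j /andP[Xj ne_ji]].
    rewrite addr0 linearZ /= cfdotZl pi_restr_Res // pi_restr_pgroup // i1 mulr1; exact.
  by rewrite linearZ /= cfdotZl pi_restr_Res // pi_restr_pgroup // j0 ?mulr0.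
have [i Xi nz_ai] : exists2 i, over_system i & a i != 0.
  apply: contrapT => no_i; have /eqP[] := pi_partial_neq0 (pi_irr_partial irr_k).
  rewrite Da big_enum big1 //= => i Xi.
  have [-> | nz] := eqVneq (a i) 0; first by rewrite scale0r.
  by case: no_i; exists i.
exists i => //; have /natrP[n Dn] := a_nat i Xi.
case: n Dn => [|n] Dn; first by rewrite Dn eqxx in nz_ai.
pose chi := n%:R *: 'chi_i + \sum_(j | over_system j && (j != i)) a j *: 'chi_j.
apply: (pi_irr_add (chi := chi)) irr_k (pi_restr_irr_partial _ _) _ _.
  rewrite rpredD // ?rpred_sum // => [|j /andP[Xj _]].
    by rewrite scaler_nat rpredMn ?irr_char.
  by have /natrP[m ->] := a_nat j Xj; rewrite scaler_nat rpredMn ?irr_char.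
rewrite Da big_enum (bigD1 i) //= /chi linearD addrA; congr (_ + _).
  by rewrite Dn -addn1 natrD addrC scalerDl scale1r linearZ.
by rewrite linear_sum; apply: eq_bigr => j _; rewrite linearZ.
Qed.

(** If the restriction were reducible, its irreducible summands would come from other members of the
    system, all orthogonal to [beta], although ['chi_i] pairs with [beta] to 1. *)
Lemma over_system_irr i : over_system i -> pi_irr pi (rho 'chi_i).
Proof.
move=> Xi; have [H [beta [sHN piH irr_beta i1 j0]]] := over_system_dual Xi.
have DE (f : 'CF(N)) : '['Res[H] (rho f), beta] = '['Res[H] f, beta].
  by rewrite pi_restr_Res // pi_restr_pgroup.
have [s irr_s Ds] := pi_partial_sum (pi_restr_irr_partial pi i).
apply: contrapT => red_i; have /eqP[] := oner_neq0 algC.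
rewrite -i1 -DE Ds linear_sum cfdot_suml big_seq big1 //= => psi /irr_s irr_psi.
have [j Xj Dj] := pi_irr_over_system irr_psi; rewrite Dj DE j0 //.
by apply: contra_not_neq red_i => <-; rewrite -Dj.
Qed.

End OverSystem.

Theorem pi_irr_over_lift nu t kappa : pi_irr pi nu -> stable_lift nu 'chi_t ->
    pi_irr pi kappa -> pi_mult pi nu ('Res[M] kappa) != 0 ->
  exists2 i, i \in irr_constt ('Ind[N] 'chi_t) & kappa = rho 'chi_i.
Proof.
move=> irr_nu lift_t irr_k nu_k.
have [sys [sys_lift sys_class sys_nu]] := lift_system irr_nu lift_t.
have [i Xi Di] := pi_irr_over_system sys_lift sys_class irr_k.
have [mu [s [irr_mu Ds si]]] := elimT (over_systemP sys_lift i) Xi.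
exists i => //; have := sys_lift _ irr_mu; rewrite Ds => lift_s.
rewrite Di pi_restr_Res // pi_mult_restr in nu_k.
have nu_mu := stable_lift_orbit irr_mu irr_nu lift_s si nu_k.
have := sys_class _ _ irr_mu irr_nu nu_mu; rewrite Ds => /(cfclass_Ind nsMN) eq1.
by rewrite (cfclass_Ind nsMN sys_nu) -eq1.
Qed.

Theorem pi_lift_irr nu t i : pi_irr pi nu -> stable_lift nu 'chi_t ->
  i \in irr_constt ('Ind[N] 'chi_t) -> pi_irr pi (rho 'chi_i).
Proof.
move=> irr_nu lift_t ti.
have [sys [sys_lift sys_class sys_nu]] := lift_system irr_nu lift_t.
apply: (over_system_irr sys_lift sys_class); apply/(over_systemP sys_lift).
have [/irrP[s Ds] _ _] := sys_lift _ irr_nu; exists nu, s; split=> //.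
by rewrite -Ds -(cfclass_Ind nsMN sys_nu).
Qed.

Lemma stable_lift_Res nu t i : pi_irr pi nu -> stable_lift nu 'chi_t ->
    i \in irr_constt ('Ind[N] 'chi_t) ->
  pi_mult pi nu ('Res[M] (rho 'chi_i)) = '['Ind[N] 'chi_t, 'chi_i].
Proof.
move=> irr_nu [_ It Dnu] ti; pose T := ('I_N[nu])%G.
have sTN : T \subset N by apply: Inertia_sub.
have [H [alpha [defT dual]]] := fongM (normal_Inertia nu sMN) (subset_trans sTN sNG0)
  (pgroupS (quotientS M sTN) piNM) irr_nu (subsetIr _ _).
rewrite -Dnu in irr_nu It dual *.
rewrite pi_restr_Res // pi_mult_restr (pi_step_dual_mult nsMN freeM irr_nu It dual ti).
by rewrite -cfdot_Res_r cfdotC conj_natr // Cnat_cfdot_char ?cfRes_char ?irr_char.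
Qed.

(** Ordinary reciprocity is read off from a stable lift of [mu]: the constituents of the character
    induced from it restrict to distinct irreducible partial characters. *)
Theorem pi_reciprocity mu kappa : free (I N) -> pi_irr pi mu -> pi_irr pi kappa ->
  pi_mult pi kappa ('Ind[N] mu) = pi_mult pi mu ('Res[M] kappa).
Proof.
move=> freeN irr_mu irr_k; have [theta lift_th] := stable_lift_exists irr_mu.
have [/irrP[t Dt] _ Dmu] := lift_th; rewrite Dt in lift_th Dmu.
rewrite -{1}Dmu -pi_restr_Ind // ['Ind[N] _]cfun_sum_constt !linear_sum /=.
have [mu_k | /eqP mu_k] := boolP (pi_mult pi mu ('Res[M] kappa) == 0).
  rewrite (eqP mu_k) big1 // => i ti; rewrite !linearZ /= pi_mult_irr //; last first.
    exact: pi_lift_irr lift_th ti.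
  case: eqP => [Di | _]; last by rewrite mulr0.
  by rewrite -Di (stable_lift_Res irr_mu lift_th ti) in mu_k; rewrite (eqP mu_k) mul0r.
have [i ti Di] := pi_irr_over_lift irr_mu lift_th irr_k (introN eqP mu_k).
rewrite Di (stable_lift_Res irr_mu lift_th ti) (bigD1 i) //= big1 ?addr0 => [|j /andP[tj ne_ji]].
  by rewrite !linearZ /= pi_mult_irr ?eqxx ?mulr1 // -Di.
rewrite !linearZ /= pi_mult_irr -?Di //; last exact: pi_lift_irr lift_th tj.
case: eqP => [Dj | _]; last by rewrite mulr0.
by case/eqP: ne_ji; apply: stable_lift_inj lift_th tj ti _; rewrite // Dj.
Qed.

End PiQuotient.

(** * Lifts and dual characters through chief factors *)

(** Frattini argument: [N] is already transitive on the [L]-conjugates of [nu]. *)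
Lemma inertia_factor (gT : finGroupType) (L N M : {group gT}) (nu : 'CF(M)) :
    M <| L -> N \subset L -> {in L, forall g, (nu ^ g)%CF \in (nu ^: N)%CF} ->
  ('I_L[nu] * N)%g = L.
Proof.
move=> nsML sNL nu_class; have nML := normal_norm nsML.
apply/eqP; rewrite eqEsubset mul_subG ?Inertia_sub //=.
apply/subsetP=> g Lg; have /cfclassP[n Nn nug] := nu_class g Lg.
have Ln := subsetP sNL n Nn.
rewrite -(mulgKV n g) mem_mulg // inE groupM ?groupV //= inE groupM ?groupV ?(subsetP nML) //=.
by rewrite (cfConjgM _ nsML) ?groupV // nug cfConjgK.
Qed.

Lemma pi_restr_aut (gT : finGroupType) (pi : nat_pred) (u : {rmorphism algC -> algC})
    (G : {group gT}) (f : 'CF(G)) :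
  cfAut u (pi_restr pi f) = pi_restr pi (cfAut u f).
Proof.
apply/cfunP=> x; rewrite cfunE !pi_restrE cfunE.
by case: (pi.-elt x)%g; rewrite ?rmorph0.
Qed.

Section StepTools.

Variables (gT : finGroupType) (pi : nat_pred).
Local Notation rho := (pi_restr pi).
Local Notation I := (Ipi pi).
Implicit Types L M N H : {group gT}.

(** The type of [alpha] mentions the intersection, so replacing it by an equal group requires a
    transport. *)
Lemma pi_dual_eq_group H M (alpha : 'CF(H :&: M)) (nu : 'CF(M)) (K : {group gT}) :
    pi_dual pi alpha nu -> K = (H :&: M)%G ->
  exists alpha' : 'CF(K), [/\ alpha' \in irr K, H \subset 'I[alpha']
    & forall psi : 'CF(M), pi_irr pi psi -> '['Res[K] psi, alpha'] = (psi == nu)%:R].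
Proof. by case=> _ irr_alpha IH dual ->; exists alpha. Qed.

Lemma pi_mult_cfclass M N (nu mu : 'CF(M)) : M <| N -> free (I M) -> pi_irr pi nu -> pi_irr pi mu ->
  pi_mult pi mu (\sum_(xi <- (nu ^: N)%CF) xi) = (mu \in (nu ^: N)%CF)%:R.
Proof.
move=> nsMN freeM irr_nu irr_mu; rewrite linear_sum /=.
have irr_class xi : xi \in (nu ^: N)%CF -> pi_irr pi xi.
  by case/cfclassP=> y _ ->; apply: pi_irrJ.
have [nu_mu | not_mu] := boolP (mu \in _).
  rewrite (bigD1_seq mu) ?cfclass_uniq //= pi_mult_irr // eqxx big_seq_cond big1 ?addr0 //.
  by move=> xi /andP[/irr_class irr_xi /negPf ne]; rewrite pi_mult_irr // ne.
rewrite big_seq big1 // => xi xiP; have irr_xi := irr_class xi xiP; rewrite pi_mult_irr //.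
by case: eqP xiP not_mu => // -> /[swap] /negPf->.
Qed.

End StepTools.

Section PiStep.

Variables (gT : finGroupType) (pi : nat_pred) (G0 M N : {group gT}).
Variable u : {rmorphism algC -> algC}.
Local Notation rho := (pi_restr pi).
Local Notation I := (Ipi pi).
Hypothesis u_pi : forall z : algC, z ^+ (#|G0|`_pi) = 1 -> u z = z.
Hypotheses (nsMG : M <| G0) (nsNG : N <| G0) (sMN : M \subset N) (piNM : pi.-group (N / M)%g).
Hypotheses (fongM : pi_fong pi G0 M) (liftM : pi_lifting pi G0 u M).

Let sNG0 : N \subset G0. Proof. exact: normal_sub. Qed.
Let nsMN : M <| N. Proof. exact: normalS nsMG. Qed.
Let freeM : free (I M).
Proof. exact: pi_fong_free (subset_trans sMN sNG0) fongM. Qed.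

Section Invariant.

Variables (L : {group gT}) (kappa : 'CF(N)).
Hypotheses (nsNL : N <| L) (sLG0 : L \subset G0).
Hypotheses (irr_k : pi_irr pi kappa) (ILk : L \subset 'I[kappa]).

Let sNL : N \subset L. Proof. exact: normal_sub. Qed.
Let nsML : M <| L. Proof. by apply: normalS nsMG => //; apply: subset_trans sNL. Qed.
Let nNL : L \subset 'N(N). Proof. exact: normal_norm. Qed.
Let nML : L \subset 'N(M). Proof. exact: normal_norm. Qed.

(** Only one character over ['chi_t] restricts to [kappa], so whatever fixes both ['chi_t] and
    [kappa] fixes ['chi_i]. This covers [u] and the stabiliser of [nu], which together with [N]
    generates [L]. *)
Lemma pi_step_invariant : exists (nu : 'CF(M)) (t : Iirr M) (i : Iirr N),
  [/\ pi_irr pi nu,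
      [/\ 'I_L[nu] \subset 'I['chi_t], cfAut u 'chi_t = 'chi_t & stable_lift pi N nu 'chi_t],
      i \in irr_constt ('Ind[N] 'chi_t) /\ kappa = rho 'chi_i,
      ('I_L[nu] * N)%g = L
    & L \subset 'I['chi_i] /\ cfAut u 'chi_i = 'chi_i].
Proof.
have [nu irr_nu nz_nu] : exists2 nu, pi_irr pi nu & pi_mult pi nu ('Res[M] kappa) != 0.
  exact: pi_partial_mult_neq0 (pi_partial_Res sMN (pi_irr_partial irr_k)).
have [_ [/irrP[t ->] It u_t Dnu]] := liftM (normal_Inertia nu (normal_sub nsML))
  (subset_trans (Inertia_sub _ _) sLG0) irr_nu (subsetIr _ _).
have lift_t : stable_lift pi N nu 'chi_t.
  by split; rewrite ?mem_irr // (subset_trans _ It) // setSI.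
have [i ti Di] := pi_irr_over_lift nsMN sNG0 piNM fongM liftM irr_nu lift_t irr_k nz_nu.
have nz_e : '['Res[M] 'chi_i, 'chi_t] != 0 by rewrite constt_Ind_Res inE in ti.
have defL : ('I_L[nu] * N)%g = L.
  apply: inertia_factor => // g Lg.
  apply: (stable_lift_orbit nsMN sNG0 fongM irr_nu (pi_irrJ g irr_nu) lift_t ti).
  rewrite -pi_mult_restr -pi_restr_Res // -Di.
  rewrite -(inertiaJ (subsetP ILk g Lg)) -cfConjgRes_norm ?(subsetP nML) ?(subsetP nNL) //.
  by rewrite pi_multJ.
exists nu, t, i; split=> //; have inj_i := stable_lift_inj nsMN sNG0 piNM fongM irr_nu lift_t.
split.
  apply/subsetP=> g; rewrite -defL => /mulsgP[h n Th Nn ->].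
  rewrite groupM //; last by rewrite (subsetP (sub_inertia _)).
  have Lh := subsetP (Inertia_sub _ _) h Th.
  rewrite inE (subsetP nNL) //=; apply/eqP; rewrite -conjg_IirrE; congr 'chi_ _.
  apply: inj_i => //; last by rewrite conjg_IirrE -pi_restrJ -Di inertiaJ // (subsetP ILk).
  rewrite constt_Ind_Res inE conjg_IirrE -cfConjgRes_norm ?(subsetP nML) ?(subsetP nNL) //.
  by rewrite -(inertiaJ (subsetP It h Th)) cfConjg_iso.
rewrite -aut_IirrE; congr 'chi_ _; apply: inj_i => //.
  rewrite constt_Ind_Res inE aut_IirrE -cfAutRes.
  by rewrite -[X in '[_, X]]u_t cfdot_aut_irr fmorph_eq0.
by rewrite aut_IirrE -pi_restr_aut -Di (cfAut_partial u_pi sNG0) //; apply: pi_irr_partial.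
Qed.

End Invariant.

Lemma pi_lifting_pi_step : pi_lifting pi G0 u N.
Proof.
move=> L kappa nsNL sLG0 irr_k ILk.
have [nu [t [i [_ _ [_ Di] _ [ILi u_i]]]]] := pi_step_invariant nsNL sLG0 irr_k ILk.
by exists 'chi_i; rewrite mem_irr -Di.
Qed.

(** The supplement [H] for the stabiliser of [nu] in [L] works again. By the modular law [H :&: N]
    supplements [M] in the stabiliser within [N], and the partner [beta] of ['chi_i] is
    [H]-invariant by uniqueness. *)
Lemma pi_fong_pi_step : pi_fong pi G0 N.
Proof.
move=> L kappa nsNL sLG0 piLN irr_k ILk.
have [nu [t [i [irr_nu [It _ lift_t] [ti Di] defL [ILi _]]]]] :=
  pi_step_invariant nsNL sLG0 irr_k ILk.
have sNL := normal_sub nsNL; have sML := subset_trans sMN sNL.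
have nsML : M <| L by apply: normalS nsMG.
pose T := ('I_L[nu])%G; have sTL : T \subset L := Inertia_sub _ _.
have piTM : pi.-group (T / M)%g.
  apply: pgroupS (quotientS M sTL) _.
  rewrite /pgroup card_quotient ?normal_norm // -(Lagrange_index sNL sMN) pnatM.
  by rewrite -!card_quotient ?normal_norm // [pnat _ _]piLN.
have [H [alpha [defT dual]]] := fongM (normal_Inertia nu sML) (subset_trans sTL sLG0)
  piTM irr_nu (subsetIr _ _).
have sHT : H \subset T by rewrite -[gval T]defT mulG_subl.
have sHL := subset_trans sHT sTL.
have [piH _ _ _] := dual; pose H1 := (H :&: N)%G.
have eqH1 : (H1 :&: M)%G = (H :&: M)%G.
  by apply: val_inj; rewrite /= -setIA (setIidPr sMN).
have [alpha1 [irr_alpha1 IHa1 dual1]] := pi_dual_eq_group dual eqH1.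
have dualH1 : pi_dual pi (alpha1 : 'CF(H1 :&: M)) nu.
  split=> //; first exact: pgroupS (subsetIl _ _) piH.
  exact: subset_trans (subsetIl _ _) IHa1.
have defT1 : (H1 * M)%g = 'I_N[nu].
  by rewrite /= setIC group_modr //= defT setIA (setIidPl sNL).
have [_ ItN Dnu] := lift_t; have multE := pi_dual_mult freeM irr_nu dualH1.
have step := pi_step_dual nsMN freeM _ _ _ _ ti; rewrite Dnu in step.
have [beta [irr_beta i1 i0 nz_beta uniq_beta]] := step _ _ irr_nu ItN defT1 dualH1.
exists H, beta; split.
  by rewrite -defL -[X in _ = (X * _)%g]defT -mulgA (mulSGid sMN).
have sH1N : H1 \subset N := subsetIr _ _.
have piH1 : pi.-group H1 := pgroupS (subsetIl _ _) piH.
have nH1H : H \subset 'N(H1) by rewrite normsI ?normG // (subset_trans sHL) ?normal_norm.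
have nH1MH : H \subset 'N(H1 :&: M) by rewrite normsI // (subset_trans sHL) ?normal_norm.
split=> // [|psi irr_psi].
  apply/subsetP=> h Hh; rewrite inE (subsetP nH1H) //=; apply/eqP; apply: uniq_beta.
  - exact: cfConjg_irr.
  - rewrite -cfConjgRes_norm ?(subsetP nH1MH) ?(subsetP nH1H) //.
    by rewrite -(inertiaJ (subsetP IHa1 h Hh)) cfConjg_iso.
  have Lh := subsetP sHL h Hh; rewrite -(inertiaJ (subsetP ILi h Lh)).
  rewrite -cfConjgRes_norm ?(subsetP nH1H) ?(subsetP (normal_norm nsNL)) //.
  by rewrite cfConjg_iso i1 oner_neq0.
have [k Dk] := pi_irr_irr irr_psi.
have DE : '['Res[H1] psi, beta] = '['Res[H1] 'chi_k, beta].
  by rewrite Dk pi_restr_Res // pi_restr_pgroup.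
have inj_i := stable_lift_inj nsMN sNG0 piNM fongM irr_nu lift_t.
have [nu_psi | nz] := eqVneq (pi_mult pi nu ('Res[M] psi)) 0; last first.
  have [j tj Dj] := pi_irr_over_lift nsMN sNG0 piNM fongM liftM irr_nu lift_t irr_psi nz.
  have -> : '['Res[H1] psi, beta] = '['Res[H1] 'chi_j, beta].
    by rewrite Dj pi_restr_Res // pi_restr_pgroup.
  have [eq_ji | ne_ji] := eqVneq j i; first by rewrite eq_ji i1 Dj eq_ji -Di eqxx.
  rewrite i0 //; case: eqP => // eq_psi; case/eqP: ne_ji; apply: inj_i => //.
  by rewrite -Dj -Di.
case: eqP => [eq_psi | _].
  have := stable_lift_Res nsMN sNG0 piNM fongM irr_nu lift_t ti.
  rewrite -Di -eq_psi nu_psi => /esym/eqP; have := ti; rewrite inE => /negPf-> //.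
(* If [beta] occurred in [psi], so would [alpha1], and [nu] would occur in the restriction of
   [psi]. *)
apply/eqP; apply: contraTT isT => nz_k; rewrite DE in nz_k.
have /irrP[b Db] := irr_beta; have /irrP[a Da] := irr_alpha1.
rewrite Db in nz_k; rewrite Db Da in nz_beta.
have := cfdot_Res_neq0 sH1N (subsetIl H1 M) nz_k nz_beta.
rewrite -Da -(cfResRes _ (subsetIr H1 M)) // multE -pi_mult_restr -pi_restr_Res // -Dk nu_psi.
by rewrite eqxx.
Qed.

End PiStep.

Lemma cfclass_sum (gT : finGroupType) (N M : {group gT}) (nu mu : 'CF(M)) :
    M <| N -> mu \in (nu ^: N)%CF ->
  \sum_(xi <- (mu ^: N)%CF) xi = \sum_(xi <- (nu ^: N)%CF) xi.
Proof.
move=> nsMN nu_mu; apply: perm_big; apply: uniq_perm; rewrite ?cfclass_uniq // => xi.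
by rewrite (cfclass_transr nu_mu).
Qed.

(** * Passing through a pi'-factor *)

Section PiComplementStep.

Variables (gT : finGroupType) (pi : nat_pred) (G0 M N : {group gT}).
Variable u : {rmorphism algC -> algC}.
Local Notation rho := (pi_restr pi).
Local Notation I := (Ipi pi).
Hypothesis u_pi : forall z : algC, z ^+ (#|G0|`_pi) = 1 -> u z = z.
Hypotheses (nsMG : M <| G0) (nsNG : N <| G0) (sMN : M \subset N).
Hypotheses (pi'NM : pi^'.-group (N / M)%g) (oddNM : odd #|N : M|).
Hypothesis u_inv : forall z : algC, z ^+ #|N : M| = 1 -> u z = z^-1.
Hypotheses (fongM : pi_fong pi G0 M) (liftM : pi_lifting pi G0 u M).

Let sNG0 : N \subset G0. Proof. exact: normal_sub. Qed.
Let nsMN : M <| N. Proof. exact: normalS nsMG. Qed.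
Let freeM : free (I M).
Proof. exact: pi_fong_free (subset_trans sMN sNG0) fongM. Qed.

(** All pi-elements of [N] lie in [M]. *)
Lemma pi_restr_eq_Res (f g : 'CF(N)) : rho f = f -> rho g = g -> 'Res[M] f = 'Res[M] g -> f = g.
Proof.
move=> Df Dg eq_fg; apply/cfun_inP=> x Nx; rewrite -Df -Dg !pi_restrE.
case: ifP => // pi_x; suffices Mx : x \in M by rewrite -!(cfResE _ sMN) // eq_fg.
have nMx := subsetP (normal_norm nsMN) x Nx; apply: coset_idr => //.
apply/eqP; rewrite -order_eq1; apply/eqP.
apply: (@pnat_1 pi); first exact: morph_p_elt.
by apply: mem_p_elt pi'NM _; rewrite mem_quotient.
Qed.

(** A stable lift of [nu] has a unique fixed extension to its stabiliser in [N], which is invariant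
    under the stabiliser of [nu] in [L] by that uniqueness. The Clifford correspondence makes the
    character induced from it to [N] irreducible. *)
Lemma pi'_orbit_lift (L : {group gT}) (nu : 'CF(M)) :
    N <| L -> L \subset G0 -> pi_irr pi nu -> ('I_L[nu] * N)%g = L ->
  exists chi : 'CF(N), [/\ chi \in irr N, L \subset 'I[chi], cfAut u chi = chi
     & 'Res[M] (rho chi) = \sum_(xi <- (nu ^: N)%CF) xi].
Proof.
move=> nsNL sLG0 irr_nu defL; have sNL := normal_sub nsNL; have sML := subset_trans sMN sNL.
have nsML : M <| L by apply: normalS nsMG.
pose T := ('I_L[nu])%G; have sTL : T \subset L := Inertia_sub _ _.
have nsMT : M <| T := normal_Inertia nu sML.
have [_ [/irrP[t ->] It u_t Dnu]] := liftM nsMT (subset_trans sTL sLG0) irr_nu (subsetIr _ _).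
pose K := ('I_N['chi_t])%G; have sKN : K \subset N := Inertia_sub _ _.
have eqI : 'I_N['chi_t] = 'I_N[nu].
  apply/eqP; rewrite eqEsubset -{1}Dnu inertia_pi_restr subsetI subsetIl.
  by apply: subset_trans It; rewrite setSI.
have sMK : M \subset K := sub_Inertia _ sMN.
have nsMK : M <| K := normal_Inertia _ sMN.
have dvd_K : (#|K : M| %| #|N : M|)%N by rewrite -(Lagrange_index sKN sMK) dvdn_mull.
have oddK : odd #|K : M| by apply: dvdn_odd oddNM.
have u_invK (z : algC) : z ^+ #|K : M| = 1 -> u z = z^-1.
  by move=> zK; apply: u_inv; have /dvdnP[q ->] := dvd_K; rewrite mulnC exprM zK expr1n.
have [psi ext_psi] := fixed_extension_exists nsMK oddK u_invK (mem_irr t) (subsetIr _ _) u_t.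
have sKT : K \subset T by rewrite /= eqI setSI.
have nKT : T \subset 'N(K).
  rewrite /= eqI; apply: normsI; first exact: subset_trans sTL (normal_norm nsNL).
  exact: subset_trans (subsetIr _ _) (normG _).
have Tpsi : T \subset 'I[psi].
  apply/subsetP=> h Th; rewrite inE (subsetP nKT) //=; apply/eqP.
  apply: (fixed_extension_inj nsMK oddK u_invK (mem_irr t) sMK (subxx K) ext_psi).
  exact: (fixed_extension_conj nsMT It sMK sKT Th (subsetP nKT h Th) ext_psi).
have [/irrP[s Ds] Dpsi u_psi] := ext_psi; rewrite Ds in Dpsi u_psi Tpsi.
have ts : s \in irr_constt ('Ind[K] 'chi_t) by rewrite constt_Ind_Res Dpsi constt_irr inE.
have [irr_ind _ _ _ res_ind] := constt_Inertia_bijection t nsMN.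
have /irrP[i Di] := irr_ind s ts.
exists ('Ind[N] 'chi_s); split; first exact: irr_ind.
- apply/subsetP=> g; rewrite -{1}defL => /mulsgP[h n Th Nn ->].
  rewrite groupM //; last by rewrite (subsetP (sub_inertia _)).
  have nNh : h \in 'N(N) by rewrite (subsetP (normal_norm nsNL)) // (subsetP sTL).
  rewrite inE nNh /= cfConjgInd_norm ?(subsetP nKT) //; apply/eqP; congr ('Ind _).
  by apply: inertiaJ; apply: (subsetP Tpsi).
- by rewrite cfAutInd u_psi.
have ei1 : '['Res[M] 'chi_i, 'chi_t] = 1.
  by rewrite -Di -res_ind //= Dpsi cfnorm_irr.
rewrite pi_restr_Res // Di (Clifford_Res_sum_cfclass (j := t) nsMN); last first.
  by rewrite inE ei1 oner_eq0.
rewrite ei1 scale1r linear_sum /= /cfclass eqI !big_image.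
by apply: eq_bigr => A _; rewrite -pi_restrJ Dnu.
Qed.

(** Multiplicities are constant on [N]-orbits, so subtracting an orbit lift over some [nu] that
    occurs keeps them natural while the degree drops. *)
Lemma pi'_nat_mult_char (f : 'CF(N)) : rho f = f ->
    (forall mu, pi_irr pi mu -> pi_mult pi mu ('Res[M] f) \in Num.nat) ->
  exists2 chi, chi \is a character & f = rho chi.
Proof.
have mult1 (g : 'CF(N)) : rho g = g -> g 1%g = \sum_(mu <- I M) pi_mult pi mu ('Res[M] g) * mu 1%g.
  move=> Dg; rewrite -(cfRes1 M) -{1}Dg pi_restr_Res // pi_mult_sum sum_cfunE.
  by apply: eq_bigr => mu _; rewrite cfunE.
have irr1_nat mu : pi_irr pi mu -> mu 1%g \in Num.nat.
  by move=> irr_mu; have [j ->] := pi_irr_irr irr_mu; rewrite pi_restr1 Cnat_irr1.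
move=> rho_f nat_f; have: f 1%g \in Num.nat.
  rewrite mult1 // big_seq rpred_sum // => mu /IpiP irr_mu.
  by rewrite rpredM ?nat_f ?irr1_nat.
case/natrP=> n; elim/ltn_ind: n f rho_f nat_f => n IHn f rho_f nat_f fn.
have [[nu irr_nu nz_nu] | no_nu] := pselect
    (exists2 nu : 'CF(M), pi_irr pi nu & pi_mult pi nu ('Res[M] f) != 0); last first.
  exists 0; rewrite ?rpred0 // linear0; apply: pi_restr_eq_Res; rewrite ?linear0 //.
  rewrite -rho_f pi_restr_Res // pi_mult_sum big_seq big1 // => mu /IpiP irr_mu.
  have [-> | nz] := eqVneq (pi_mult pi mu ('Res[M] f)) 0; first by rewrite scale0r.
  by case: no_nu; exists mu.
have defN : ('I_N[nu] * N)%g = N by rewrite mulSGid ?Inertia_sub.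
have [chi [irr_chi _ _ Dchi]] := pi'_orbit_lift (normal_refl N) sNG0 irr_nu defN.
have class_mult mu : pi_irr pi mu -> pi_mult pi mu ('Res[M] (rho chi)) = (mu \in (nu ^: N)%CF)%:R.
  by move=> irr_mu; rewrite Dchi pi_mult_cfclass.
pose g := f - rho chi.
have rho_g : rho g = g by rewrite /g linearB /= pi_restr_id rho_f.
have mult_g mu : pi_irr pi mu ->
    pi_mult pi mu ('Res[M] g) = pi_mult pi mu ('Res[M] f) - (mu \in (nu ^: N)%CF)%:R.
  by move=> irr_mu; rewrite /g !linearB /= class_mult.
have nat_g mu : pi_irr pi mu -> pi_mult pi mu ('Res[M] g) \in Num.nat.
  move=> irr_mu; rewrite mult_g //; case: cfclassP => [[y Ny Dmu] | _]; last by rewrite subr0 nat_f.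
  have nMy := subsetP (normal_norm nsMN) y Ny.
  have -> : pi_mult pi mu ('Res[M] f) = pi_mult pi nu ('Res[M] f).
    rewrite Dmu -{1}(cfConjg_id f Ny) -cfConjgRes_norm ?(subsetP (normG N)) //.
    by rewrite pi_multJ.
  have /natrP[k Dk] := nat_f nu irr_nu; rewrite Dk in nz_nu *.
  by case: k nz_nu {Dk} => [|k _]; rewrite ?eqxx // -addn1 natrD addrK rpred_nat.
have chi_gt0 : 0 < chi 1%g by have /irrP[j ->] := irr_chi; apply: irr1_gt0.
have /natrP[m gm] : g 1%g \in Num.nat.
  rewrite mult1 // big_seq rpred_sum // => mu /IpiP irr_mu.
  by rewrite rpredM ?nat_g ?irr1_nat.
have lt_mn : (m < n)%N.
  have g1 : g 1%g = f 1%g - chi 1%g by rewrite -[chi 1%g](pi_restr1 pi) !cfunE.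
  by rewrite -(ltr_nat algC) -gm -fn g1 gtrBl.
have [psi Npsi Dg] := IHn m lt_mn g rho_g nat_g gm.
exists (psi + chi); first by rewrite rpredD // irrWchar.
by rewrite linearD /= -Dg subrK.
Qed.

(** What remains of [kappa] after removing an orbit lift still restricts with natural
    multiplicities, so it comes from a character, and irreducibility of [kappa] makes it vanish. *)
Lemma pi'_irr_Res (kappa : 'CF(N)) : pi_irr pi kappa ->
  exists2 nu : 'CF(M), pi_irr pi nu & 'Res[M] kappa = \sum_(xi <- (nu ^: N)%CF) xi.
Proof.
move=> irr_k; have Pk := pi_irr_partial irr_k.
have [nu irr_nu nz_nu] : exists2 nu : 'CF(M), pi_irr pi nu & pi_mult pi nu ('Res[M] kappa) != 0.
  exact: pi_partial_mult_neq0 (pi_partial_Res sMN Pk).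
have defN : ('I_N[nu] * N)%g = N by rewrite mulSGid ?Inertia_sub.
have [chi [irr_chi _ _ Dchi]] := pi'_orbit_lift (normal_refl N) sNG0 irr_nu defN.
exists nu => //; rewrite -Dchi; congr ('Res _).
have [||psi Npsi Dpsi] := @pi'_nat_mult_char (kappa - rho chi).
- by rewrite linearB /= pi_restr_id pi_irr_restr.
- move=> mu irr_mu; rewrite !linearB /= Dchi pi_mult_cfclass //.
  have nat_k := pi_mult_partial_nat freeM (pi_partial_Res sMN Pk).
  case: cfclassP => [[y Ny Dmu] | _]; last by rewrite subr0 nat_k.
  have nMy := subsetP (normal_norm nsMN) y Ny.
  have -> : pi_mult pi mu ('Res[M] kappa) = pi_mult pi nu ('Res[M] kappa).
    rewrite Dmu -{1}(cfConjg_id kappa Ny) -cfConjgRes_norm ?(subsetP (normG N)) //.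
    by rewrite pi_multJ.
  have /natrP[k Dk] := nat_k nu irr_nu; rewrite Dk in nz_nu *.
  by case: k nz_nu {Dk} => [|k _]; rewrite ?eqxx // -addn1 natrD addrK rpred_nat.
apply: (pi_irr_add irr_k _ Npsi); last by rewrite -Dpsi addrC subrK.
by have /irrP[j ->] := irr_chi; apply: pi_restr_irr_partial.
Qed.

(** An irreducible summand of the orbit lift restricts to a full orbit sum, and by nonnegativity of
    multiplicities that orbit must be the one of [nu]. *)
Lemma pi'_irr_exists (nu : 'CF(M)) : pi_irr pi nu ->
  exists2 kappa : 'CF(N), pi_irr pi kappa & 'Res[M] kappa = \sum_(xi <- (nu ^: N)%CF) xi.
Proof.
move=> irr_nu; have defN : ('I_N[nu] * N)%g = N by rewrite mulSGid ?Inertia_sub.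
have [chi [irr_chi _ _ Dchi]] := pi'_orbit_lift (normal_refl N) sNG0 irr_nu defN.
have Pchi : pi_partial_char pi (rho chi).
  by have /irrP[j ->] := irr_chi; apply: pi_restr_irr_partial.
have [s irr_s Ds] := pi_partial_sum Pchi.
case: s irr_s Ds => [_ D0 | psi s irr_s Ds].
  by have /eqP[] := pi_partial_neq0 Pchi; rewrite D0 big_nil.
have irr_psi : pi_irr pi psi by apply: irr_s; rewrite inE eqxx.
have [mu irr_mu Dpsi] := pi'_irr_Res irr_psi.
exists psi => //; rewrite Dpsi; apply: cfclass_sum => //; apply: contraT => not_mu.
have := pi_mult_cfclass nsMN freeM irr_nu irr_mu.
rewrite -Dchi Ds big_cons !linearD /= Dpsi pi_mult_cfclass // cfclass_refl (negPf not_mu).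
rewrite linear_sum linear_sum /= => /eqP; rewrite paddr_eq0 ?ler01 ?oner_eq0 //.
rewrite big_seq sumr_ge0 // => g s_g; apply: natr_ge0.
apply: pi_mult_partial_nat => //; apply: pi_partial_Res => //.
by apply/pi_irr_partial/irr_s; rewrite inE s_g orbT.
Qed.

Lemma pi'_irr_invariant (L : {group gT}) (kappa : 'CF(N)) :
    N <| L -> L \subset G0 -> pi_irr pi kappa -> L \subset 'I[kappa] ->
  exists nu : 'CF(M), [/\ pi_irr pi nu, 'Res[M] kappa = \sum_(xi <- (nu ^: N)%CF) xi
    & ('I_L[nu] * N)%g = L].
Proof.
move=> nsNL sLG0 irr_k ILk; have [nu irr_nu Dk] := pi'_irr_Res irr_k.
have sNL := normal_sub nsNL; have sML := subset_trans sMN sNL.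
have nsML : M <| L by apply: normalS nsMG.
exists nu; split=> //; apply: inertia_factor => // g Lg.
have irr_nug := pi_irrJ g irr_nu.
have := pi_mult_cfclass nsMN freeM irr_nu irr_nug.
rewrite -Dk -{1}(inertiaJ (subsetP ILk g Lg)).
rewrite -cfConjgRes_norm ?(subsetP (normal_norm nsML)) ?(subsetP (normal_norm nsNL)) //.
rewrite pi_multJ // Dk pi_mult_cfclass // cfclass_refl.
by case: (_ \in _) => // /eqP; rewrite oner_eq0.
Qed.

Lemma pi_lifting_pi'_step : pi_lifting pi G0 u N.
Proof.
move=> L kappa nsNL sLG0 irr_k ILk.
have [nu [irr_nu Dk defL]] := pi'_irr_invariant nsNL sLG0 irr_k ILk.
have [chi [irr_chi ILchi u_chi Dchi]] := pi'_orbit_lift nsNL sLG0 irr_nu defL.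
exists chi; split=> //; apply: (pi_restr_eq_Res (pi_restr_id _ _) (pi_irr_restr irr_k)).
by rewrite Dchi.
Qed.

(** In the stabiliser [T] of [nu], the group [K / M] is a normal pi'-subgroup with pi-quotient.
    Schur-Zassenhaus gives a complement [C / M], and the dual character for [M] inside [C] also
    serves for [N]. *)
Lemma pi_fong_pi'_step : pi_fong pi G0 N.
Proof.
move=> L kappa nsNL sLG0 piLN irr_k ILk.
have [nu [irr_nu Dk defL]] := pi'_irr_invariant nsNL sLG0 irr_k ILk.
have sNL := normal_sub nsNL; have sML := subset_trans sMN sNL.
have nsML : M <| L by apply: normalS nsMG.
pose T := ('I_L[nu])%G; have sTL : T \subset L := Inertia_sub _ _.
have nsMT : M <| T := normal_Inertia nu sML.
have sMT := normal_sub nsMT; have nMT := normal_norm nsMT.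
pose K := (T :&: N)%G; have sKT : K \subset T := subsetIl _ _.
have sMK : M \subset K by rewrite subsetI sMT sMN.
have nsKT : K <| T by rewrite /normal sKT normsI ?normG // (subset_trans sTL) ?normal_norm.
have pi'KM : pi^'.-group (K / M)%g := pgroupS (quotientS M (subsetIr T N)) pi'NM.
have nNT : T \subset 'N(N) by rewrite (subset_trans sTL) ?normal_norm.
have iTK : #|T : K| = #|L : N| by rewrite indexgI -indexMg -(normC nNT) defL.
have piTK : pi.-nat #|T : K|.
  by rewrite iTK -card_quotient ?normal_norm.
have iTKM : #|T / M : K / M|%g = #|T : K|.
  by rewrite index_quotient_eq // subIset ?sMK ?orbT.
have hallK : Hall (T / M) (K / M).
  rewrite /Hall quotientS //= -/K iTKM coprime_sym.
  exact: pnat_coprime piTK pi'KM.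
have /splitsP[Cb /complP[tiKC defT]] := SchurZassenhaus_split hallK (quotient_normal M nsKT).
have sCT : Cb \subset (T / M)%g by rewrite -defT mulG_subr.
have [C defC sMC sCT'] := inv_quotientS nsMT sCT.
have nsMC : M <| C by apply: normalS nsMT.
have piCM : pi.-group (C / M)%g.
  rewrite -defC /pgroup; suffices -> : #|Cb| = #|T : K| by [].
  apply/eqP; rewrite -(eqn_pmul2l (cardG_gt0 (K / M)%G)) -iTKM.
  by rewrite -(TI_cardMg tiKC) defT Lagrange ?quotientS.
have nKC : C \subset 'N(K) := subset_trans sCT' (normal_norm nsKT).
have defT' : (K * C)%g = T.
  rewrite -norm_joinEr //; apply/eqP; rewrite eqEsubset join_subG sKT sCT' /=.
  rewrite -(quotientSGK nMT); last by rewrite (subset_trans sMK) ?joing_subl.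
  have -> : ((K <*> C)%G / M = (K / M) * (C / M))%g.
    by rewrite -quotientMl ?(subset_trans sKT) // -(norm_joinEr nKC).
  by rewrite -defC defT.
have sCI : C \subset 'I[nu] by apply: subset_trans sCT' (subsetIr _ _).
have [H [alpha [defH dual]]] := fongM nsMC (subset_trans sCT' (subset_trans sTL sLG0)) piCM irr_nu sCI.
have sHC : H \subset C by rewrite -[gval C]defH mulG_subl.
(* The image of [H :&: N] modulo [M] lies in both [K / M] and its complement. Thus [H] meets [N] and
   [M] in the same group, where [alpha] lives. *)
have sHNM : H :&: N \subset M.
  have sHT := subset_trans sHC sCT'.
  rewrite -quotient_sub1; last by apply: subset_trans (subsetIl _ _) (subset_trans sHT nMT).
  rewrite -tiKC subsetI; apply/andP; split.
    exact/quotientS/setSI.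
  by rewrite defC quotientS // subIset ?sHC.
have eqHN : (H :&: N)%G = (H :&: M)%G.
  apply: val_inj; apply/eqP; rewrite eqEsubset; apply/andP; split; last exact: setIS.
  by rewrite subsetI subsetIl.
have [alpha1 [irr_alpha1 IHa1 dual1]] := pi_dual_eq_group dual eqHN.
have [piH _ _ _] := dual.
exists H, alpha1; split.
  rewrite -(mulSGid sMN) mulgA defH -defL.
  have -> : 'I_L[nu] = (C * K)%g.
    by rewrite -[LHS]defT' (normC nKC).
  by rewrite -mulgA (mulSGid (subsetIr T N)).
split=> // psi irr_psi.
have [mu irr_mu Dpsi] := pi'_irr_Res irr_psi.
have DE f : '['Res[(H :&: N)%G] f, alpha1] = pi_mult pi nu f.
  pose D : {linear 'CF(M) -> algC | *%R} := cfdotr alpha1 \o 'Res[(H :&: N)%G].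
  apply: (pi_mult_functional (D := D)) => // g.
  rewrite /D /= pi_restr_Res // pi_restr_pgroup //.
  exact: pgroupS (subsetIl _ _) piH.
rewrite -(cfResRes psi sHNM sMN) DE Dpsi pi_mult_cfclass //.
congr _%:R; congr (nat_of_bool _); apply/idP/eqP=> [mu_nu | eq_psi].
  apply: (pi_restr_eq_Res (pi_irr_restr irr_psi) (pi_irr_restr irr_k)).
  by rewrite Dpsi Dk (cfclass_sum nsMN mu_nu).
have := pi_mult_cfclass nsMN freeM irr_mu irr_nu.
rewrite -Dpsi eq_psi Dk pi_mult_cfclass // cfclass_refl.
by case: (_ \in _) => // /eqP; rewrite oner_eq0.
Qed.

End PiComplementStep.

(** * Induction along the normal series *)

Lemma pgroup_quotient_le (gT : finGroupType) (pi : nat_pred) (A V K : {group gT}) :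
    A \subset 'N(V) -> A \subset 'N(K) -> A :&: V \subset K ->
  pi.-group (A / V)%g ->
  pi.-group (A / K)%g.
Proof.
move=> nVA nKA sAVK; rewrite /pgroup !card_quotient // -(indexgI A K) -(indexgI A V).
apply: pnat_dvd; rewrite -(@Lagrange_index _ A (A :&: K) (A :&: V)) ?subsetIl ?dvdn_mulr //.
by rewrite subsetI subsetIl.
Qed.

(** Intersecting the terms of the given series with [M] and joining them with [N] climbs from [N] to
    [M]; [K] is the last term still proper in [M]. *)
Lemma pi_separable_step (gT : finGroupType) (pi : nat_pred) (G N M : {group gT}) :
    pi_separable pi G -> N <| G -> M <| G -> N \proper M ->
  exists K : {group gT}, [/\ K <| G, N \subset K, K \proper M & pi.-group (M / K)%g || pi^'.-group (M / K)%g].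
Proof.
case=> s ser_s last_s nsNG nsMG ltNM.
have sNM := proper_sub ltNM; have nNG := normal_norm nsNG; have nMG := normal_norm nsMG.
have lt1 : (N <*> (1%G :&: M))%g \proper M.
  by rewrite (setIidPl (sub1G M)) joingG1.
have ns1 : (1%G : {group gT}) <| G := normal1 G.
elim: s (1%G : {group gT}) ns1 lt1 ser_s last_s => [|W s IHs] V nsVG ltVM /=.
  move=> _ defV; have /negP[] := proper_subn ltVM.
  by rewrite defV (setIidPr (normal_sub nsMG)) joing_subr.
case/andP=> /andP[/and3P[nVG nWG nsVW] piWV] ser_s last_s.
have nsWG : W <| G.
  rewrite /normal nWG andbT -last_s; elim: s {IHs last_s nsVW piWV nWG} W ser_s => //= X s IHs W.
  case/andP=> /andP[/and3P[_ _ /normal_sub sWX] _] /IHs; exact: subset_trans.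
have [ltWM | ] := boolP ((N <*> (W :&: M))%g \proper M); first exact: (IHs W).
rewrite properE join_subG sNM subsetIr negbK /= => sMW.
pose K := (N <*> (V :&: M))%G; exists K.
have nsKG : K <| G by rewrite normalY ?normalI.
have sKM := proper_sub ltVM; have nKM := subset_trans (normal_sub nsMG) (normal_norm nsKG).
have sWMW : W :&: M \subset W := subsetIl _ _.
have defM : (M / K = (W :&: M) / K)%g.
  have {1}<- : ((W :&: M) <*> K)%g = M.
    apply/eqP; rewrite eqEsubset join_subG subsetIr sKM /=.
    apply: subset_trans sMW _; rewrite join_subG joing_subl andbT.
    by apply: subset_trans (joing_subr _ _); apply: joing_subl.
  by rewrite quotientYidr // (subset_trans (subsetIr W M)).
split; first exact: nsKG.
- exact: joing_subl.
- exact: ltVM.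
have step (rho : nat_pred) : rho.-group (W / V)%g -> rho.-group (M / K)%g.
  move=> rhoWV; rewrite defM; apply: (@pgroup_quotient_le _ rho (W :&: M)%G V).
  - by apply: subset_trans sWMW (normal_norm nsVW).
  - by apply: subset_trans (subsetIr _ _) nKM.
  - by apply: subset_trans (joing_subr _ _); rewrite /= setIAC (setIidPr (normal_sub nsVW)).
  exact: pgroupS (quotientS V sWMW) rhoWV.
by case/orP: piWV => /step->; rewrite ?orbT.
Qed.


Section TrivialGroup.

Variables (gT : finGroupType) (pi : nat_pred).

Lemma pi_irr_trivial (M : {group gT}) (eta : 'CF(M)) : (M :=: 1)%g -> pi_irr pi eta -> eta = 1.
Proof.
move=> M1 /pi_irr_irr[i ->]; apply/cfun_inP=> x Mx; have /set1P-> : x \in [1 gT] by rewrite -M1.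
have lin_i : 'chi_i \is a linear_char by apply: char_abelianP; rewrite M1 abelian1.
by rewrite pi_restr1 lin_char1 // cfun11.
Qed.

Lemma pi_lifting_trivial (G M : {group gT}) u : (M :=: 1)%g -> pi_lifting pi G u M.
Proof.
move=> M1 L eta nsML _ /(pi_irr_trivial M1)-> _; exists 1; split; rewrite ?cfun1_irr ?rmorph1 //.
  by apply/subsetP=> x Lx; rewrite inE (subsetP (normal_norm nsML)) //= rmorph1.
rewrite pi_restr_pgroup // M1; exact: pgroup1.
Qed.

Lemma pi_fong_trivial (G M : {group gT}) : (M :=: 1)%g -> pi_fong pi G M.
Proof.
move=> M1 L eta nsML _ piLM irr_eta _; exists L, 1; split; first by rewrite M1 mulg1.
have piL : pi.-group L.
  rewrite /pgroup -(LagrangeI L M) pnatM; move: piLM.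
  by rewrite /pgroup card_quotient ?normal_norm // => ->; rewrite M1 setIg1 cards1.
split=> //; first exact: cfun1_irr.
  by apply/subsetP=> x Lx; rewrite inE (subsetP (normsI (normG L) (normal_norm nsML))) //= rmorph1.
move=> psi irr_psi; rewrite (pi_irr_trivial M1 irr_eta) (pi_irr_trivial M1 irr_psi) eqxx rmorph1.
by rewrite -irr0 cfnorm_irr.
Qed.

End TrivialGroup.

(** One [u], chosen for [#|G|], serves all normal subgroups. The hypothesis on 2 makes every index
    that is a pi'-number odd. *)
Lemma pi_fong_lifting (gT : finGroupType) (pi : nat_pred) (G : {group gT}) :
    pi_separable pi G -> 2%N \in pi \/ odd #|G| ->
  exists u : {rmorphism algC -> algC},
    [/\ forall M N : {group gT}, N <| G -> M \subset N -> pi^'.-group (N / M)%g -> M <| G ->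
          odd #|N : M| /\ (forall z : algC, z ^+ #|N : M| = 1 -> u z = z^-1)
      & forall N : {group gT}, N <| G -> pi_fong pi G N /\ pi_lifting pi G u N].
Proof.
move=> sepG pi2; have [u [u_pi u_pi']] := pi_Galois_aut pi (cardG_gt0 G).
exists u.
have indexP (M N : {group gT}) : N <| G -> M \subset N -> pi^'.-group (N / M)%g -> M <| G ->
    odd #|N : M| /\ (forall z : algC, z ^+ #|N : M| = 1 -> u z = z^-1).
  move=> nsNG sMN + nsMG; rewrite /pgroup card_quotient; last first.
    exact: subset_trans (normal_sub nsNG) (normal_norm nsMG).
  move=> pi'i; have dv_i : (#|N : M| %| #|G|)%N.
    by rewrite (dvdn_trans (dvdn_indexg N M)) ?cardSg ?normal_sub.
  split=> [|z zi]; last first.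
    apply: u_pi'; have := partn_dvd pi^' (cardG_gt0 G) dv_i.
    by rewrite part_pnat_id // => /dvdnP[q ->]; rewrite mulnC exprM zi expr1n.
  case: pi2 => [pi_2 | oddG]; last exact: dvdn_odd dv_i oddG.
  rewrite odd_2'nat; apply: sub_in_pnat pi'i => p _; rewrite !inE; apply: contraNneq => ->.
  exact: pi_2.
split=> // N; have [n] := ubnP #|N|; elim: n N => // n IHn N leNn nsNG.
have [N1 | ntN] := eqsVneq N 1%g; first by split; [apply: pi_fong_trivial | apply: pi_lifting_trivial].
have [|K [nsKG _ ltKN]] := pi_separable_step sepG (normal1 G : (1%G : {group gT}) <| G) nsNG.
  by rewrite proper1G.
have sKN := proper_sub ltKN; have ltKn : (#|K| < n)%N by apply: leq_trans (proper_card ltKN) _.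
have [fongK liftK] := IHn K ltKn nsKG.
case/orP=> [piNK | pi'NK].
  by split; [apply: (@pi_fong_pi_step _ _ _ K N u) | apply: (@pi_lifting_pi_step _ _ _ K N u)].
have [oddNK u_inv] := indexP _ _ nsNG sKN pi'NK nsKG.
by split; [apply: (@pi_fong_pi'_step _ _ _ K N u) | apply: (@pi_lifting_pi'_step _ _ _ K N u)].
Qed.

(** * The correspondence *)

Section Correspondence.

Variables (gT : finGroupType) (pi : nat_pred) (G : {group gT}) (u : {rmorphism algC -> algC}).
Local Notation rho := (pi_restr pi).
Local Notation I := (Ipi pi).
Implicit Types K M N : {group gT}.

Hypothesis sepG : pi_separable pi G.
Hypothesis index_pi' : forall M N, N <| G -> M \subset N -> pi^'.-group (N / M)%g -> M <| G ->
  odd #|N : M| /\ (forall z : algC, z ^+ #|N : M| = 1 -> u z = z^-1).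
Hypothesis fong_lift : forall N, N <| G -> pi_fong pi G N /\ pi_lifting pi G u N.

Lemma free_Ipi N : N <| G -> free (I N).
Proof. by move=> nsNG; apply: pi_fong_free (normal_sub nsNG) (fong_lift nsNG).1. Qed.

Lemma pi_mult_Res_conj N M (kappa : 'CF(M)) (eta : 'CF(N)) g : N <| G -> g \in 'N(M) -> g \in G ->
  pi_irr pi eta -> pi_mult pi (eta ^ g)%CF ('Res[N] (kappa ^ g)%CF) = pi_mult pi eta ('Res[N] kappa).
Proof.
move=> nsNG nMg Gg irr_eta.
by rewrite -cfConjgRes_norm ?(subsetP (normal_norm nsNG)) // pi_multJ // free_Ipi.
Qed.

(** Multiplicities in partial characters are natural numbers, so nothing cancels in the sum over the
    intermediate [mu]. *)
Lemma pi_mult_Res_transP N K M (eta : 'CF(N)) (kappa : 'CF(M)) :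
    N <| G -> K <| G -> N \subset K -> K \subset M -> pi_irr pi eta -> pi_partial_char pi kappa ->
  reflect (exists mu : 'CF(K), [/\ pi_irr pi mu, pi_mult pi mu ('Res[K] kappa) != 0
     & pi_mult pi eta ('Res[N] mu) != 0])
    (pi_mult pi eta ('Res[N] kappa) != 0).
Proof.
move=> nsNG nsKG sNK sKM irr_eta Pk.
have Nk mu : pi_irr pi mu -> pi_mult pi mu ('Res[K] kappa) \in Num.nat.
  exact: pi_mult_partial_nat (free_Ipi nsKG) _ _ (pi_partial_Res sKM Pk).
have Nmu mu : pi_irr pi mu -> pi_mult pi eta ('Res[N] (mu : 'CF(K))) \in Num.nat.
  by move=> irr_mu; rewrite pi_mult_partial_nat ?free_Ipi //; apply/pi_partial_Res/pi_irr_partial.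
have -> : pi_mult pi eta ('Res[N] kappa)
    = \sum_(mu <- I K | mu \in I K) pi_mult pi mu ('Res[K] kappa) * pi_mult pi eta ('Res[N] mu).
  rewrite -big_seq -(cfResRes _ sNK sKM) -[in LHS](pi_partial_restr (pi_partial_Res sKM Pk)).
  by rewrite pi_mult_sum !linear_sum; apply: eq_bigr => mu _; rewrite !linearZ.
rewrite psumr_neq0 => [|mu /IpiP irr_mu]; last by rewrite mulr_ge0 // natr_ge0 ?Nk ?Nmu.
apply: (iffP hasP) => [[mu /IpiP irr_mu /andP[_ /lt0r_neq0]] | [mu [irr_mu nz_k nz_mu]]].
  by rewrite mulf_eq0 negb_or => /andP[]; exists mu.
have Imu : mu \in I K by apply/IpiP.
by exists mu; rewrite // Imu lt0r mulf_neq0 // mulr_ge0 ?natr_ge0 ?Nk ?Nmu.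
Qed.

Lemma pi_Clifford_step K M (kappa : 'CF(M)) (mu nu : 'CF(K)) :
    K <| G -> M <| G -> K \subset M -> pi.-group (M / K)%g || pi^'.-group (M / K)%g ->
    pi_irr pi kappa -> pi_irr pi mu -> pi_irr pi nu ->
    pi_mult pi mu ('Res[K] kappa) != 0 -> pi_mult pi nu ('Res[K] kappa) != 0 ->
  nu \in (mu ^: M)%CF.
Proof.
move=> nsKG nsMG sKM + irr_k irr_mu irr_nu nz_mu nz_nu.
have nsKM := normalS sKM (normal_sub nsMG) nsKG; have freeK := free_Ipi nsKG.
have [fongK liftK] := fong_lift nsKG; case/orP=> [piMK | pi'MK].
  have [theta lift_mu] := stable_lift_exists nsKM (normal_sub nsMG) liftK irr_mu.
  have [/irrP[t Dt] _ _] := lift_mu; rewrite Dt in lift_mu.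
  have [i ti Dk] := pi_irr_over_lift nsKM (normal_sub nsMG) piMK fongK liftK irr_mu lift_mu irr_k nz_mu.
  apply: (stable_lift_orbit nsKM (normal_sub nsMG) fongK irr_mu irr_nu lift_mu ti).
  by rewrite -pi_mult_restr -pi_restr_Res // -Dk.
have [oddMK u_inv] := index_pi' nsMG sKM pi'MK nsKG.
have [xi irr_xi Dk] := pi'_irr_Res nsKG nsMG sKM pi'MK oddMK u_inv fongK liftK irr_k.
move: nz_mu nz_nu; rewrite Dk !pi_mult_cfclass // !pnatr_eq0 !eqb0 !negbK => xi_mu xi_nu.
by rewrite -(cfclass_transr xi_mu).
Qed.

(** If [eta] lies below [mu] and [nu] below [xi], both [mu] and [xi] below [kappa], then [xi] is a
    conjugate of [mu] by some [g] in [M]. Now [eta ^ g] and [nu] both lie below [xi], and induction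
    applies to [K]. *)
Lemma pi_Clifford N M (kappa : 'CF(M)) (eta nu : 'CF(N)) :
    N <| G -> M <| G -> N \subset M ->
    pi_irr pi kappa -> pi_irr pi eta -> pi_irr pi nu ->
    pi_mult pi eta ('Res[N] kappa) != 0 -> pi_mult pi nu ('Res[N] kappa) != 0 ->
  nu \in (eta ^: M)%CF.
Proof.
move=> nsNG; have [n] := ubnP #|M|; elim: n M kappa eta nu => // n IHn M kappa eta nu leMn nsMG.
rewrite subEproper => /orP[/eqP eqNM | ltNM] irr_k irr_eta irr_nu.
  have eqNM' : N = M by apply: val_inj.
  (* [M] occurs in types, so the equality is eliminated rather than rewritten. *)
  case: M / eqNM' {eqNM leMn nsMG} kappa irr_k => kappa irr_k.
  have mult1 mu : pi_irr pi mu -> pi_mult pi mu ('Res[N] kappa) = (kappa == mu)%:R.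
    by rewrite cfRes_id; apply: pi_mult_irr irr_k; apply: free_Ipi.
  rewrite !mult1 // !pnatr_eq0 !eqb0 !negbK => /eqP<- /eqP<-; exact: cfclass_refl.
have [K [nsKG sNK ltKM piMK]] := pi_separable_step sepG nsNG nsMG ltNM.
have sKM := proper_sub ltKM; have sMG := normal_sub nsMG; have Pk := pi_irr_partial irr_k.
case/(pi_mult_Res_transP nsNG nsKG sNK sKM irr_eta Pk) => mu [irr_mu nz_mu mu_eta].
case/(pi_mult_Res_transP nsNG nsKG sNK sKM irr_nu Pk) => xi [irr_xi nz_xi xi_nu].
have /cfclassP[g Mg Dxi] := pi_Clifford_step nsKG nsMG sKM piMK irr_k irr_mu irr_xi nz_mu nz_xi.
have Gg := subsetP sMG g Mg; have nKg := subsetP (normal_norm nsKG) g Gg.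
have irr_eg := pi_irrJ g irr_eta.
have ltKn : (#|K| < n)%N by apply: leq_trans (proper_card ltKM) _.
have /cfclassP[k Kk ->] : nu \in ((eta ^ g)%CF ^: K)%CF.
  apply: (IHn K xi _ _ ltKn nsKG sNK irr_xi irr_eg irr_nu _ xi_nu).
  by rewrite Dxi pi_mult_Res_conj.
apply/cfclassP; exists (g * k)%g; first by rewrite groupM // (subsetP sKM).
by rewrite (cfConjgM _ nsNG) // (subsetP (normal_sub nsKG)).
Qed.

Lemma pi_Clifford_Res N M (kappa : 'CF(M)) (eta : 'CF(N)) :
    N <| G -> M <| G -> N \subset M -> pi_irr pi kappa -> pi_irr pi eta ->
    pi_mult pi eta ('Res[N] kappa) != 0 ->
  'Res[N] kappa = pi_mult pi eta ('Res[N] kappa) *: \sum_(nu <- (eta ^: M)%CF) nu.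
Proof.
move=> nsNG nsMG sNM irr_k irr_eta nz_eta; have freeN := free_Ipi nsNG.
have nsNM := normalS sNM (normal_sub nsMG) nsNG.
have class_irr nu : nu \in (eta ^: M)%CF -> pi_irr pi nu.
  by case/cfclassP=> y _ ->; apply: pi_irrJ.
have rhoS : rho (\sum_(nu <- (eta ^: M)%CF) nu) = \sum_(nu <- (eta ^: M)%CF) nu.
  by rewrite linear_sum /=; apply: eq_big_seq => nu /class_irr/pi_irr_restr.
rewrite -[LHS](pi_partial_restr (pi_partial_Res sNM (pi_irr_partial irr_k))) -rhoS.
rewrite !pi_mult_sum scaler_sumr; apply: eq_big_seq => nu /IpiP irr_nu; rewrite scalerA.
congr (_ *: _); rewrite pi_mult_cfclass //.
have [/cfclassP[y My ->] | not_nu] := boolP (nu \in _).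
  rewrite mulr1 -{1}(cfConjg_id kappa My) pi_mult_Res_conj //.
    exact: subsetP (normG M) y My.
  exact: subsetP (normal_sub nsMG) y My.
by rewrite mulr0; apply: contraNeq not_nu => /(pi_Clifford nsNG nsMG sNM irr_k irr_eta irr_nu nz_eta).
Qed.

(** The multiplicity form of [pi_irr_over]; the two agree once [Ipi pi N] is known to be free. *)
Definition lies_over N M (eta : 'CF(N)) (kappa : 'CF(M)) : Prop :=
  pi_irr pi kappa /\ pi_mult pi eta ('Res[N] kappa) != 0.

Definition mul_correspondence N M (eta : 'CF(N)) (zeta : 'CF(M)) : Prop :=
  let eta_xi := eta * 'Res[N] zeta in
  [/\ forall kappa, lies_over eta kappa -> lies_over eta_xi (kappa * zeta),
      forall kappa1 kappa2, lies_over eta kappa1 -> lies_over eta kappa2 ->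
        kappa1 * zeta = kappa2 * zeta -> kappa1 = kappa2
    & forall psi, lies_over eta_xi psi -> exists2 kappa, lies_over eta kappa & kappa * zeta = psi].

(* [eta] and [eta * 'Res zeta] have the same stabiliser in M; unlike
   M-invariance of [eta], this passes to the intermediate normal subgroups. *)
Definition same_inertia N M (eta : 'CF(N)) (zeta : 'CF(M)) : Prop :=
  forall g, g \in M -> (eta ^ g)%CF * 'Res[N] zeta = eta * 'Res[N] zeta -> (eta ^ g)%CF = eta.

Lemma cfConjg_mul_Res N M (eta : 'CF(N)) (zeta : 'CF(M)) g : N <| M -> g \in M ->
  ((eta * 'Res[N] zeta) ^ g)%CF = (eta ^ g)%CF * 'Res[N] zeta.
Proof.
move=> nsNM Mg; have nNg := subsetP (normal_norm nsNM) g Mg.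
have nMg := subsetP (normG M) g Mg.
by rewrite rmorphM /= (cfConjgRes_norm zeta nNg nMg) (cfConjg_id zeta Mg).
Qed.

(** [same_inertia] makes multiplication by the restriction of [zeta] injective on the orbit of
    [eta], hence a bijection onto the orbit of the product. *)
Lemma cfclass_mul_Res N M (eta : 'CF(N)) (zeta : 'CF(M)) : N <| M -> same_inertia eta zeta ->
  \sum_(nu <- (eta ^: M)%CF) nu * 'Res[N] zeta = \sum_(nu <- ((eta * 'Res[N] zeta) ^: M)%CF) nu.
Proof.
move=> nsNM inertia_eq; rewrite -(big_map (fun nu => nu * 'Res[N] zeta) predT id).
apply: perm_big; apply: uniq_perm; last 1 first; rewrite ?cfclass_uniq //.
- move=> nu; apply/mapP/cfclassP=> [[_ /cfclassP[y My ->] ->] | [y My ->]].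
    by exists y; rewrite ?cfConjg_mul_Res.
  by exists (eta ^ y)%CF; rewrite ?cfConjg_mul_Res //; apply/cfclassP; exists y.
rewrite map_inj_in_uniq ?cfclass_uniq //.
move=> _ _ /cfclassP[x Mx ->] /cfclassP[y My ->] eq_xy.
have Mxy : (x * y^-1)%g \in M by rewrite groupM ?groupV.
have eq_eta : (eta ^ (x * y^-1))%CF = eta.
  apply: inertia_eq => //; rewrite -cfConjg_mul_Res //.
  rewrite (cfConjgM _ nsNM) ?groupV // cfConjg_mul_Res // eq_xy -cfConjg_mul_Res //.
  by rewrite cfConjgK.
by rewrite -{2}eq_eta -(cfConjgM _ nsNM) // mulgKV.
Qed.

Section ChiefStep.

Variables (K M : {group gT}) (mu : 'CF(K)) (zeta : 'CF(M)).
Hypotheses (nsKG : K <| G) (nsMG : M <| G) (sKM : K \subset M).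
Hypotheses (irr_mu : pi_irr pi mu) (Pz : pi_partial_char pi zeta).
Hypotheses (irr_mz : pi_irr pi (mu * 'Res[K] zeta)) (inertia_eq : same_inertia mu zeta).
Let mz := mu * 'Res[K] zeta.

Let nsKM : K <| M. Proof. exact: normalS (normal_sub nsMG) nsKG. Qed.
Let freeK : free (I K). Proof. exact: free_Ipi. Qed.
Let freeM : free (I M). Proof. exact: free_Ipi. Qed.
Let fongK := (fong_lift nsKG).1.
Let liftK := (fong_lift nsKG).2.

Let Res_mul kappa : lies_over mu kappa ->
  'Res[K] (kappa * zeta) = pi_mult pi mu ('Res[K] kappa) *: \sum_(nu <- (mz ^: M)%CF) nu.
Proof.
case=> irr_k nz_k; rewrite rmorphM /= {1}(pi_Clifford_Res nsKG nsMG sKM irr_k irr_mu nz_k).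
by rewrite -scalerAl mulr_suml cfclass_mul_Res.
Qed.

(** Over [mu], as over [mz], there is exactly one irreducible partial character, determined by its
    restriction to [K], the orbit sum. By [Res_mul] the product with [zeta] has the right
    restriction. *)
Lemma mul_correspondence_pi' : pi^'.-group (M / K)%g -> mul_correspondence mu zeta.
Proof.
move=> pi'MK; have [oddMK u_inv] := index_pi' nsMG sKM pi'MK nsKG.
have resE (nu : 'CF(K)) (kappa : 'CF(M)) : pi_irr pi nu -> lies_over nu kappa ->
    'Res[K] kappa = \sum_(xi <- (nu ^: M)%CF) xi.
  move=> irr_nu [irr_k nz_k].
  have [xi irr_xi Dk] := pi'_irr_Res nsKG nsMG sKM pi'MK oddMK u_inv fongK liftK irr_k.
  rewrite Dk; apply/esym/cfclass_sum => //.
  by move: nz_k; rewrite Dk pi_mult_cfclass // pnatr_eq0 eqb0 negbK.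
have over_exists (nu : 'CF(K)) : pi_irr pi nu -> exists kappa : 'CF(M), lies_over nu kappa.
  move=> irr_nu; have [kappa irr_k Dk] :=
    pi'_irr_exists nsKG nsMG sKM pi'MK oddMK u_inv fongK liftK irr_nu.
  by exists kappa; split; rewrite // Dk pi_mult_cfclass // cfclass_refl oner_eq0.
have mulE (kappa psi : 'CF(M)) : lies_over mu kappa -> lies_over mz psi -> kappa * zeta = psi.
  move=> k_mu psi_mz; have [[irr_k _] [irr_psi _]] := (k_mu, psi_mz).
  have Pkz := pi_partialM (pi_irr_partial irr_k) Pz.
  apply: (pi_restr_eq_Res nsKG nsMG sKM pi'MK (pi_partial_restr Pkz) (pi_irr_restr irr_psi)).
  by rewrite (resE mz psi) // Res_mul // (resE mu kappa) // pi_mult_cfclass // cfclass_refl scale1r.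
split=> [kappa k_mu | k1 k2 k1_mu k2_mu _ | psi psi_mz].
- by have [psi psi_mz] := over_exists _ irr_mz; rewrite (mulE _ _ k_mu psi_mz).
- apply: (pi_restr_eq_Res nsKG nsMG sKM pi'MK); rewrite ?pi_irr_restr ?(resE mu) //.
    by case: k1_mu.
  by case: k2_mu.
by have [kappa k_mu] := over_exists _ irr_mu; exists kappa => //; apply: mulE.
Qed.

Lemma mul_correspondence_pi : pi.-group (M / K)%g -> mul_correspondence mu zeta.
Proof.
move=> piMK; have recip := pi_reciprocity nsKM (normal_sub nsMG) piMK fongK liftK.
have irrM psi : psi \in I M -> pi_irr pi psi by move/IpiP.
pose over (nu : 'CF(K)) := [seq psi <- I M | pi_mult pi nu ('Res[K] psi) != 0].
have overP nu psi : reflect (lies_over nu psi) (psi \in over nu).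
  by rewrite mem_filter andbC; apply: (iffP andP) => -[/IpiP].
pose m kappa psi := pi_mult pi psi (kappa * zeta).
pose e (nu : 'CF(K)) (psi : 'CF(M)) := pi_mult pi nu ('Res[K] psi).
have Pmul kappa : pi_irr pi kappa -> pi_partial_char pi (kappa * zeta).
  by move/pi_irr_partial=> Pk; apply: pi_partialM.
have e_gt0 nu : pi_irr pi nu -> {in over nu, forall psi, 0 < e nu psi}.
  move=> irr_nu psi /overP[irr_psi nz_e]; rewrite lt0r nz_e natr_ge0 //.
  exact: pi_mult_partial_nat (pi_partial_Res sKM (pi_irr_partial irr_psi)) irr_nu.
have mulE kappa : pi_irr pi kappa -> kappa * zeta = \sum_(psi <- I M) m kappa psi *: psi.
  by move=> /Pmul Pk; rewrite -[LHS](pi_partial_restr Pk) pi_mult_sum.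
(* A constituent of the restriction of [psi] occurs in that of [kappa * zeta], so it is conjugate to
   [mz]; invariance of [psi] under [M] moves it to [mz]. Hence no term of [kappa * zeta] falls
   outside [over mz]. *)
have over_mz kappa psi : lies_over mu kappa -> pi_irr pi psi -> m kappa psi != 0 -> lies_over mz psi.
  move=> k_mu irr_psi nz_m; have [irr_k nz_k] := k_mu; split=> //.
  have [nu irr_nu nz_nu] := pi_partial_mult_neq0 (pi_partial_Res sKM (pi_irr_partial irr_psi)).
  have: pi_mult pi nu ('Res[K] (kappa * zeta)) != 0.
    apply/(pi_mult_Res_transP nsKG nsMG sKM (subxx M) irr_nu (Pmul _ irr_k)).
    by exists psi; rewrite cfRes_id.
  rewrite Res_mul // linearZ /= pi_mult_cfclass // mulf_eq0 (negPf nz_k) pnatr_eq0 eqb0 negbK.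
  case/cfclassP=> y My Dnu; have Gy := subsetP (normal_sub nsMG) y My.
  have nMy := subsetP (normG M) y My.
  by move: nz_nu; rewrite Dnu -{1}(cfConjg_id psi My) pi_mult_Res_conj.
have e_mul kappa : lies_over mu kappa -> e mz (kappa * zeta) = e mu kappa.
  by move=> k_mu; rewrite /e Res_mul // linearZ /= pi_mult_cfclass // cfclass_refl mulr1.
have mulIE psi : pi_irr pi psi -> e mz psi = \sum_(kappa <- I M) e mu kappa * m kappa psi.
  move=> irr_psi; rewrite /e -recip // cfIndM //.
  have /pi_partial_restr <- := pi_partial_Ind sKM (pi_irr_partial irr_mu).
  rewrite pi_mult_sum mulr_suml linear_sum; apply: eq_big_seq => kappa /irrM irr_k.
  by rewrite -scalerAl linearZ /= recip.
have permP : {in over mu, forall kappa, exists2 psi, psi \in over mz & [/\ m kappa psi = 1,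
      {in over mu, forall kappa', kappa' != kappa -> m kappa' psi = 0}
    & {in over mz, forall psi', psi' != psi -> m kappa psi' = 0}]}.
  apply: (nat_matrix_perm (e := e mu) (f := e mz)); rewrite ?filter_uniq ?Ipi_uniq //.
  - move=> kappa psi /overP[irr_k _] /overP[irr_psi _].
    by apply: pi_mult_partial_nat => //; apply: Pmul.
  - exact: e_gt0.
  - exact: e_gt0.
  - move=> kappa /overP[irr_k nz_k]; rewrite -e_mul // /e {1}mulE // !linear_sum.
    rewrite big_filter [RHS]big_mkcond; apply: eq_bigr => psi _.
    by rewrite !linearZ /=; case: eqP => //= ->; rewrite mulr0.
  move=> psi /overP[irr_psi _]; rewrite mulIE // big_filter [RHS]big_mkcond.
  by apply: eq_bigr => kappa _; rewrite /e mulrC; case: eqP => //= ->; rewrite mulr0.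
have prodP kappa : lies_over mu kappa -> exists2 psi, psi \in over mz & [/\ kappa * zeta = psi,
      {in over mu, forall kappa', m kappa' psi != 0 -> kappa' = kappa}
    & {in over mz, forall psi', m kappa psi' != 0 -> psi' = psi}].
  move=> k_mu; have [irr_k _] := k_mu.
  have [psi psi_mz [m1 m0l m0r]] := permP _ (introT (overP _ _) k_mu); exists psi => //.
  have Ipsi : psi \in I M by move: psi_mz; rewrite mem_filter => /andP[].
  split; last first.
  - by move=> psi' /m0r m0; apply: contraNeq => /m0->.
  - by move=> kappa' /m0l m0; apply: contraNeq => /m0->.
  rewrite mulE // (bigD1_seq psi) ?Ipi_uniq //= m1 scale1r big_seq_cond big1 ?addr0 //.
  move=> psi' /andP[/irrM irr_psi' ne]; have [-> | nz_m] := eqVneq (m kappa psi') 0; first exact: scale0r.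
  by rewrite m0r ?scale0r //; apply/overP/(over_mz kappa).
have m_prod kappa psi : lies_over mu kappa -> psi \in over mz -> kappa * zeta = psi -> m kappa psi != 0.
  by move=> _ /overP[irr_psi _] Dpsi; rewrite /m Dpsi pi_mult_irr // eqxx oner_eq0.
split=> [kappa k_mu | k1 k2 k1_mu k2_mu eq_k | psi psi_mz].
- by have [psi /overP psi_mz [-> _ _]] := prodP _ k_mu.
- have [psi psi_mz [Dpsi inj_psi _]] := prodP _ k2_mu.
  by apply: inj_psi; [apply/overP | apply: m_prod; rewrite // eq_k].
have [irr_psi nz_psi] := psi_mz; have [kappa Ik nz_k] : exists2 kappa, kappa \in over mu & m kappa psi != 0.
  apply/hasP; apply: contraR nz_psi => /hasPn m0; rewrite [pi_mult _ _ _]mulIE //.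
  rewrite big1_seq // => kappa /= Ik; have [-> | nz] := eqVneq (e mu kappa) 0; first by rewrite mul0r.
  have /m0 : kappa \in over mu by rewrite mem_filter Ik andbT.
  by rewrite negbK => /eqP->; rewrite mulr0.
have /overP k_mu := Ik; exists kappa => //.
have [psi' _ [-> _ uniq_psi']] := prodP _ k_mu.
by apply/esym/uniq_psi' => //; apply/overP.
Qed.

End ChiefStep.

Lemma lies_over_conj N K (eta : 'CF(N)) (mu : 'CF(K)) g : N <| G -> K <| G -> g \in G ->
  pi_irr pi eta -> lies_over eta mu -> lies_over (eta ^ g)%CF (mu ^ g)%CF.
Proof.
move=> nsNG nsKG Gg irr_eta [irr_mu nz_mu]; split; first exact: pi_irrJ.
by rewrite pi_mult_Res_conj // (subsetP (normal_norm nsKG)).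
Qed.

Lemma lies_over_trans N K M (eta : 'CF(N)) (kappa : 'CF(M)) :
    N <| G -> K <| G -> N \subset K -> K \subset M -> pi_irr pi eta ->
  lies_over eta kappa <-> exists2 mu : 'CF(K), lies_over eta mu & lies_over mu kappa.
Proof.
move=> nsNG nsKG sNK sKM irr_eta.
have transP irr_k := pi_mult_Res_transP nsNG nsKG sNK sKM irr_eta (@pi_irr_partial _ _ _ kappa irr_k).
split=> [[irr_k /(transP irr_k)[mu [irr_mu nz_k nz_mu]]] | [mu [irr_mu nz_mu] [irr_k nz_k]]].
  by exists mu.
by split=> //; apply/(transP irr_k); exists mu.
Qed.

(** The correspondences from [N] to [K] and from each [mu] over [eta] to [M] are composed. Since
    [kappa] determines [mu] only up to [M]-conjugacy, injectivity requires control over which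
    conjugates still lie over [eta]. *)
Lemma pi_mul_correspondence N M (eta : 'CF(N)) (zeta : 'CF(M)) :
    N <| G -> M <| G -> N \subset M -> pi_irr pi eta -> pi_partial_char pi zeta ->
    pi_irr pi (eta * 'Res[N] zeta) -> same_inertia eta zeta ->
  mul_correspondence eta zeta.
Proof.
move=> nsNG; have [n] := ubnP #|M|; elim: n M zeta => // n IHn M zeta leMn nsMG.
rewrite subEproper => /orP[/eqP eqNM | ltNM] irr_eta Pz irr_ez inertia_eq.
  have eqNM' : N = M by apply: val_inj.
  case: M / eqNM' {eqNM leMn nsMG} zeta Pz irr_ez inertia_eq => zeta _ irr_ez _.
  have overE (nu kappa : 'CF(N)) : pi_irr pi nu -> lies_over nu kappa <-> kappa = nu.
    move=> irr_nu; rewrite /lies_over cfRes_id; split=> [[irr_k] | ->].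
      by rewrite pi_mult_irr ?free_Ipi // pnatr_eq0 eqb0 negbK => /eqP.
    by rewrite pi_mult_irr ?free_Ipi // eqxx oner_eq0.
  split=> [kappa | k1 k2 | psi].
  - by move/(overE eta) => -> //; apply/overE; rewrite // cfRes_id.
  - by move=> /(overE eta)-> // /(overE eta)-> //.
  by move/overE=> -> //; exists eta; [apply/overE | rewrite cfRes_id].
have [K [nsKG sNK ltKM piMK]] := pi_separable_step sepG nsNG nsMG ltNM.
have sKM := proper_sub ltKM; have sMG := normal_sub nsMG.
have nsNM := normalS (subset_trans sNK sKM) sMG nsNG; have nsKM := normalS sKM sMG nsKG.
have nsNK := normalS sNK (normal_sub nsKG) nsNG.
pose zK := 'Res[K] zeta; have resN : 'Res[N] zK = 'Res[N] zeta by rewrite cfResRes.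
have ltKn : (#|K| < n)%N by apply: leq_trans (proper_card ltKM) _.
have [] := IHn K zK ltKn nsKG sNK irr_eta (pi_partial_Res sKM Pz); rewrite ?resN //.
  by move=> g Kg; rewrite resN; apply: inertia_eq; apply: subsetP Kg.
move=> mulK injK surjK.
have transM := lies_over_trans _ nsNG nsKG sNK sKM.
(* The products of [eta] and [eta ^ g] with the restriction of [zeta] lie below the same member of
   [I K], so some [k] in [K] carries the first to the second. By [same_inertia], [g * k^-1] fixes
   [eta], while [k] fixes [mu ^ g]. *)
have conj_over (mu : 'CF(K)) g : g \in M -> lies_over eta mu ->
    lies_over (eta * 'Res[N] zeta) ((mu ^ g)%CF * zK) -> lies_over eta (mu ^ g)%CF.
  move=> Mg mu_eta mgz; have Gg := subsetP sMG g Mg.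
  have irr_eg := pi_irrJ g irr_eta.
  have mug_eg := lies_over_conj nsNG nsKG Gg irr_eta mu_eta.
  have := lies_over_conj nsNG nsKG Gg irr_ez (mulK _ mu_eta).
  rewrite !cfConjg_mul_Res // => -[irr_mgz nz_eg]; have [_ nz_e] := mgz.
  have irr_egz : pi_irr pi ((eta ^ g)%CF * 'Res[N] zeta).
    by rewrite -cfConjg_mul_Res //; apply: pi_irrJ.
  have /cfclassP[k Kk] := pi_Clifford nsNG nsKG sNK irr_mgz irr_ez irr_egz nz_e nz_eg.
  have Mk := subsetP sKM k Kk; rewrite cfConjg_mul_Res // => eq_gk.
  have eq_eta : (eta ^ (g * k^-1))%CF = eta.
    apply: inertia_eq; rewrite ?groupM ?groupV // -cfConjg_mul_Res ?groupM ?groupV //.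
    rewrite (cfConjgM _ nsNM) ?groupV // cfConjg_mul_Res // eq_gk -cfConjg_mul_Res //.
    by rewrite cfConjgK.
  have -> : (mu ^ g = (mu ^ g) ^ k^-1)%CF by rewrite (cfConjg_id _ (groupVr Kk)).
  rewrite -eq_eta (cfConjgM _ nsNM) ?groupV //.
  by apply: lies_over_conj; rewrite ?groupV // (subsetP sMG).
have chief (mu : 'CF(K)) : lies_over eta mu -> mul_correspondence mu zeta.
  move=> mu_eta; have [irr_mu _] := mu_eta; have mz := mulK _ mu_eta; have [irr_mz _] := mz.
  (* Injectivity over [K] holds only among characters over [eta]; [conj_over] places [mu ^ g]
     there. *)
  have inertia_mu : same_inertia mu zeta.
    move=> g Mg eq_g; apply: injK => //; apply: conj_over => //.
    by rewrite /zK eq_g.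
  case/orP: piMK; last exact: mul_correspondence_pi'.
  exact: mul_correspondence_pi.
split=> [kappa | k1 k2 | psi].
- case/transM=> // mu mu_eta; have [mulM _ _] := chief mu mu_eta; move/mulM=> kz.
  by apply/transM => //; exists (mu * zK); first exact: mulK.
- case/transM=> // mu1 mu1_eta k1_mu1 /transM[] // mu2 mu2_eta k2_mu2 eq_k.
  have [[irr_mu1 _] [irr_mu2 _]] := (mu1_eta, mu2_eta).
  have [[mul1 inj1 _] [mul2 inj2 _]] := (chief _ mu1_eta, chief _ mu2_eta).
  have [mz1 mz2] := (mulK _ mu1_eta, mulK _ mu2_eta).
  have [irr_k1z nz1] := mul1 _ k1_mu1; have [_ nz2] := mul2 _ k2_mu2; rewrite -eq_k in nz2.
  (* The products of [mu1] and [mu2] with [zK] lie below the common product, so they are conjugate.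
     Cancelling [zK] gives [mu2 = mu1 ^ g], whence [k1] also lies over [mu2] and injectivity over
     [mu2] applies. *)
  have /cfclassP[g Mg] := pi_Clifford nsKG nsMG sKM irr_k1z (proj1 mz1) (proj1 mz2) nz1 nz2.
  have Gg := subsetP sMG g Mg.
  rewrite cfConjg_mul_Res // => Dmz2.
  have Dmu2 : mu2 = (mu1 ^ g)%CF.
    by apply: injK => //; apply: conj_over => //; rewrite /zK -Dmz2.
  apply: inj2 => //; rewrite Dmu2 -(cfConjg_id k1 Mg).
  exact: lies_over_conj.
case/transM=> // mz /surjK[mu mu_eta <-]; have [_ _ surjM] := chief mu mu_eta.
case/surjM=> kappa k_mu <-.
by exists kappa => //; apply/transM => //; exists mu.
Qed.

End Correspondence.
Theorem theorem4 (gT : finGroupType) (pi : nat_pred) (G N : {group gT})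
  (sepG : pi_separable pi G) (nsNG : N <| G)
  (pi2 : 2%N \in pi \/ odd #|G|)
  (eta xi : 'CF(N)) (zeta : 'CF(G))
  (eta_irr : pi_irr pi eta) (xi_irr : pi_irr pi xi)
  (eta_inv : G \subset 'I[eta])
  (zeta_irr : pi_irr pi zeta) (zeta_ext : 'Res[N] zeta = xi)
  (eta_xi_irr : pi_irr pi (eta * xi)) :
  [/\ forall kappa : 'CF(G),
        pi_irr_over pi eta kappa -> pi_irr_over pi (eta * xi) (kappa * zeta),
      forall kappa1 kappa2 : 'CF(G),
        pi_irr_over pi eta kappa1 -> pi_irr_over pi eta kappa2 ->
        kappa1 * zeta = kappa2 * zeta -> kappa1 = kappa2
    & forall mu : 'CF(G), pi_irr_over pi (eta * xi) mu ->
        exists2 kappa : 'CF(G), pi_irr_over pi eta kappa & kappa * zeta = mu].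
Proof.
have sNG := normal_sub nsNG; have Pz := pi_irr_partial zeta_irr.
have [u [index_pi' fong_lift]] := pi_fong_lifting sepG pi2.
have freeN := free_Ipi fong_lift nsNG.
have overE (nu : 'CF(N)) (kappa : 'CF(G)) :
    pi_irr pi nu -> pi_irr_over pi nu kappa <-> lies_over pi nu kappa.
  move=> irr_nu; have consP irr_k := pi_constituentP freeN nu
    (pi_partial_restr (pi_partial_Res sNG (@pi_irr_partial _ _ _ kappa irr_k))).
  by split=> -[irr_k]; [case/(consP irr_k) | split=> //; apply/(consP irr_k)].
have [||mulG injG surjG] :=
  pi_mul_correspondence sepG index_pi' fong_lift nsNG (normal_refl G) sNG eta_irr Pz.
- by rewrite zeta_ext.
(* Invariance of [eta] under [G] gives [same_inertia] outright. *)
- by move=> g Gg _; apply/inertiaJ/(subsetP eta_inv).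
rewrite zeta_ext in mulG surjG.
have [over_eta over_mul] := (overE _ ^~ eta_irr, overE _ ^~ eta_xi_irr).
split=> [kappa | k1 k2 | psi].
- by move=> /over_eta/mulG/over_mul.
- by move=> /over_eta k1_eta /over_eta; apply: injG.
by move=> /over_mul/surjG[kappa /over_eta]; exists kappa.
Qed.
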